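(* Let $X=(X(z))_{z\in\mathbb{Z}^2}$ be an array of i.i.d. nonnegative random variables, let $d_X$ be its lattice last passage metric, and let $\rho,\alpha,\beta,\chi,\tau>0$. For $p=(x,s)\in\mathbb{R}^2$ let $(p)_n=(\lfloor\rho ns+\tau n^{2/3}x\rfloor,\lfloor-ns\rfloor)$ and define $$d_n(x,s;y,t)=\frac{d_X\big((x,s)_n,(y,t)_n\big)-\alpha n(t-s)-\beta\tau n^{2/3}(y-x)}{\chi n^{1/3}}.$$ Suppose that $d_n$ converges to the directed landscape $\mathcal{L}$ in the multi-time sense. Let $U=\{(0,0;x,1):-3\le x\le3\}$. If for some $\delta>0$, $$\limsup_{n\to\infty}\ \sup_{u\in U}\ \mathbb{E}\big(d_n(u)^-\big)^{5+\delta}<\infty,$$ then in some coupling of the $d_n$ and $\mathcal{L}$, $d_n\to\mathcal{L}$ uniformly on compact subsets of $\mathbb{R}^4_\uparrow$, almost surely.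
   Context: $a^-=\max(-a,0)$; $\mathbb{R}^4_\uparrow=\{(x,s;y,t)\in\mathbb{R}^4:s<t\}$; $\bar{\mathbb{R}}=[-\infty,\infty]$. Lattice last passage metric: for $a,b\in\mathbb{Z}^2$, $d_X(a,b)=\max_\pi\sum_{z\in\pi,z\ne a}X(z)$ over lattice paths $\pi$ from $a$ to $b$ with steps in $\{(1,0),(0,-1)\}$, and $-\infty$ if there is no such path. Multi-time convergence: for every finite or countable collection of pairs $s_i<t_i$, the random functions $d_n(\cdot,s_i;\cdot,t_i)$ converge jointly in distribution to $\mathcal{L}(\cdot,s_i;\cdot,t_i)$, in the product over $i$ of the graph topologies. The graph topology on functions $f:\mathbb{R}^2\to\bar{\mathbb{R}}$: $\mathfrak{g}f$ is the closure of $\{(r,f(r))\}$ in $\mathbb{R}^2\times\bar{\mathbb{R}}$; with $E'(r,a)=(r,e^{-|r|}a/(1+|a|))$ (and $a/(1+|a|)=\pm1$ at $\pm\infty$) the distance of $f,g$ is the Hausdorff distance between $E'(\mathfrak{g}f)$ and $E'(\mathfrak{g}g)$. Parabolic Airy line ensemble. The random continuous $\mathfrak{A}:\mathbb{N}\times\mathbb{R}\to\mathbb{R}$ with $\mathfrak{A}_1>\mathfrak{A}_2>\cdots$ such that for any times $t_1,\dots,t_m$ the point process $\{(t_j,\mathfrak{A}_i(t_j)+t_j^2)\}$ is determinantal with the extended Airy kernel $K(s,x;t,y)=\int_0^\infty e^{-\lambda(s-t)}\mathrm{Ai}(x+\lambda)\mathrm{Ai}(y+\lambda)d\lambda$ for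 $s\ge t$, $-\int_{-\infty}^0e^{-\lambda(s-t)}\mathrm{Ai}(x+\lambda)\mathrm{Ai}(y+\lambda)d\lambda$ for $s<t$. For continuous $f=(f_i)$: $f[(x,n)\to(y,m)]=\sup\sum_{i=m}^n(f_i(t_{i-1})-f_i(t_i))$ over $x=t_n\le\dots\le t_{m-1}=y$. Airy sheet. The random continuous $\mathcal{S}:\mathbb{R}^2\to\mathbb{R}$ (unique in law) with $\mathcal{S}(\cdot+t,\cdot+t)\overset{d}{=}\mathcal{S}$ for all $t$, that can be coupled with $\mathfrak{A}$ so that $\mathcal{S}(0,\cdot)=\mathfrak{A}_1$ and for all $(x,y,z)\in\mathbb{Q}^+\times\mathbb{Q}^2$ a.s. for all sufficiently large (random) $k$, $\mathfrak{A}[(-\sqrt{k/(2x)},k)\to(z,1)]-\mathfrak{A}[(-\sqrt{k/(2x)},k)\to(y,1)]=\mathcal{S}(x,z)-\mathcal{S}(x,y)$. Airy sheet of scale $r$: $r\mathcal{S}(x/r^2,y/r^2)$. Directed landscape. The random $\mathcal{L}:\mathbb{R}^2\times\mathbb{R}^2\to\mathbb{R}\cup\{-\infty\}$ (unique in law), continuous and finite on $\mathbb{R}^4_\uparrow$, $0$ on the diagonal, $-\infty$ elsewhere; for disjoint $(s_i,t_i)$ the functions $\mathcal{L}(\cdot,s_i;\cdot,t_i)$ are independent Airy sheets of scale $(t_i-s_i)^{1/3}$; a.s. $\mathcal{L}(x,r;y,t)=\max_z[\mathcal{L}(x,r;z,s)+\mathcal{L}(z,s;y,t)]$ for all $r<s<t$,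 $x,y$. *)

(* Defs.v *)
From HB Require Import structures.
From mathcomp Require Import all_boot all_order all_algebra.
From mathcomp Require Import all_classical all_reals all_analysis.
From mathcomp Require Import measurable_realfun.

Set Implicit Arguments.
Unset Strict Implicit.
Unset Printing Implicit Defensive.

Import Order.TTheory GRing.Theory Num.Theory.
Import numFieldNormedType.Exports.

Local Open Scope classical_set_scope.
Local Open Scope ring_scope.

Definition random_function d (T : measurableType d) dV (V : measurableType dV)
    (I : Type) (F : T -> I -> V) : Prop :=
  forall i, measurable_fun setT (fun w => F w i).

(** Equality of the laws on the product sigma-algebra of [I -> V]; the finite
cylinder sets form a pi-system generating it. *)
Definition same_law (R : realType) dV (V : measurableType dV) (I : Type)
    d (T : measurableType d) (P : probability T R) (F : T -> I -> V)
    d' (T' : measurableType d') (P' : probability T' R) (F' : T' -> I -> V)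
    : Prop :=
  forall (m : nat) (p : 'I_m -> I) (B : 'I_m -> set V),
    (forall j, measurable (B j)) ->
    P [set w | forall j, B j (F w (p j))] =
    P' [set w | forall j, B j (F' w (p j))].

Definition sigma_of d (T : measurableType d) dV (V : measurableType dV)
    (I : Type) (F : T -> I -> V) : set (set T) :=
  <<s [set E | exists i, exists2 B, measurable B &
                 E = (fun w => F w i) @^-1` B] >>.

Definition independent (R : realType) d (T : measurableType d)
    (P : probability T R) (I : choiceType) (G : I -> set (set T)) : Prop :=
  forall (s : seq I) (E : I -> set T), uniq s -> (forall i, G i (E i)) ->
    P (\bigcap_(i in [set` s]) E i) = (\prod_(i <- s) P (E i))%E.

Definition iid (R : realType) d (T : measurableType d) (P : probability T R)
    (I : choiceType) (X : T -> I -> R) : Prop :=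
  [/\ random_function X,
      independent P
        (fun i => sigma_of (fun (w : T) (_ : unit) => X w i)) &
      forall i j, same_law P (fun w (_ : unit) => X w i)
                           P (fun w (_ : unit) => X w j)].

Definition cvg_in_distribution (R : realType) (Z : topologicalType)
    d (T : measurableType d) (P : probability T R) (Y : nat -> T -> Z)
    d' (T' : measurableType d') (P' : probability T' R) (Y' : T' -> Z)
    : Prop :=
  forall phi : Z -> R, continuous phi ->
    (exists M : R, forall z, `|phi z| <= M) ->
    (fun n => \int[P]_w (phi (Y n w))%:E)%E @ \oo -->
    (\int[P']_w (phi (Y' w))%:E)%E.

Section Hausdorff.
Context {R : realType} {V : normedModType R}.
Implicit Types (A B C : set V) (e : R).

Definition hausdorff_within e A B : Prop :=
  (forall a, A a -> exists2 b, B b & `|a - b| < e) /\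
  (forall b, B b -> exists2 a, A a & `|a - b| < e).

Definition hausdorff_dist A B : R :=
  inf [set e | 0 < e /\ hausdorff_within e A B].

Lemma hausdorff_within_sym e A B :
  hausdorff_within e A B -> hausdorff_within e B A.
Proof.
by move=> [h1 h2]; split=> x /[dup] _ => [/h2|/h1] [y Hy xy]; exists y => //;
  rewrite distrC.
Qed.

Lemma hausdorff_within_trans e1 e2 A B C :
  hausdorff_within e1 A B -> hausdorff_within e2 B C ->
  hausdorff_within (e1 + e2) A C.
Proof.
move=> [h1 h2] [k1 k2]; split.
- move=> a /h1[b /k1[c Cc bc] ab]; exists c => //.
  by rewrite -(subrKA b); apply: (le_lt_trans (ler_normD _ _)); exact: ltrD.
- move=> c /k2[b /h2[a Aa ab] bc]; exists a => //.
  by rewrite -(subrKA b); apply: (le_lt_trans (ler_normD _ _)); exact: ltrD.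
Qed.

Lemma hausdorff_dist_lt e A B :
  (exists e0, 0 < e0 /\ hausdorff_within e0 A B) ->
  hausdorff_dist A B < e <->
  exists2 e', e' < e & 0 < e' /\ hausdorff_within e' A B.
Proof.
move=> H; split.
- by move=> /inf_lt -/(_ H)[e' He' e'e]; exists e'.
- move=> [e' e'e He']; apply: le_lt_trans e'e; apply: ge_inf => //.
  by exists 0 => x [/ltW].
Qed.

End Hausdorff.

Section GraphTopology.
Context {R : realType}.

(** A named copy of the function type, to carry the graph topology. *)
Definition gfun : Type := (R * R)%type -> \bar R.

Definition plane_norm (r : R * R) : R := Num.sqrt (r.1 ^+ 2 + r.2 ^+ 2).

Definition graph_closure (f : gfun) : set ((R * R) * \bar R) :=
  closure [set p | p.2 = f p.1].

(** [contract a] is [a / (1 + |a|)], extended by [1] and [-1] at infinity. *)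
Definition graph_embed (p : (R * R) * \bar R) : (R * R) * R :=
  (p.1, expR (- plane_norm p.1) * contract p.2).

(** [(R * R) * R] carries the maximum norm, which is equivalent to the
Euclidean one; the Hausdorff distances are then equivalent too. *)
Definition graph_dist (f g : gfun) : R :=
  hausdorff_dist (graph_embed @` graph_closure f)
                 (graph_embed @` graph_closure g).

Let gball (f : gfun) (e : R) (g : gfun) : Prop := graph_dist f g < e.

Let graph_closure_le (f g : gfun) :
  forall a, (graph_embed @` graph_closure f) a ->
    exists2 b, (graph_embed @` graph_closure g) b & `|a - b| < 3.
Proof.
move=> _ [[r a] _ <-]; exists (graph_embed (r, g r)).
  by exists (r, g r) => //; apply: subset_closure.
rewrite /graph_embed prod_normE/= subrr normr0 gt_max ltr0n/= -mulrBr normrM.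
have e1 : `|expR (- plane_norm r)| <= 1.
  by rewrite ger0_norm ?expR_ge0// -[leRHS]expR0 ler_expR oppr_le0 sqrtr_ge0.
have c2 : `|contract a - contract (g r)| <= 2.
  apply: le_trans (ler_normB _ _) _.
  by rewrite -[2]/(1 + 1); apply: lerD; exact: contract_le1.
apply: (@le_lt_trans _ _ (1 * 2)); last by rewrite mul1r ltr_nat.
exact: ler_pM.
Qed.

Let graph_within (f g : gfun) : exists e, 0 < e /\
  hausdorff_within e (graph_embed @` graph_closure f)
                     (graph_embed @` graph_closure g).
Proof.
exists 3; split; first by rewrite ltr0n.
split; first exact: graph_closure_le.
by move=> b /(@graph_closure_le g f)[a Ha ab]; exists a => //; rewrite distrC.
Qed.

Let gball_center f (e : R) : 0 < e -> gball f e f.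
Proof.
move=> e0; apply/(hausdorff_dist_lt _ (graph_within f f)).
exists (e / 2); first by rewrite ltr_pdivrMr// ltr_pMr// ltr1n.
split; first exact: divr_gt0.
by split=> a Ha; exists a => //; rewrite subrr normr0 divr_gt0.
Qed.

Let gball_sym f g (e : R) : gball f e g -> gball g e f.
Proof.
move=> /(hausdorff_dist_lt _ (graph_within f g))[e' e'e [e'0 H]].
apply/(hausdorff_dist_lt _ (graph_within g f)); exists e' => //.
by split=> //; exact: hausdorff_within_sym.
Qed.

Let gball_triangle f g h (e1 e2 : R) :
  gball f e1 g -> gball g e2 h -> gball f (e1 + e2) h.
Proof.
move=> /(hausdorff_dist_lt _ (graph_within f g))[a ae [a0 H]].
move=> /(hausdorff_dist_lt _ (graph_within g h))[b be [b0 K]].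
apply/(hausdorff_dist_lt _ (graph_within f h)).
exists (a + b); first exact: ltrD.
by split; [exact: addr_gt0 | exact: hausdorff_within_trans H K].
Qed.

HB.instance Definition _ := gen_eqMixin gfun.
HB.instance Definition _ := gen_choiceMixin gfun.
HB.instance Definition _ := hasNbhs.Build gfun (nbhs_ (entourage_ gball)).
HB.instance Definition _ := @Nbhs_isPseudoMetric.Build R gfun
  (entourage_ gball) erefl gball gball_center gball_sym gball_triangle erefl.

End GraphTopology.
Arguments gfun : clear implicits.

Section Airy.
Context {R : realType}.
Local Notation mu := (@lebesgue_measure R).

(** [Ai x] is the improper integral of [cos (t^3/3 + x t) / pi] over
[0 <= t]; it is only conditionally convergent. *)
Definition Ai (x : R) : R :=
  pi^-1 * lim ((\int[mu]_(t in `[0, M]) cos (t ^+ 3 / 3 + x * t)) @[M --> +oo]).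

Definition extended_airy_kernel (s x t y : R) : R :=
  if t <= s then
    \int[mu]_(l in `[0, +oo[) (expR (- l * (s - t)) * Ai (x + l) * Ai (y + l))
  else
    - \int[mu]_(l in `]-oo, 0])
        (expR (- l * (s - t)) * Ai (x + l) * Ai (y + l)).

(** Iterated Lebesgue integral of [f [:: x_0; ...; x_(k-1)]] over
[x_0 \in B_0, ..., x_(k-1) \in B_(k-1)]. *)
Fixpoint iterated_integral (Bs : seq (set R)) (f : seq R -> \bar R) : \bar R :=
  if Bs is B :: Bs' then
    (\int[mu]_(x in B) iterated_integral Bs' (fun xs => f (x :: xs)))%E
  else f [::].

(** The point process [{(j, p w j i) : j < m, i : nat}] on ['I_m * R] is
determinantal with kernel [K] with respect to counting times Lebesgue measure:
its [k]-th factorial moment measure has density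
[\det (K (j a) (x a) (j b) (x b))_(a, b < k)]. *)
Definition determinantal d (T : measurableType d) (P : probability T R)
    (m : nat) (p : T -> 'I_m -> nat -> R) (K : 'I_m -> R -> 'I_m -> R -> R)
    : Prop :=
  forall (k : nat) (j : 'I_k -> 'I_m) (B : 'I_k -> set R),
    (forall l, measurable (B l)) ->
    (\int[P]_w \esum_(i in [set i : {ffun 'I_k -> nat} |
                              injective (fun l => (j l, i l))])
        (\prod_(l < k) \1_(B l) (p w (j l) (i l)))%:E)%E =
    iterated_integral [seq B l | l <- enum 'I_k]
      (fun xs => (\det (\matrix_(a < k, b < k)
                     K (j a) (nth 0 xs a) (j b) (nth 0 xs b)))%:E).

(** Lines are numbered from [0]: [A w i] is the [i.+1]-st line. *)
Definition parabolic_airy_line_ensemble d (T : measurableType d)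
    (P : probability T R) (A : T -> nat -> R -> R) : Prop :=
  [/\ random_function (fun w (q : nat * R) => A w q.1 q.2),
      forall w i, continuous (A w i),
      forall w i t, A w i.+1 t < A w i t &
      forall (m : nat) (t : 'I_m -> R), injective t ->
        determinantal P (fun w j i => A w i (t j) + t j ^+ 2)
          (fun j x j' y => extended_airy_kernel (t j) x (t j') y)].

(** The last passage value [f[(x,n) -> (y,m)]]; [u i] is the jump time usually
written [t_(i-1)]. *)
Definition line_last_passage (f : nat -> R -> R) (x : R) (n : nat) (y : R)
    (m : nat) : R :=
  sup [set v | exists u : nat -> R,
    [/\ u n.+1 = x, u m = y,
        forall i, (m <= i <= n)%N -> u i.+1 <= u i &
        v = \sum_(m <= i < n.+1) (f i (u i) - f i (u i.+1))]].

(** With lines numbered from [0], the top [k] lines are [0], ..., [k.-1]. *)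
Definition airy_sheet_coupling d (T : measurableType d) (P : probability T R)
    (S : T -> R * R -> R) (A : T -> nat -> R -> R) : Prop :=
  {ae P, forall w, forall y, S w (0, y) = A w 0%N y} /\
  forall x y z : rat, 0 < x ->
    {ae P, forall w, \forall k \near \oo,
      let a := - Num.sqrt (k%:R / (2 * ratr x)) in
      line_last_passage (A w) a k.-1 (ratr z) 0 -
      line_last_passage (A w) a k.-1 (ratr y) 0 =
      S w (ratr x, ratr z) - S w (ratr x, ratr y)}.

Definition airy_sheet d (T : measurableType d) (P : probability T R)
    (S : T -> R * R -> R) : Prop :=
  [/\ random_function S,
      forall w, continuous (S w),
      forall t : R, same_law P (fun w q => S w (q.1 + t, q.2 + t)) P S &
      exists d' (T' : measurableType d') (P' : probability T' R)
             (S' : T' -> R * R -> R) (A : T' -> nat -> R -> R),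
        [/\ random_function S', (forall w, continuous (S' w)),
            same_law P' S' P S, parabolic_airy_line_ensemble P' A &
            airy_sheet_coupling P' S' A]].

Definition airy_sheet_of_scale d (T : measurableType d) (P : probability T R)
    (r : R) (F : T -> R * R -> \bar R) : Prop :=
  exists2 S : T -> R * R -> R, airy_sheet P S &
    forall w q, F w q = (r * S w (q.1 / r ^+ 2, q.2 / r ^+ 2))%:E.

End Airy.

Section Landscape.
Context {R : realType}.

(** [((x, s), (y, t))] stands for [(x, s; y, t)]. *)

Definition R4up : set ((R * R) * (R * R)) := [set u | u.1.2 < u.2.2].

Definition time_slice (f : (R * R) * (R * R) -> \bar R) (s t : R) : gfun R :=
  fun q => f ((q.1, s), (q.2, t)).

Definition directed_landscape d (T : measurableType d) (P : probability T R)
    (L : T -> (R * R) * (R * R) -> \bar R) : Prop :=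
  [/\ random_function L,
      [/\ forall w u, R4up u -> L w u \is a fin_num /\ {for u, continuous (L w)},
          forall w p, L w (p, p) = 0%E &
          forall w p q, p <> q -> ~ R4up (p, q) -> L w (p, q) = -oo%E],
      forall (k : nat) (s t : 'I_k -> R), (forall i, s i < t i) ->
        trivIset setT (fun i => [set` `]s i, t i[]) ->
        (forall i, airy_sheet_of_scale P ((t i - s i) `^ (1 / 3))
                     (fun w => time_slice (L w) (s i) (t i))) /\
        independent P (fun i => sigma_of (fun w => time_slice (L w) (s i) (t i))) &
      {ae P, forall w, forall r s t x y, r < s -> s < t ->
        (forall z, (L w ((x, r), (z, s)) + L w ((z, s), (y, t)) <=
                    L w ((x, r), (y, t)))%E) /\
        (exists z, L w ((x, r), (y, t)) =
                   (L w ((x, r), (z, s)) + L w ((z, s), (y, t)))%E)}].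

Definition multi_time_cvg
    d (T : measurableType d) (P : probability T R)
    (D : nat -> T -> (R * R) * (R * R) -> \bar R)
    d' (T' : measurableType d') (P' : probability T' R)
    (L : T' -> (R * R) * (R * R) -> \bar R) : Prop :=
  forall (I : countType) (s t : I -> R), (forall i, s i < t i) ->
    cvg_in_distribution P
      (fun n w => (fun i => time_slice (D n w) (s i) (t i)) : {ptws I -> gfun R})
      P'
      (fun w => (fun i => time_slice (L w) (s i) (t i)) : {ptws I -> gfun R}).

Definition lattice_step (a b : int * int) : bool :=
  (b == (a.1 + 1, a.2)) || (b == (a.1, a.2 - 1)).

(** A path from [a] to [b] is [a :: p]. The set of paths is finite, so
[ereal_sup] is a maximum, or [-oo] if there is no path. *)
Definition lattice_last_passage (X : int * int -> R) (a b : int * int)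
    : \bar R :=
  ereal_sup [set (\sum_(z <- p) X z)%:E | p in
              [set p : seq (int * int) | path lattice_step a p /\ last a p = b]].

Definition lattice_point (rho tau : R) (n : nat) (p : R * R) : int * int :=
  (Num.floor (rho * n%:R * p.2 + tau * (n%:R `^ (2 / 3)) * p.1),
   Num.floor (- (n%:R * p.2))).

Definition rescaled_lpp (rho alpha beta chi tau : R) (n : nat)
    (X : int * int -> R) (u : (R * R) * (R * R)) : \bar R :=
  let: ((x, s), (y, t)) := u in
  ((lattice_last_passage X (lattice_point rho tau n (x, s))
                           (lattice_point rho tau n (y, t))
    - (alpha * n%:R * (t - s) + beta * tau * (n%:R `^ (2 / 3)) * (y - x))%:E)
   * ((chi * n%:R `^ (1 / 3))^-1)%:E)%E.

Definition negative_part_moment d (T : measurableType d) (P : probability T R)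
    (r : R) (a : T -> \bar R) : \bar R :=
  (\int[P]_w poweR (maxe (- a w) 0) r)%E.

Definition segment_U : set ((R * R) * (R * R)) :=
  [set ((0, 0), (x, 1)) | x in `[-3, 3]].

Definition cvg_uniformly_on_compacts (D : nat -> (R * R) * (R * R) -> \bar R)
    (L : (R * R) * (R * R) -> \bar R) : Prop :=
  forall K : set ((R * R) * (R * R)), compact K -> K `<=` R4up ->
    forall e : R, 0 < e -> \forall n \near \oo,
      forall u, K u -> (`|D n u - L u| < e%:E)%E.

End Landscape.

(* Main.v *)
(** Multi-time convergence controls [d_n] only on fixed time slices; there it
is uniform in space, since the functional [deviation], the largest distance to
a constant over a ball, is continuous for the graph topology.

To leave the slices, every space-time point is joined, forwards and backwards,
to a nearby point of the slices at times in [eta * Z] by a chain of lattice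
edges of durations comparable to [8^j]. At the relative length scale
[x = (8^j / n)^(1/3)] there are [O(x^-5)] edges in a compact set ([x^-2]
positions, [x^-3] times). By superadditivity and the moment bound an edge
costs more than [x^g], in the units of [d_n], with probability
[O(x^((5 + delta) * (1 - g)))]. For small [g > 0] both the bad probabilities
and the costs are summable over scales; this is what the exponent 5 is for.
The reverse triangle inequality then sandwiches [d_n] between its values on
the slices, so that [d_n] is close to [L] as soon as finitely many deviations
from the values of [L] on a net are small.

Splitting according to these values gives disjoint events for [L] and disjoint
events for [d_n] that are at least almost as likely. They are matched by a
coupling that samples all the fields from one uniform variable, each field
being encoded as a real number; the Borel-Cantelli lemma over the levels of
accuracy, which involve [L] and one more uniform variable but not [n], yields
almost sure convergence. *)
Require Import Defs.
From mathcomp Require Import all_boot all_order all_algebra.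
From mathcomp Require Import all_classical all_reals all_analysis.
From mathcomp Require Import measurable_realfun.
From mathcomp Require Import ring lra zify.

Import Order.TTheory GRing.Theory Num.Theory.
Import numFieldNormedType.Exports.

Local Open Scope classical_set_scope.
Local Open Scope ring_scope.

Set Implicit Arguments.
Unset Strict Implicit.
Unset Printing Implicit Defensive.

(** * Graph topology *)

(** The values of [d_n] may be -oo and those of [L] are bounded only on compact sets, so closeness
    is measured through [contract], the coordinate in which the graph topology is defined; finite
    values are recovered at the very end, on a compact set where [L] is bounded.

    The range [-3, 3] in [U] dictates the geometry of the chains. The grids refine time by 8 and
    space by 4, as in the 1:2:3 scaling; passing to the parent cell shifts a point by up to 3 cells
    in space, and the time offsets make the edge long enough for its rescaled slope to stay within
    3. Since the law of the field does not depend on n, an edge of duration m is estimated by [d_m]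
    and not by [d_n].

    The coupling has to deliver whole fields with the law of X, one for each n, next to a landscape
    on an arbitrary probability space. Matching finitely many events at a time needs only one-sided
    bounds on probabilities; weak convergence gives them for smoothed events, and gaps between the
    cells of values keep the events disjoint. *)

Section Contract.
Context {R : realType}.
Implicit Types (a b e B : R) (x y : \bar R).

(** The derivative of a / (1 + |a|) is (1 + |a|)^-2, which lies between (1 + B)^-2 and 1 on
    [-B, B]. *)
Lemma contract_fin_diff a b B : a <= b -> `|a| <= B -> `|b| <= B ->
  (b - a) / (1 + B) ^+ 2 <= contract b%:E - contract a%:E <= b - a.
Proof.
move=> ab aB bB; rewrite /contract.
have B0 : 0 <= B by exact: le_trans aB.
have B1 : 0 < 1 + B by rewrite ltr_pwDl.
have B2 : 1 <= (1 + B) ^+ 2 by nra.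
have key (u v : R) : 0 <= u -> 0 <= v -> u <= B -> v <= B ->
    u / (1 + u) - v / (1 + v) = (u - v) / ((1 + u) * (1 + v)).
  by move=> u0 v0 uB vB; field; apply/andP; split; apply: lt0r_neq0; rewrite ltr_pwDl.
have bound (u v : R) : 0 <= u -> 0 <= v -> v <= u -> u <= B -> v <= B ->
    (u - v) / (1 + B) ^+ 2 <= u / (1 + u) - v / (1 + v) <= u - v.
  move=> u0 v0 vu uB vB; rewrite key//.
  have uv0 : 0 <= u - v by rewrite subr_ge0.
  have p1 : 0 < (1 + u) * (1 + v) by apply: mulr_gt0; rewrite ltr_pwDl.
  apply/andP; split.
    apply: ler_wpM2l => //; rewrite lef_pV2 ?posrE ?exprn_gt0// expr2.
    by apply: ler_pM; rewrite ?addr_ge0// lerD2l.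
  by rewrite ler_pdivrMr// ler_peMr// mulrDl !mul1r !mulrDr !mulr1; nra.
case: (leP 0 a) => a0.
  rewrite (ger0_norm a0) (ger0_norm (le_trans a0 ab)).
  by apply: bound; rewrite ?(le_trans a0 ab) ?(ger0_norm a0)//;
    [move: bB|move: aB]; rewrite ger0_norm// (le_trans a0 ab).
case: (leP 0 b) => b0; last first.
  move: aB bB; rewrite (ltr0_norm a0) (ltr0_norm b0) => aB bB.
  have /andP[h1 h2] : (- a - - b) / (1 + B) ^+ 2 <=
      - a / (1 + - a) - - b / (1 + - b) <= - a - - b by apply: bound; lra.
  move: h1 h2; rewrite (_ : - a - - b = b - a) ?mulNr; last by ring.
  by rewrite ?mulNr ?opprK => h1 h2; apply/andP; split; lra.
(* Here a < 0 <= b; the increments from a to 0 and from 0 to b are estimated separately. *)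
rewrite (ltr0_norm a0) (ger0_norm b0).
have u0 : 0 <= b / (1 + b) <= b.
  apply/andP; split; first by rewrite divr_ge0// addr_ge0.
  by rewrite ler_pdivrMr ?ltr_pwDl// ler_peMr// lerDl.
have v0 : 0 <= - a / (1 - a) <= - a.
  apply/andP; split; first by rewrite divr_ge0//; lra.
  by rewrite ler_pdivrMr ?ler_peMr//; lra.
have h (w : R) : 0 <= w -> w <= B -> w / (1 + B) ^+ 2 <= w / (1 + w).
  move=> w0 wB; apply: ler_wpM2l => //.
  rewrite lef_pV2 ?posrE ?exprn_gt0 ?ltr_pwDl// expr2.
  by rewrite -[leLHS]mul1r; apply: ler_pM; rewrite ?addr_ge0// ?lerDl ?lerD2l.
move: bB aB; rewrite (ger0_norm b0) (ltr0_norm a0) => bB aB.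
have := h _ b0 bB; have := h (- a); rewrite !mulNr => h1 h2.
have {}h1 : - (a / (1 + B) ^+ 2) <= - (a / (1 - a)) by apply: h1; lra.
move: v0 u0; rewrite mulNr mulrBl => /andP[? ?] /andP[? ?].
by apply/andP; split; lra.
Qed.

Lemma contract_shift x e : 0 <= e -> contract (x + e%:E)%E <= contract x + e.
Proof.
move=> e0; case: x => [a| |] /=; rewrite ?lerDl//.
have ae : a <= a + e by rewrite lerDl.
have := @contract_fin_diff a (a + e) (Num.max `|a| `|a + e|).
rewrite !le_max !lexx orbT => /(_ ae erefl erefl)/andP[_].
by rewrite /contract; lra.
Qed.

(** The contracted values of a + e and a - e are at least e / (1 + B + e)^2 away from that of a.
    This also forces [x] to be finite, and brings uniform closeness back from contracted to true
    values. *)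
Lemma contract_close_fin a x B e : `|a| <= B -> 0 < e ->
  `|contract x - contract a%:E| < e / (1 + B + e) ^+ 2 -> (`|x - a%:E| < e%:E)%E.
Proof.
move=> aB e0.
have B0 : 0 <= B by exact: le_trans aB.
have h1 : `|a + e| <= B + e.
  by apply: le_trans (ler_normD _ _) _; rewrite (gtr0_norm e0) lerD2r.
have h2 : `|a - e| <= B + e.
  by apply: le_trans (ler_normB _ _) _; rewrite (gtr0_norm e0) lerD2r.
have aBe : `|a| <= B + e by lra.
have up : e / (1 + B + e) ^+ 2 <= contract (a + e)%:E - contract a%:E.
  have := @contract_fin_diff a (a + e) (B + e).
  rewrite lerDl (ltW e0) => /(_ erefl aBe h1)/andP[+ _].
  by rewrite addrA [a + e - a]addrAC subrr add0r.
have dn : e / (1 + B + e) ^+ 2 <= contract a%:E - contract (a - e)%:E.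
  have := @contract_fin_diff (a - e) a (B + e).
  rewrite gerBl (ltW e0) => /(_ erefl h2 aBe)/andP[+ _].
  by rewrite addrA opprB addrCA subrr addr0.
rewrite ltr_norml => /andP[l1 l2].
have xu : (x < (a + e)%:E)%E by rewrite -lt_contract; lra.
have xd : ((a - e)%:E < x)%E by rewrite -lt_contract; lra.
case: x xu xd {l1 l2} => [x| |]//=; rewrite !lte_fin => xu xd.
by rewrite ltr_norml; apply/andP; split; lra.
Qed.

Lemma le_contract_norm x : - 1 <= contract x <= 1.
Proof. by rewrite -ler_norml; exact: contract_le1. Qed.

End Contract.

Section PlaneNorm.
Context {R : realType}.
Implicit Types (r q : R * R).

Lemma ler_prod_norm r q : `|r.1 - q.1| <= `|r - q| /\ `|r.2 - q.2| <= `|r - q|.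
Proof. by rewrite prod_normE/= !le_max !lexx orbT. Qed.

(** [plane_norm] is Euclidean while [|r - q|] is the maximum norm; 2 stands for the square root of
    2. *)
Lemma plane_norm_le r q : plane_norm r <= plane_norm q + 2 * `|r - q|.
Proof.
have [h1 h2] := ler_prod_norm r q.
set d := `|r - q| in h1 h2 *; have d0 : 0 <= d by exact: normr_ge0.
set s := plane_norm q; have s0 : 0 <= s by exact: sqrtr_ge0.
rewrite -[leRHS]ger0_norm ?addr_ge0 ?mulr_ge0// -sqrtr_sqr.
apply: ler_wsqrtr.
have ss : s ^+ 2 = q.1 ^+ 2 + q.2 ^+ 2 by rewrite sqr_sqrtr// addr_ge0// sqr_ge0.
have q1s : `|q.1| <= s by rewrite -sqrtr_sqr ler_wsqrtr// lerDl sqr_ge0.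
have q2s : `|q.2| <= s by rewrite -sqrtr_sqr ler_wsqrtr// lerDr sqr_ge0.
have sq (a b : R) : `|a - b| <= d -> `|b| <= s -> a ^+ 2 <= b ^+ 2 + 2 * s * d + d ^+ 2.
  move=> ab bs.
  have -> : a ^+ 2 = b ^+ 2 + 2 * (b * (a - b)) + (a - b) ^+ 2 by ring.
  apply: lerD; last by rewrite -[leLHS]real_normK ?num_real// ler_pXn2r ?nnegrE.
  rewrite lerD2l -mulrA ler_pM2l// (le_trans (ler_norm _))// normrM.
  exact: ler_pM.
have := sq _ _ h1 q1s; have := sq _ _ h2 q2s; rewrite sqrrD ss.
have := mulr_ge0 s0 d0; nra.
Qed.

Lemma expRN_dist (a b : R) : 0 <= a -> 0 <= b -> `|expR (- a) - expR (- b)| <= `|a - b|.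
Proof.
wlog ab : a b / a <= b.
  move=> H a0 b0; case: (leP a b) => ab; first exact: H.
  by rewrite distrC [leRHS]distrC; apply: H => //; exact: ltW.
move=> a0 b0.
rewrite ger0_norm ?subr_ge0 ?ler_expR ?lerN2// ler0_norm ?subr_le0// opprB.
have -> : expR (- b) = expR (- a) * expR (a - b) by rewrite -expRD addrA addNr add0r.
rewrite -[X in X - _]mulr1 -mulrBr.
have e1 : expR (- a) <= 1 by rewrite -[leRHS]expR0 ler_expR oppr_le0.
have e2 : 1 - expR (a - b) <= b - a by have := expR_ge1Dx (a - b); lra.
have e3 : 0 <= 1 - expR (a - b) by rewrite subr_ge0 -[leRHS]expR0 ler_expR subr_le0.
by rewrite -[leRHS]mul1r; apply: ler_pM => //; exact: expR_ge0.
Qed.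

Lemma expR_plane_norm_dist r q :
  `|expR (- plane_norm r) - expR (- plane_norm q)| <= 2 * `|r - q|.
Proof.
apply: le_trans (expRN_dist (sqrtr_ge0 _) (sqrtr_ge0 _)) _.
rewrite ler_norml; apply/andP; split.
  by have := plane_norm_le q r; rewrite [X in _ * X]distrC /plane_norm; lra.
by have := plane_norm_le r q; rewrite /plane_norm; lra.
Qed.

(** The partner of a graph point of [f] lies a priori only in the closure of the graph of [g]; the
    strict inequality leaves room to move it onto the graph itself. *)
Lemma graph_dist_approx (f g : gfun R) e r : graph_dist f g < e ->
  exists r', `|r - r'| < e /\
    `|expR (- plane_norm r) * contract (f r) -
      expR (- plane_norm r') * contract (g r')| < e.
Proof.
move=> fge.
have [e' e'e [e'0 [H _]]] : exists2 e', e' < e & 0 < e' /\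
    hausdorff_within e' (graph_embed @` graph_closure f)
                        (graph_embed @` graph_closure g).
  (* The distance is an infimum, which has a default value on the empty set, so some admissible
     radius must be exhibited. Contracted values lie in [-1, 1], hence 3 is one. *)
  have : [set e | 0 < e /\ hausdorff_within e
      (graph_embed @` graph_closure f) (graph_embed @` graph_closure g)] !=set0.
    have near (f1 f2 : gfun R) : forall a, (graph_embed @` graph_closure f1) a ->
        exists2 b, (graph_embed @` graph_closure f2) b & `|a - b| < 3.
      move=> _ [[s a] _ <-]; exists (graph_embed (s, f2 s)).
        by exists (s, f2 s) => //; apply: subset_closure.
      rewrite /graph_embed prod_normE/= subrr normr0 gt_max ltr0n/= -mulrBr normrM.
      have e1 : `|expR (- plane_norm s)| <= 1.
        by rewrite ger0_norm ?expR_ge0// -[leRHS]expR0 ler_expR oppr_le0 sqrtr_ge0.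
      have c2 : `|contract a - contract (f2 s)| <= 2.
        apply: le_trans (ler_normB _ _) _.
        by rewrite -[2]/(1 + 1); apply: lerD; exact: contract_le1.
      apply: (@le_lt_trans _ _ (1 * 2)); last by rewrite mul1r ltr_nat.
      exact: ler_pM.
    exists 3; split; first by rewrite ltr0n.
    split; first exact: near.
    by move=> b /(near g f)[a Ha ab]; exists a => //; rewrite distrC.
  move=> hi; have [e' He' e'e] := inf_lt hi fge.
  by exists e'.
have [] := H (graph_embed (r, f r)).
  by exists (r, f r) => //; apply: subset_closure.
move=> _ [[s v] clg <-]; rewrite /graph_embed/= prod_normE/= gt_max => /andP[rs cs].
(* Moving the point by [eta] changes the embedded value by at most 2 [eta] through the exponential
   weight and [eta] through the contraction, and 3 [eta] < e - e'. *)
pose eta := (e - e') / 4.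
have eta0 : 0 < eta by rewrite divr_gt0 ?subr_gt0.
have [] := clg (ball ((s, v) : (R * R) * \bar R) eta).
  exact: nbhsx_ballx.
move=> [r' v'] [/= -> [/= [b1 b2] bv]].
have sr' : `|s - r'| < eta.
  by rewrite prod_normE/= gt_max; apply/andP; split; [exact: b1|exact: b2].
have {}bv : `|contract v - contract (g r')| < eta by exact: bv.
exists r'; split.
  rewrite -(subrKA s); apply: le_lt_trans (ler_normD _ _) _.
  by rewrite /eta in sr'; lra.
rewrite -(subrKA (expR (- plane_norm s) * contract v)).
apply: le_lt_trans (ler_normD _ _) _.
have : `|expR (- plane_norm s) * contract v -
         expR (- plane_norm r') * contract (g r')| <= 3 * eta.
  rewrite -(subrKA (expR (- plane_norm r') * contract v)) -mulrBl -mulrBr.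
  apply: le_trans (ler_normD _ _) _; rewrite !normrM.
  have h1 : `|expR (- plane_norm s) - expR (- plane_norm r')| * `|contract v|
      <= 2 * eta.
    rewrite -[leRHS]mulr1; apply: ler_pM => //; last exact: contract_le1.
    by apply: le_trans (expR_plane_norm_dist _ _) _; rewrite ler_pM2l// ltW.
  have h2 : `|expR (- plane_norm r')| * `|contract v - contract (g r')| <= 1 * eta.
    apply: ler_pM => //; last exact: ltW.
    by rewrite ger0_norm ?expR_ge0// -[leRHS]expR0 ler_expR oppr_le0 sqrtr_ge0.
  by lra.
by rewrite /eta; lra.
Qed.

End PlaneNorm.

(** * A functional continuous for the graph topology *)

Section Deviation.
Context {R : realType}.
Variables (q : R * R) (k m l : R).
Hypotheses (k0 : 0 <= k) (l0 : 0 < l).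
Implicit Types (f g : gfun R) (r : R * R).

(** A supremum over a fixed ball is not continuous for the graph topology, as matched points may
    cross the boundary. A linear penalty of slope [l] outside the ball of radius [k] makes it
    Lipschitz. *)
Definition penalized_dev f r : R :=
  `|contract (f r) - m| - l * Num.max 0 (`|r - q| - k).

Definition deviation f : R := sup (range (penalized_dev f)).

Lemma contract_dist_le f r : `|contract (f r) - m| <= 1 + `|m|.
Proof. by apply: le_trans (ler_normB _ _) _; rewrite lerD2r contract_le1. Qed.

Lemma penalized_dev_le f r : penalized_dev f r <= `|contract (f r) - m|.
Proof. by rewrite gerBl mulr_ge0 ?(ltW l0)// le_max lexx. Qed.

Lemma le_deviation f r : penalized_dev f r <= deviation f.
Proof.
apply: ub_le_sup; last by exists r.
exists (1 + `|m|) => _ [s _ <-].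
exact: le_trans (penalized_dev_le _ _) (contract_dist_le _ _).
Qed.

Lemma deviation_le f a : (forall r, penalized_dev f r <= a) -> deviation f <= a.
Proof.
move=> H; apply: ge_sup; first by exists (penalized_dev f q), q.
by move=> _ [r _ <-].
Qed.

Lemma deviation_ge f r : `|r - q| <= k -> `|contract (f r) - m| <= deviation f.
Proof.
move=> rq; have := le_deviation f r; rewrite /penalized_dev.
by rewrite (_ : Num.max _ _ = 0) ?mulr0 ?subr0//; apply/max_idPl; rewrite subr_le0.
Qed.

Lemma deviation_ge0 f : 0 <= deviation f.
Proof.
by have := @deviation_ge f q; rewrite subrr normr0 => /(_ k0); exact: le_trans.
Qed.

Lemma penalized_dev_far f z r : 1 + `|m| <= l * z -> k + z <= `|r - q| ->
  penalized_dev f r <= 0.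
Proof.
move=> lz krq; rewrite subr_le0; apply: le_trans (contract_dist_le _ _) _.
by apply: le_trans lz _; rewrite ler_pM2l// le_max; apply/orP; right; lra.
Qed.

(** Beyond [k + z] the penalty exceeds 1 + |m|, the largest possible deviation. With [deviation_ge]
    this places [deviation] between the suprema over the balls of radii [k] and [k + z]. *)
Lemma deviation_le_near f z h : 1 + `|m| <= l * z -> 0 <= h ->
  (forall r, `|r - q| <= k + z -> `|contract (f r) - m| <= h) -> deviation f <= h.
Proof.
move=> lz h0 H; apply: deviation_le => r; case: (leP `|r - q| (k + z)) => rq.
  by apply: le_trans (penalized_dev_le _ _) _; exact: H.
by apply: le_trans h0; apply: (penalized_dev_far _ lz); exact: ltW.
Qed.

(** Only points within [k + z] of [q] matter; there the weight exp(-|r|) of the graph metric is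
    bounded below and can be divided out. *)
Lemma deviation_lipschitz : exists2 C, 0 < C & forall f g e, graph_dist f g < e ->
  deviation f <= deviation g + C * e.
Proof.
pose z := (1 + `|m|) / l.
have z0 : 0 < z by rewrite divr_gt0// ltr_pwDl.
have lz : 1 + `|m| <= l * z by rewrite mulrC divfK// gt_eqF.
pose M := plane_norm q + 2 * (k + z).
(* In the factor 3, the matching of embedded values counts 1 and the change of weight between [r]
   and [r'] counts 2; [l] pays for the penalty at the displaced point. *)
exists (3 * expR M + l).
  by rewrite addr_gt0// mulr_gt0// expR_gt0.
move=> f g e fg.
have e0 : 0 < e.
  have [r' [+ _]] := graph_dist_approx q fg.
  exact: le_lt_trans (normr_ge0 _).
apply: deviation_le => r.
case: (leP (k + z) `|r - q|) => rq.
  apply: le_trans (penalized_dev_far f lz rq) _.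
  by rewrite addr_ge0 ?deviation_ge0// mulr_ge0 ?(ltW e0)// addr_ge0 ?(ltW l0)// mulr_ge0 ?expR_ge0.
have [r' [rr' cc]] := graph_dist_approx r fg.
have rM : plane_norm r <= M.
  by apply: le_trans (plane_norm_le r q) _; rewrite /M; lra.
have cc3 : expR (- plane_norm r) * `|contract (f r) - contract (g r')| <= 3 * e.
  rewrite -[X in X * _]ger0_norm ?expR_ge0// -normrM mulrBr.
  rewrite -(subrKA (expR (- plane_norm r') * contract (g r'))) -mulrBl.
  apply: le_trans (ler_normD _ _) _; rewrite normrM.
  have h : `|expR (- plane_norm r') - expR (- plane_norm r)| * `|contract (g r')|
      <= 2 * e.
    rewrite -[leRHS]mulr1; apply: ler_pM => //; last exact: contract_le1.
    by apply: le_trans (expR_plane_norm_dist _ _) _; rewrite ler_pM2l// distrC ltW.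
  by lra.
have {}cc3 : `|contract (f r) - contract (g r')| <= 3 * expR M * e.
  have := ler_pM (expR_ge0 (plane_norm r)) _ _ cc3.
  move=> /(_ (expR M)); rewrite ler_expR => /(_ _ rM) H.
  have := H (mulr_ge0 (expR_ge0 _) (normr_ge0 _)).
  by rewrite mulrA expRxMexpNx_1 mul1r mulrA [expR M * 3]mulrC.
have := le_deviation g r'; rewrite /penalized_dev.
have h1 : `|contract (f r) - m| <= `|contract (f r) - contract (g r')| + `|contract (g r') - m|.
  by rewrite -(subrKA (contract (g r'))) ler_normD.
have h2 : Num.max 0 (`|r' - q| - k) <= Num.max 0 (`|r - q| - k) + e.
  rewrite ge_max; apply/andP; split.
    by rewrite addr_ge0 ?(ltW e0)// le_max lexx.
  apply: (@le_trans _ _ (`|r - q| - k + e)); last by rewrite lerD2r le_max lexx orbT.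
  have : `|r' - q| <= `|r' - r| + `|r - q| by rewrite -(subrKA r) ler_normD.
  by move: rr'; rewrite distrC; lra.
have := ler_wpM2l (ltW l0) h2; rewrite mulrDr; lra.
Qed.

Lemma continuous_deviation : continuous deviation.
Proof.
have [C C0 HC] := deviation_lipschitz.
move=> f U /nbhs_ballP[e /= e0 eU].
have eC : 0 < e / (2 * C) by rewrite divr_gt0// mulr_gt0.
have CeC : C * (e / (2 * C)) < e.
  have -> : C * (e / (2 * C)) = e / 2 by field; rewrite gt_eqF.
  by rewrite ltr_pdivrMr// ltr_pMr// ltr1n.
apply/nbhs_ballP; exists (e / (2 * C)) => //= g fg.
have fg' : ball g (e / (2 * C)) f by exact: ball_sym.
have h1 := HC _ _ _ fg; have h2 := HC _ _ _ fg'.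
apply: eU; rewrite -ball_normE/=.
by rewrite ltr_norml; apply/andP; split; lra.
Qed.

End Deviation.

(** Right continuity in both variables, shared by [d_n], whose floors jump only from the left, and
    by the continuous [L]. It lets rational points determine suprema, hence makes [deviation]
    measurable. *)
Definition right_approximable {R : realType} (f : gfun R) : Prop :=
  forall r e, 0 < e -> exists2 eta, 0 < eta &
    forall r', r.1 <= r'.1 < r.1 + eta -> r.2 <= r'.2 < r.2 + eta ->
      `|contract (f r') - contract (f r)| < e.

Lemma measurable_contract {R : realType} d (T : measurableType d)
    (G : T -> \bar R) : measurable_fun setT G ->
  measurable_fun setT (fun w => contract (G w)).
Proof.
move=> mG; apply: (measurability _ (RGenOInfty.measurableE R)) => //.
move=> _ [_ [a ->] <-]; rewrite setTI.
have [a1|a1] := leP `|a| 1.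
  rewrite (_ : _ @^-1` _ = [set w | expand a < G w]%E).
    by rewrite -[X in measurable X]setTI; apply: emeasurable_fun_o_infty.
  apply/seteqP; split => w /=; rewrite in_itv/= andbT -lt_contract expandK//.
case: (leP 0 a) => a0.
  rewrite (_ : _ @^-1` _ = set0) //; apply/seteqP; split => w //=.
  rewrite in_itv/= andbT ltNge => /negP; apply.
  have := le_contract_norm (G w); move: a1; rewrite ger0_norm//; lra.
rewrite (_ : _ @^-1` _ = setT) //; apply/seteqP; split => w //= _.
rewrite in_itv/= andbT.
have := le_contract_norm (G w); move: a1; rewrite ltr0_norm//; lra.
Qed.

Lemma rat_right_near {R : realType} (x eta : R) : 0 < eta ->
  exists p : rat, x <= ratr p < x + eta.
Proof.
move=> eta0; have [p] : exists p : rat, ratr p \in `]x, (x + eta)[%R.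
  by apply: rat_in_itvoo; rewrite ltrDl.
by rewrite in_itv/= => /andP[xp px]; exists p; rewrite (ltW xp) px.
Qed.

Lemma measurable_deviation {R : realType} (q : R * R) (k m l : R)
    d (T : measurableType d) (F : T -> gfun R) : 0 < l ->
  (forall r, measurable_fun setT (fun w => F w r)) ->
  (forall w, right_approximable (F w)) ->
  measurable_fun setT (fun w => deviation q k m l (F w)).
Proof.
move=> l0 mF rF.
apply: (measurability _ (RGenOInfty.measurableE R)) => //.
move=> _ [_ [a ->] <-]; rewrite setTI.
pose rr (p : rat * rat) : R * R := (ratr p.1, ratr p.2).
rewrite (_ : _ @^-1` _ =
    \bigcup_(p : rat * rat) [set w | a < penalized_dev q k m l (F w) (rr p)]).
  apply: countable_bigcupT_measurable; first exact: countableP.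
  move=> p; rewrite -[X in measurable X]setTI.
  have mc := measurable_contract (mF (rr p)).
  have mp : measurable_fun setT (fun w => penalized_dev q k m l (F w) (rr p)).
    apply: measurable_funB => //; apply: measurableT_comp => //.
    exact: measurable_funB.
  have := mp measurableT `]a, +oo[%classic (measurable_itv _).
  congr measurable; congr (_ `&` _).
  by apply/seteqP; split => w /=; rewrite in_itv/= andbT.
apply/seteqP; split => w /=; rewrite in_itv/= andbT.
- move=> aw; have [_ [r _ <-] ar] : exists2 y, range (penalized_dev q k m l (F w)) y & a < y.
    apply: sup_gt => //; first by exists (penalized_dev q k m l (F w) q), q.
  (* A rational point within [e] loses at most [e] in the value and [l * e] in the penalty, which is
     less than the available margin (2 + l) [e]. *)
  pose e := (penalized_dev q k m l (F w) r - a) / (2 + l).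
  have e0 : 0 < e by rewrite divr_gt0 ?subr_gt0// addr_gt0.
  have [eta eta0 H] := rF w r e e0.
  have me0 : 0 < Num.min eta e by rewrite lt_min eta0.
  have [p1 hp1] := rat_right_near r.1 me0.
  have [p2 hp2] := rat_right_near r.2 me0.
  exists (p1, p2) => //=; rewrite /rr/=.
  have p1' : ratr p1 < r.1 + eta /\ ratr p1 < r.1 + e.
    by move: hp1 => /andP[_]; rewrite -ltrBlDl lt_min => /andP[]; lra.
  have p2' : ratr p2 < r.2 + eta /\ ratr p2 < r.2 + e.
    by move: hp2 => /andP[_]; rewrite -ltrBlDl lt_min => /andP[]; lra.
  have := H (ratr p1, ratr p2) => /=.
  have [hp1' _] := andP hp1; have [hp2' _] := andP hp2.
  rewrite hp1' hp2' p1'.1 p2'.1 => /(_ erefl erefl) cc.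
  set s := (ratr p1, ratr p2) in cc *.
  have rs : `|s - r| <= e.
    rewrite prod_normE/= ge_max; apply/andP; split; rewrite ger0_norm ?subr_ge0//; lra.
  have h1 : `|contract (F w r) - m| <= `|contract (F w s) - contract (F w r)| + `|contract (F w s) - m|.
    by rewrite [X in _ <= X + _]distrC -(subrKA (contract (F w s)) (contract (F w r))) ler_normD.
  have h2 : Num.max 0 (`|s - q| - k) <= Num.max 0 (`|r - q| - k) + e.
    rewrite ge_max; apply/andP; split.
      by rewrite addr_ge0 ?(ltW e0)// le_max lexx.
    apply: (@le_trans _ _ (`|r - q| - k + e)); last by rewrite lerD2r le_max lexx orbT.
    have : `|s - q| <= `|s - r| + `|r - q| by rewrite -(subrKA r) ler_normD.
    by lra.
  have h3 := ler_wpM2l (ltW l0) h2; rewrite mulrDr in h3.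
  have h4 : e * (2 + l) = penalized_dev q k m l (F w) r - a.
    by rewrite /e divfK// gt_eqF// addr_gt0.
  move: h4; rewrite /penalized_dev mulrDr; lra.
- by move=> [p _] /lt_le_trans; apply; exact: le_deviation.
Qed.

(** * Weak convergence and smoothed events *)

Section Portmanteau.
Context {R : realType}.

Definition cutoff (h del x : R) : R := Num.max 0 (Num.min 1 ((h - x) / del)).

Lemma cutoff_itv h del x : 0 <= cutoff h del x <= 1.
Proof. by rewrite /cutoff le_max lexx/= ge_max ler01 ge_min lexx. Qed.

Lemma cutoff_eq1 h del x : 0 < del -> x <= h - del -> cutoff h del x = 1.
Proof.
move=> d0 xh; rewrite /cutoff.
have : 1 <= (h - x) / del by rewrite ler_pdivlMr// mul1r; lra.
by move=> /min_idPl ->; apply/max_idPr.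
Qed.

Lemma cutoff_gt0 h del x : 0 < del -> 0 < cutoff h del x -> x < h.
Proof.
move=> d0; rewrite /cutoff lt_max ltxx/= lt_min => /andP[_].
by rewrite pmulr_lgt0 ?invr_gt0// subr_gt0.
Qed.

Lemma continuous_cutoff h del : continuous (cutoff h del).
Proof.
move=> x; apply: (@continuous_max R R (cst 0) (fun x => Num.min 1 ((h - x) / del))).
  exact: cvg_cst.
apply: (@continuous_min R R (cst 1) (fun x => (h - x) / del)).
  exact: cvg_cst.
by apply: cvgMl; apply: cvgB; [exact: cvg_cst|exact: cvg_id].
Qed.

Lemma continuous_prod_seq (Z : topologicalType) (J : Type) (s : seq J)
    (g : J -> Z -> R) : (forall j, continuous (g j)) ->
  continuous (fun z => \prod_(j <- s) g j z).
Proof.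
move=> cg; elim: s => [|j s IH].
  rewrite (_ : (fun z => _) = cst 1); first by move=> z; exact: cvg_cst.
  by apply/funext => z; rewrite big_nil.
rewrite (_ : (fun z => _) = (fun z => g j z * \prod_(i <- s) g i z)).
  by move=> z; apply: continuousM; [exact: cg|exact: IH].
by apply/funext => z; rewrite big_cons.
Qed.

Lemma measurable_cutoff d (T : measurableType d) (h del : R) (f : T -> R) :
  measurable_fun setT f -> measurable_fun setT (fun w => cutoff h del (f w)).
Proof.
move=> mf; apply: (@measurableT_comp _ _ _ _ _ _ (cutoff h del)) => //.
exact: (continuous_measurable_fun (@continuous_cutoff h del)).
Qed.

Lemma measurable_deviation_event d (T : measurableType d) (I : finType)
    (F : I -> T -> gfun R) (q : I -> R * R) (k m l h : I -> R) :
  (forall i, 0 < l i) -> (forall i r, measurable_fun setT (fun w => F i w r)) ->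
  (forall i w, right_approximable (F i w)) ->
  measurable [set w | forall i, deviation (q i) (k i) (m i) (l i) (F i w) < h i].
Proof.
move=> l0 mF rF; rewrite (_ : [set w | _] = \bigcap_(i in setT)
    [set w | deviation (q i) (k i) (m i) (l i) (F i w) < h i]); last first.
  by apply/seteqP; split => [w H i _|w H i]; [exact: H|exact: (H i)].
apply: fin_bigcap_measurable => // i _.
have := measurable_deviation (q i) (k i) (m i) (l0 i) (mF i) (rF i).
move=> /(_ measurableT `]-oo, (h i)[%classic (measurable_itv _)).
by rewrite setTI; congr measurable; apply/seteqP; split => w /=; rewrite in_itv.
Qed.

(* Smoothed indicators of the events below are continuous for the graph
topology, hence the one-sided bound that weak convergence gives on them. *)
Lemma multi_time_portmanteau
    d (T : measurableType d) (P : probability T R)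
    (D : nat -> T -> (R * R) * (R * R) -> \bar R)
    d1 (T1 : measurableType d1) (P1 : probability T1 R)
    (L : T1 -> (R * R) * (R * R) -> \bar R)
    (I : finType) (s t : I -> R) (q : I -> R * R) (k m h : I -> R) (z del : R)
    (A : set T1) :
  multi_time_cvg P D P1 L ->
  (forall n u, measurable_fun setT (fun w => D n w u)) ->
  (forall n w i, right_approximable (time_slice (D n w) (s i) (t i))) ->
  (forall u, measurable_fun setT (fun w => L w u)) ->
  (forall w i, right_approximable (time_slice (L w) (s i) (t i))) ->
  (forall i, s i < t i) -> (forall i, 0 <= k i) -> 0 < z -> 0 < del ->
  measurable A ->
  (forall w i r, A w -> `|r - q i| <= k i + z ->
    `|contract (time_slice (L w) (s i) (t i) r) - m i| <= h i - del) ->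
  forall eps : R, 0 < eps -> \forall n \near \oo,
    (P1 A - eps%:E <= P [set w | forall i,
       (deviation (q i) (k i) (m i) ((1 + `|m i|) / z)
         (time_slice (D n w) (s i) (t i)) < h i)%R])%E.
Proof.
move=> cvgD mD rD mL rL st k0 z0 del0 mA HA eps eps0.
pose l i := (1 + `|m i|) / z.
have l0 i : 0 < l i by rewrite divr_gt0// ltr_pwDl.
have lz i : 1 + `|m i| <= l i * z by rewrite divfK// gt_eqF.
pose dv i (f : gfun R) := deviation (q i) (k i) (m i) (l i) f.
pose phi (f : {ptws I -> gfun R}) : R :=
  \prod_(i <- enum I) cutoff (h i) del (dv i (f i)).
have cphi : continuous phi.
  apply: continuous_prod_seq => i f.
  apply: (@continuous_comp _ _ _ (fun f : {ptws I -> gfun R} => dv i (f i))).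
    apply: (@continuous_comp _ _ _ (fun f : {ptws I -> gfun R} => f i)).
      exact: (@proj_continuous I (fun _ => gfun R) i).
    exact: continuous_deviation.
  exact: continuous_cutoff.
have phi01 f : 0 <= phi f <= 1.
  rewrite /phi; elim: (enum I) => [|i e /andP[IH1 IH2]].
    by rewrite big_nil ler01 lexx.
  rewrite big_cons; have /andP[c0 c1] := cutoff_itv (h i) del (dv i (f i)).
  by rewrite mulr_ge0//= mulr_ile1.
have phi_gt0 f : 0 < phi f -> forall i, dv i (f i) < h i.
  move=> ph i; apply: (cutoff_gt0 del0).
  rewrite lt_neqAle (andP (cutoff_itv _ _ _)).1 andbT eq_sym.
  apply: contraTN ph => /eqP c0.
  by rewrite -leNgt /phi (bigD1_seq i) ?mem_enum ?enum_uniq//= c0 mul0r.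
have phib : exists M : R, forall f, `|phi f| <= M.
  by exists 1 => f; have /andP[p0 p1] := phi01 f; rewrite ger0_norm.
have := cvgD I s t st phi cphi phib.
set F := fun n => _; set a := (\int[P1]_w _)%E => cvgF.
have Aa : (P1 A <= a)%E.
  have -> : P1 A = (\int[P1]_w (\1_A w)%:E)%E by rewrite integral_indic// setIT.
  apply: ge0_le_integral => //.
  - by apply/measurable_EFinP; exact: measurable_indic.
  - apply/measurable_EFinP; apply: measurable_prod => i _.
    by apply: measurable_cutoff; apply: measurable_deviation => // r; exact: mL.
  (* On [A] the bound over the ball of radius [k i + z] gives a deviation of at most [h i - del], so
     every cutoff equals 1. *)
  - move=> w _; rewrite lee_fin indicE; case: (boolP (w \in A)) => [|_].
      rewrite inE => Aw; rewrite /phi big1_seq// => i _.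
      apply: cutoff_eq1 => //; apply: (deviation_le_near (l0 i) (lz i)) => //.
        by apply: le_trans (HA w i (q i) Aw _); rewrite // subrr normr0 addr_ge0 ?(ltW z0).
      by move=> r rq; exact: HA.
    by rewrite (andP (phi01 _)).1.
have afin : a \is a fin_num.
  rewrite ge0_fin_numE; last by apply: integral_ge0 => w _; rewrite lee_fin (andP (phi01 _)).1.
  apply: (@le_lt_trans _ _ (\int[P1]_w (cst 1 w))%E); last first.
    by rewrite integral_cst//= probability_setT mule1 ltry.
  apply: ge0_le_integral => //.
  - by move=> w _; rewrite lee_fin (andP (phi01 _)).1.
  - apply/measurable_EFinP; apply: measurable_prod => i _.
    by apply: measurable_cutoff; apply: measurable_deviation => // r; exact: mL.
  - by move=> w _; rewrite lee_fin (andP (phi01 _)).2.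
have : nbhs a [set x | (a - eps%:E < x)%E].
  by apply: open_ereal_gt'; rewrite lteBlDr// lteDl// lte_fin.
move=> /cvgF/= aF; near=> n; have aFn : (a - eps%:E < F n)%E by near: n.
apply: (@le_trans _ _ (a - eps%:E)%E); first by apply: leeD.
apply: (le_trans (ltW aFn)).
set E := [set w | _].
have mE : measurable E.
  by apply: measurable_deviation_event => // i r; exact: mD.
have -> : P E = (\int[P]_w (\1_E w)%:E)%E by rewrite integral_indic// setIT.
apply: ge0_le_integral => //.
- by move=> w _; rewrite lee_fin (andP (phi01 _)).1.
- apply/measurable_EFinP; apply: measurable_prod => i _.
  by apply: measurable_cutoff; apply: measurable_deviation => // r; exact: mD.
- by apply/measurable_EFinP; exact: measurable_indic.
- move=> w _; rewrite lee_fin indicE; case: (boolP (w \in E)) => [_|].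
    by rewrite (andP (phi01 _)).2.
  rewrite notin_setE => nE; rewrite leNgt; apply/negP => /phi_gt0 H.
  exact: nE.
Unshelve. all: by end_near. Qed.

End Portmanteau.

(** * Lattice last passage *)

Section LastPassage.
Context {R : realType}.
Implicit Types (X : int * int -> R) (a b c : int * int).

Lemma path_cat_lpp a b c p q :
  path lattice_step a p -> last a p = b -> path lattice_step b q -> last b q = c ->
  path lattice_step a (p ++ q) /\ last a (p ++ q) = c.
Proof. by move=> pp pb qq qc; rewrite cat_path last_cat pb pp qq. Qed.

Lemma lpp_ge X a p : path lattice_step a p ->
  ((\sum_(z <- p) X z)%:E <= lattice_last_passage X a (last a p))%E.
Proof. by move=> pp; apply: ereal_sup_ubound; exists p. Qed.

(** Concatenate paths: the weight of [b] is counted once because a path does not count its starting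
    point. *)
Lemma lpp_superadd X a b c :
  (lattice_last_passage X a b + lattice_last_passage X b c <=
   lattice_last_passage X a c)%E.
Proof.
set Lab := lattice_last_passage X a b; set Lbc := lattice_last_passage X b c.
set Lac := lattice_last_passage X a c.
have key p q : path lattice_step a p -> last a p = b ->
    path lattice_step b q -> last b q = c ->
    ((\sum_(z <- p) X z)%:E + (\sum_(z <- q) X z)%:E <= Lac)%E.
  move=> pp pb qq qc; have [pq pqc] := path_cat_lpp pp pb qq qc.
  by have := lpp_ge X pq; rewrite pqc big_cat EFinD.
have key2 q : path lattice_step b q -> last b q = c ->
    (Lab + (\sum_(z <- q) X z)%:E <= Lac)%E.
  move=> qq qc; rewrite -leeBrDr//.
  apply: ge_ereal_sup => _ [p [pp pb] <-].
  by rewrite leeBrDr//; exact: key.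
(* The suprema are extended reals, and -oo absorbs +oo in sums; the infinite values are excluded one
   by one before the suprema are approached path by path. *)
have [->|Lab_Ny] := eqVneq Lab -oo%E; first by rewrite addNye leNye.
have [Lac_y|Lac_y] := eqVneq Lac +oo%E; first by rewrite Lac_y leey.
have [->|Lbc_Ny] := eqVneq Lbc -oo%E; first by rewrite addeNy leNye.
have [q [qq qc]] : exists q, path lattice_step b q /\ last b q = c.
  apply: contrapT => H; move/negP: Lbc_Ny; apply; rewrite -leeNy_eq.
  apply: ge_ereal_sup => _ [q [qq qc] <-].
  by exfalso; apply: H; exists q.
have Labf : Lab \is a fin_num.
  rewrite fin_numE Lab_Ny/=; apply: contraNN Lac_y => /eqP Laby.
  by have := key2 q qq qc; rewrite Laby addye// leye_eq.
rewrite addeC -leeBrDr//.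
apply: ge_ereal_sup => _ [q' [qq' qc'] <-].
by rewrite leeBrDr// addeC; exact: key2.
Qed.

Lemma lattice_path_exists a b : a.1 <= b.1 -> b.2 <= a.2 ->
  exists p, path lattice_step a p /\ last a p = b.
Proof.
case: a b => a1 a2 [b1 b2] /= h1 h2.
have right m x y : exists p, path lattice_step (x, y) p /\ last (x, y) p = (x + Posz m, y).
  elim: m x => [|m IH] x; first by exists [::]; rewrite addr0.
  have [p [pp pl]] := IH (x + 1); exists ((x + 1, y) :: p) => /=.
  by rewrite /lattice_step/= eqxx/= pp pl; split => //; congr (_, _); lia.
have down m x y : exists p, path lattice_step (x, y) p /\ last (x, y) p = (x, y - Posz m).
  elim: m y => [|m IH] y; first by exists [::]; rewrite subr0.
  have [p [pp pl]] := IH (y - 1); exists ((x, y - 1) :: p) => /=.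
  by rewrite /lattice_step/= eqxx orbT/= pp pl; split => //; congr (_, _); lia.
have [p [pp pl]] := right `|b1 - a1|%N a1 a2.
have [q [qq ql]] := down `|a2 - b2|%N (a1 + Posz `|b1 - a1|%N) a2.
exists (p ++ q); rewrite cat_path last_cat pl pp qq ql; split => //.
by congr (_, _); lia.
Qed.

Lemma lpp_ge0 X a b : (forall z, 0 <= X z) -> a.1 <= b.1 -> b.2 <= a.2 ->
  (0%:E <= lattice_last_passage X a b)%E.
Proof.
move=> X0 h1 h2; have [p [pp <-]] := lattice_path_exists h1 h2.
by apply: le_trans (lpp_ge X pp); rewrite lee_fin sumr_ge0.
Qed.

Lemma lpp_gt_setE a b (r : R) :
  [set X | (r%:E < lattice_last_passage X a b)%E] =
  \bigcup_(p in [set p : seq (int * int) | path lattice_step a p /\ last a p = b])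
    [set X | r < \sum_(z <- p) X z].
Proof.
apply/seteqP; split => X /=.
  by move=> /ereal_sup_gt[_ [p pp <-]]; rewrite lte_fin => h; exists p.
move=> [p [pp <-]] h; apply: lt_le_trans (lpp_ge X pp).
by rewrite lte_fin.
Qed.

Lemma measurable_lpp_gt d (T : measurableType d) (F : T -> int * int -> R) a b (r : R) :
  random_function F ->
  measurable [set w | (r%:E < lattice_last_passage (F w) a b)%E].
Proof.
move=> mF.
rewrite (_ : [set w | _] = F @^-1` [set X | (r%:E < lattice_last_passage X a b)%E])//.
rewrite lpp_gt_setE preimage_bigcup bigcup_mkcond.
apply: countable_bigcupT_measurable; first exact: countableP.
move=> p; case: ifPn => _ //.
have mS : measurable_fun setT (fun w => \sum_(z <- p) F w z).
  by apply: measurable_sum => z; exact: mF.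
have := mS measurableT `]r, +oo[%classic (measurable_itv _).
by rewrite setTI; congr measurable; apply/seteqP; split => w /=; rewrite in_itv/= andbT.
Qed.

Lemma measurable_lpp d (T : measurableType d) (F : T -> int * int -> R) a b :
  random_function F ->
  measurable_fun setT (fun w => lattice_last_passage (F w) a b).
Proof.
move=> mF; apply: (measurability _ (ErealGenOInfty.measurableE R)) => //.
move=> _ [_ [r ->] <-]; rewrite setTI.
have := measurable_lpp_gt a b r mF; congr measurable.
by apply/seteqP; split => w /=; rewrite in_itv/= andbT.
Qed.

End LastPassage.

Lemma contract_lipschitz {R : realType} (a b : R) :
  `|contract a%:E - contract b%:E| <= `|a - b|.
Proof.
wlog ab : a b / a <= b.
  move=> H; case: (leP a b) => ab; first exact: H.
  by rewrite distrC [leRHS]distrC; apply: H; exact: ltW.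
have := @contract_fin_diff _ a b (Num.max `|a| `|b|) ab.
rewrite !le_max !lexx orbT => /(_ erefl erefl)/andP[h0 h1].
rewrite distrC [leRHS]distrC (@ger0_norm _ (b - a)) ?subr_ge0// ger0_norm//.
by apply: le_trans h0; rewrite divr_ge0 ?subr_ge0// exprn_ge0// addr_ge0// le_max normr_ge0.
Qed.

Section Rescaled.
Context {R : realType}.
Variables (rho alpha beta chi tau : R).
Hypotheses (chi0 : 0 < chi) (tau0 : 0 < tau).
Implicit Types (X : int * int -> R) (n : nat) (s t : R).
Local Notation lpt := (lattice_point rho tau).
Local Notation dn := (rescaled_lpp rho alpha beta chi tau).

Definition centering n (p q : R * R) : R :=
  alpha * n%:R * (q.2 - p.2) + beta * tau * (n%:R `^ (2 / 3)) * (q.1 - p.1).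

Lemma rescaled_lppE n X p q : dn n X (p, q) =
  ((lattice_last_passage X (lpt n p) (lpt n q) - (centering n p q)%:E) *
    ((chi * n%:R `^ (1 / 3))^-1)%:E)%E.
Proof. by case: p q => [x s] [y t]. Qed.

Lemma measurable_rescaled_lpp d (T : measurableType d) (F : T -> int * int -> R) n u :
  random_function F -> measurable_fun setT (fun w => dn n (F w) u).
Proof.
move=> mF; case: u => p q; under eq_fun do rewrite rescaled_lppE.
apply: emeasurable_funM; last exact: measurable_cst.
by apply: emeasurable_funB; [exact: measurable_lpp|exact: measurable_cst].
Qed.

Lemma rescaled_lpp_superadd n X p q r : (0 < n)%N ->
  (dn n X (p, q) + dn n X (q, r) <= dn n X (p, r))%E.
Proof.
move=> n0; rewrite !rescaled_lppE.
have k0 : 0 < (chi * n%:R `^ (1 / 3))^-1.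
  by rewrite invr_gt0 mulr_gt0// powR_gt0// ltr0n.
set k := _^-1 in k0 *.
have := lpp_superadd X (lpt n p) (lpt n q) (lpt n r).
have -> : centering n p r = centering n p q + centering n q r.
  by rewrite /centering; ring.
move: (centering n p q) (centering n q r) => A B.
case: (lattice_last_passage X _ _) => [x||]; case: (lattice_last_passage X _ _) => [y||];
  case: (lattice_last_passage X _ _) => [z||]//=;
  rewrite ?(gt0_muley, gt0_muleNy, gt0_mulye, gt0_mulNye) ?lte_fin//= ?leey ?leNye//.
by rewrite -!EFinD -!EFinM !lee_fin -mulrDl ler_pM2r//; lra.
Qed.

Lemma floor_right_cst (c : R) : 0 <= c -> forall x a : R, exists2 eta, 0 < eta &
  forall x', x <= x' < x + eta -> Num.floor (a + c * x') = Num.floor (a + c * x).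
Proof.
move=> c0 x a; set f := Num.floor (a + c * x).
have fl : a + c * x < (f + 1)%:~R by have /andP[] := floor_itv (a + c * x).
have fg : f%:~R <= a + c * x by have /andP[] := floor_itv (a + c * x).
(* The distance to the next integer, divided by 1 + c and not by c, which vanishes when [n = 0]. *)
exists (((f + 1)%:~R - (a + c * x)) / (1 + c)).
  by rewrite divr_gt0 ?subr_gt0// ltr_pwDl.
move=> x' /andP[xx' x'e]; apply: floor_def; apply/andP; split.
  by apply: le_trans fg _; rewrite lerD2l ler_wpM2l.
have : (1 + c) * (x' - x) < (f + 1)%:~R - (a + c * x).
  by rewrite mulrC -ltr_pdivlMr ?ltr_pwDl// ltrBlDl.
have : 0 <= x' - x by rewrite subr_ge0.
lra.
Qed.

(** Just to the right of a point the lattice points do not change; only the centering moves, and it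
    is linear in space. *)
Lemma right_approximable_rescaled_lpp n X s t :
  right_approximable (time_slice (dn n X) s t).
Proof.
have c0 : 0 <= tau * n%:R `^ (2 / 3) by rewrite mulr_ge0 ?powR_ge0// ltW.
move=> [x y] e e0; rewrite /=.
have [eta1 h1 H1] := floor_right_cst c0 x (rho * n%:R * s).
have [eta2 h2 H2] := floor_right_cst c0 y (rho * n%:R * t).
set k := (chi * n%:R `^ (1 / 3))^-1.
have k0 : 0 <= k by rewrite invr_ge0 mulr_ge0 ?powR_ge0// ltW.
pose c : R := `|beta * tau * (n%:R `^ (2 / 3))|.
pose eta3 : R := e / (2 * (1 + k * c)).
have c'0 : 0 <= c by exact: normr_ge0.
have kc0 : 0 < 1 + k * c by rewrite ltr_pwDl// mulr_ge0.
have h3 : 0 < eta3 by rewrite divr_gt0// mulr_gt0.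
exists (Num.min (Num.min eta1 eta2) eta3); first by rewrite !lt_min h1 h2.
move=> [x' y'] /= /andP[x1 x2] /andP[y1 y2].
have [x2a x2b] : x' < x + eta1 /\ x' < x + eta3.
  by move: x2; rewrite -ltrBlDl !lt_min => /andP[/andP[]]; lra.
have [y2a y2b] : y' < y + eta2 /\ y' < y + eta3.
  by move: y2; rewrite -ltrBlDl !lt_min => /andP[/andP[]]; lra.
rewrite /time_slice/= /lattice_point/= H1 ?x1// H2 ?y1//.
case: (lattice_last_passage X _ _) => [L||]; last 2 first.
- by rewrite /= subrr normr0.
- by rewrite /= subrr normr0.
apply: le_lt_trans (contract_lipschitz _ _) _.
rewrite -mulrBl normrM [`|k|]ger0_norm//.
set A := _ - _; have -> : A = beta * tau * (n%:R `^ (2 / 3)) * ((y - y') - (x - x')).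
  by rewrite /A; ring.
rewrite normrM -/c.
have dd : `|y - y' - (x - x')| < 2 * eta3.
  by rewrite ltr_norml; apply/andP; split; lra.
have : c * `|y - y' - (x - x')| * k <= k * c * (2 * eta3).
  by rewrite mulrC mulrA ler_wpM2l ?mulr_ge0//; exact: ltW.
move/le_lt_trans; apply.
have -> : k * c * (2 * eta3) = e * ((k * c) / (1 + k * c)).
  by rewrite /eta3; field; rewrite gt_eqF.
by rewrite gtr_pMr// ltr_pdivrMr// mul1r ltrDr.
Qed.

End Rescaled.

(** * Invariance of the field under translations *)

Section SameLaw.
Context {R : realType} {I : Type}.

Definition cylinders : set (set (I -> R)) :=
  [set S | exists m (p : 'I_m -> I) (B : 'I_m -> set R),
    (forall j, measurable (B j)) /\ S = [set f | forall j, B j (f (p j))]].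

Local Notation cylinder_space := (g_sigma_algebraType cylinders).

Lemma cylindersI : setI_closed cylinders.
Proof.
move=> _ _ [m1 [p1 [B1 [mB1 ->]]]] [m2 [p2 [B2 [mB2 ->]]]].
exists (m1 + m2)%N.
exists (fun j => match fintype.split j with inl a => p1 a | inr b => p2 b end).
exists (fun j => match fintype.split j with inl a => B1 a | inr b => B2 b end).
split; first by move=> j; case: fintype.split.
apply/seteqP; split => [f [/= h1 h2] j|f /= h].
  by case: fintype.split => a.
split => j.
  by have := h (lshift m2 j); case: splitP => [a /= ja|a /= ja];
    [have -> : j = a by exact/val_inj|
     exfalso; have := ltn_ord j; rewrite ja ltnNge leq_addr].
have := h (rshift m1 j); case: splitP => [a /= ja|a /= ja].
  by exfalso; have := ltn_ord a; rewrite -ja ltnNge leq_addr.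
have -> // : j = a by apply/val_inj/eqP; rewrite -(eqn_add2l m1) ja.
Qed.

Lemma random_function_measurable d (T : measurableType d) (F : T -> I -> R) :
  random_function F -> measurable_fun setT (F : T -> cylinder_space).
Proof.
move=> mF; apply: (@measurability _ _ T cylinder_space setT F cylinders) => //.
move=> _ [_ [m [p [B [mB ->]]]] <-]; rewrite setTI.
rewrite (_ : _ @^-1` _ = \bigcap_(j in setT) (fun w => F w (p j)) @^-1` (B j)).
  apply: fin_bigcap_measurable => // j _.
  by rewrite -[X in measurable X]setTI; exact: mF.
by apply/seteqP; split => [w h j _|w h j]; [exact: h|exact: (h j)].
Qed.

Lemma random_function_id :
  random_function (fun w : cylinder_space => (w : I -> R)).
Proof.
move=> i _ B mB; rewrite setTI; apply: sub_sigma_algebra.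
exists 1%N, (fun=> i), (fun=> B); split => //.
by apply/seteqP; split => [f /= h _ //|f /= /(_ ord0)].
Qed.

(** By the pi-lambda theorem equality on cylinders extends to the generated sigma-algebra. This
    serves for events on last passage values, which are presented as countable unions over paths. *)
Lemma same_law_cylinder_space d (T : measurableType d) (P : probability T R)
    (F : T -> I -> R) d' (T' : measurableType d') (P' : probability T' R)
    (F' : T' -> I -> R) (S : set cylinder_space) :
  random_function F -> random_function F' -> same_law P F P' F' ->
  measurable S -> P (F @^-1` S) = P' (F' @^-1` S).
Proof.
move=> mF mF' FF' mS.
have mf := random_function_measurable mF.
have mf' := random_function_measurable mF'.
apply: (@measure_unique _ R cylinder_space cylinders (fun=> setT) erefl cylindersI
  _ _ (pushforward P (F : T -> cylinder_space))
      (pushforward P' (F' : T' -> cylinder_space))) => //.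
- move=> _; exists 0%N, (fun j : 'I_0 => match notF (ltn_ord j) with end), (fun=> setT).
  by split => //; apply/seteqP; split.
- by rewrite bigcup_const//; exists 0%N.
- by move=> _ [m [p [B [mB ->]]]]; exact: FF'.
- by move=> k; rewrite /= /pushforward preimage_setT probability_setT ltry.
Qed.

End SameLaw.

Lemma iid_shift (R : realType) d (T : measurableType d) (P : probability T R)
    (X : T -> int * int -> R) (v : int * int) : iid P X ->
  same_law P (fun w z => X w (z + v)) P X.
Proof.
move=> [mX indX idX] m p B mB.
(* The points [p j] may coincide: the conditions at one site are intersected, and the product
   formula is applied over the distinct sites [s]. *)
pose C (z : int * int) : set R := \bigcap_(j in [set j | p j = z]) B j.
have mC z : measurable (C z) by apply: fin_bigcap_measurable => // j _; exact: mB.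
pose s := undup (codom p).
pose G i := sigma_of (fun (w : T) (_ : unit) => X w i).
have GC i (S : set R) : measurable S -> G i [set w | S (X w i)].
  by move=> mS; apply: sub_sigma_algebra; exists tt, S.
have e1 : [set w | forall j, B j (X w (p j + v))] =
    \bigcap_(i in [set` [seq z + v | z <- s]]) [set w | C (i - v) (X w i)].
  apply/seteqP; split => w /= h.
    move=> _ /= /mapP[z _ ->] j /= pj; rewrite addrK in pj.
    by have := h j; rewrite pj.
  move=> j; have : p j + v \in [seq z + v | z <- s].
    by apply: map_f; rewrite mem_undup codom_f.
  by move=> /h; rewrite /= addrK => /(_ j erefl).
have e2 : [set w | forall j, B j (X w (p j))] =
    \bigcap_(i in [set` s]) [set w | C i (X w i)].
  apply/seteqP; split => w /= h.
    by move=> i _ j /= pj; have := h j; rewrite pj.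
  by move=> j; have /h /(_ j erefl) : p j \in s by rewrite mem_undup codom_f.
rewrite e1 e2 (indX [seq z + v | z <- s] (fun i => [set w | C (i - v) (X w i)])).
- rewrite (indX s (fun i => [set w | C i (X w i)])) ?undup_uniq//; last first.
    by move=> i; exact: GC.
  rewrite big_map; apply: eq_bigr => z _; rewrite addrK.
  have := idX (z + v) z 1%N (fun=> tt) (fun=> C z) (fun=> mC z).
  by congr (P _ = P _); apply/seteqP; split => w //= h; exact: (h ord0).
- by rewrite map_inj_uniq ?undup_uniq//; exact: addIr.
- by move=> i; exact: GC.
Qed.

Section LppLaw.
Context {R : realType} d (T : measurableType d) (P : probability T R)
  (X : T -> int * int -> R).
Hypothesis iidX : iid P X.

Lemma lpp_shift (Y : int * int -> R) (v a b : int * int) :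
  lattice_last_passage (fun z => Y (z + v)) a b =
  lattice_last_passage Y (a + v) (b + v).
Proof.
have stepE (x y u : int * int) : lattice_step (x + u) (y + u) = lattice_step x y.
  case: x y u => x1 x2 [y1 y2] [u1 u2]; rewrite /lattice_step/=.
    rewrite (_ : (y1, y2) + (u1, u2) = (y1 + u1, y2 + u2))//.
  by rewrite !xpair_eqE; congr orb; congr andb; lia.
have pathE x p : path lattice_step (x + v) [seq z + v | z <- p] = path lattice_step x p.
  by elim: p x => //= y p IH x; rewrite stepE IH.
have lastE x p : last (x + v) [seq z + v | z <- p] = last x p + v.
  by rewrite (last_map (fun z => z + v)).
congr ereal_sup; apply/seteqP; split => _ [p [pp pb] <-].
  exists [seq z + v | z <- p]; first by rewrite /= pathE lastE pb.
  by rewrite big_map.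
exists [seq z - v | z <- p].
  have pK : [seq z + v | z <- [seq z - v | z <- p]] = p.
    by rewrite -map_comp -[RHS]map_id; apply: eq_map => z /=; rewrite subrK.
  split; first by rewrite -pathE pK.
  by apply: (addIr v); rewrite -lastE pK.
by rewrite big_map; congr EFin; apply: eq_bigr => z _; rewrite subrK.
Qed.

Lemma lpp_gt_shift (a v : int * int) (r : R) :
  P [set w | (r%:E < lattice_last_passage (X w) a (a + v)%R)%E] =
  P [set w | (r%:E < lattice_last_passage (X w) (0, 0)%R v)%E].
Proof.
have [mX _ _] := iidX.
have sl := iid_shift a iidX.
have mX' : random_function (fun w z => X w (z + a)) by move=> z; exact: mX.
have := same_law_cylinder_space mX' mX sl
  (measurable_lpp_gt (0, 0) v r random_function_id).
move=> <-; congr (P _); apply/seteqP; split => w /=; rewrite lpp_shift;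
  by rewrite (_ : (0, 0) + a = a) ?[v + a]addrC//; case: a {sl mX'} => ? ?; congr (_, _); rewrite add0r.
Qed.

End LppLaw.

(** * Tail estimates from the moment bound *)

Section TailBound.
Context {R : realType} d (T : measurableType d) (P : probability T R)
  (X : T -> int * int -> R).
Variables (rho alpha beta chi tau : R) (r C : R) (n0 : nat).
Hypotheses (iidX : iid P X) (chi0 : 0 < chi) (tau0 : 0 < tau) (r0 : 0 < r).
Local Notation dn := (rescaled_lpp rho alpha beta chi tau).
Hypothesis momentX : forall n, (n0 <= n)%N -> forall x : R, -3 <= x <= 3 ->
  (negative_part_moment P r (fun w => dn n (X w) ((0, 0), (x, 1))%R) <= C%:E)%E.

Lemma markov_poweR (f : T -> \bar R) (c : R) : measurable_fun setT f -> 0 < c ->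
  (negative_part_moment P r f <= C%:E)%E ->
  (P [set w | (f w <= (- c)%:E)%E] <= (C / c `^ r)%:E)%E.
Proof.
move=> mf c0 mom.
set E := [set w | _].
have mE : measurable E.
  have := mf measurableT `]-oo, (- c)%:E]%classic (emeasurable_itv _).
  by rewrite setTI; congr measurable; apply/seteqP; split => w /=; rewrite in_itv.
have cr0 : 0 < c `^ r by exact: powR_gt0.
rewrite EFinM lee_pdivlMr//.
apply: le_trans mom.
have -> : (P E * (c `^ r)%:E = \int[P]_w ((c `^ r)%:E * (\1_E w)%:E))%E.
  rewrite ge0_integralZl//=; last 2 first.
  - by apply/measurable_EFinP; exact: measurable_indic.
  - by rewrite lee_fin ltW.
  by rewrite integral_indic// setIT muleC.
apply: ge0_le_integral => //.
- by move=> w _; rewrite mule_ge0// lee_fin// ltW.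
- apply: measurable_funeM.
  by apply/measurable_EFinP; exact: measurable_indic.
- apply: (measurableT_comp (measurable_poweR _)).
  by apply: measurable_maxe; [exact: measurableT_comp|exact: measurable_cst].
- move=> w _; rewrite indicE; case: (boolP (w \in E)) => [|_]; last first.
    by rewrite mule0 poweR_ge0.
  rewrite inE => Ew; rewrite mule1 -poweR_EFin.
  have cf : (c%:E <= - f w)%E by move: Ew; rewrite /E/= EFinN leeNr.
  apply: gt0_ler_poweR; rewrite ?(ltW r0)//.
  - by rewrite in_itv/= leey andbT lee_fin ltW.
  - by rewrite in_itv/= leey andbT le_max lexx orbT.
  - by rewrite le_max cf.
Qed.

(** The centering as a linear form on lattice vectors: up to rounding, -v.2 is n times the duration,
    and v.1 + rho v.2 is the space displacement times tau n^(2/3). *)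
Definition drift (v : int * int) : R :=
  alpha * (- v.2%:~R) + beta * (v.1%:~R + rho * v.2%:~R).

(** By stationarity only the displacement [v] matters, and a displacement of duration [m] is one of
    unit duration for [d_m]. So the moment bound is applied at index [m], followed by Markov's
    inequality. *)
Lemma lpp_tail_bound (a v : int * int) (m : nat) (lam : R) :
  (0 < m)%N -> (n0 <= m)%N -> v.2 = - m%:Z -> 0 < lam ->
  `|v.1%:~R - rho * m%:R| <= 3 * tau * m%:R `^ (2 / 3) ->
  (P [set w | ~ ((drift v - lam)%:E < lattice_last_passage (X w) a (a + v)%R)%E] <=
   (C * (chi * m%:R `^ (1 / 3) / lam) `^ r)%:E)%E.
Proof.
move=> m0 nm v2 lam0 vb.
have [mX _ _] := iidX.
have m0' : (0 : R) < m%:R by rewrite ltr0n.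
have t0 : 0 < tau * m%:R `^ (2 / 3) by rewrite mulr_gt0// powR_gt0.
have k0 : 0 < chi * m%:R `^ (1 / 3) by rewrite mulr_gt0// powR_gt0.
(* With this abscissa [lattice_point rho tau m (x, 1)] is exactly [v], since both floors are taken
   of integers. *)
pose x := (v.1%:~R - rho * m%:R) / (tau * m%:R `^ (2 / 3)).
have xb : -3 <= x <= 3.
  rewrite -ler_norml normrM normfV (gtr0_norm t0) ler_pdivrMr// mulrA.
  exact: vb.
have e1 : [set w | ~ ((drift v - lam)%:E < lattice_last_passage (X w) a (a + v)%R)%E] =
  ~` [set w | ((drift v - lam)%:E < lattice_last_passage (X w) a (a + v)%R)%E] by [].
rewrite e1 probability_setC; last exact: measurable_lpp_gt.
rewrite lpp_gt_shift// -probability_setC; last exact: measurable_lpp_gt.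
pose c := lam / (chi * m%:R `^ (1 / 3)).
have c0 : 0 < c by rewrite divr_gt0.
have -> : (chi * m%:R `^ (1 / 3) / lam) `^ r = (c `^ r)^-1.
  apply/esym/mulr1_eq; rewrite -powRM ?(ltW c0)//; last by rewrite divr_ge0 ?(ltW k0) ?(ltW lam0).
  by rewrite /c mulrA divfK ?gt_eqF// divff ?powR1// gt_eqF.
apply: le_trans (markov_poweR (measurable_rescaled_lpp rho alpha beta chi tau m _ mX) c0 (momentX nm xb)).
have lp0 : lattice_point rho tau m (0, 0) = (0, 0).
  by rewrite /lattice_point/= !mulr0 addr0 oppr0 floor0.
have lpx : lattice_point rho tau m (x, 1) = v.
  rewrite /lattice_point/= !mulr1 /x [tau * _ * _]mulrC divfK ?gt_eqF//.
  rewrite addrC subrK intrKfloor.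
  rewrite (_ : - m%:R = (- m%:Z)%:~R :> R) ?intrKfloor; last by rewrite mulrNz.
  by rewrite -v2; case: (v).
have ce : centering alpha beta tau m (0, 0) (x, 1) = drift v.
  rewrite /centering /drift/= !subr0 mulr1 v2.
  have -> : beta * tau * m%:R `^ (2 / 3) * x = beta * (tau * m%:R `^ (2 / 3) * x) by ring.
  by rewrite /x [tau * _ * _]mulrC divfK ?gt_eqF// rmorphN/= opprK mulrN.
apply: le_measure.
- rewrite inE; apply: measurableC; exact: measurable_lpp_gt.
- rewrite inE.
  have mR := measurable_rescaled_lpp rho alpha beta chi tau m ((0, 0), (x, 1))%R mX.
  have := mR measurableT `]-oo, (- c)%:E]%classic (emeasurable_itv _).
  by rewrite setTI; congr measurable; apply/seteqP; split => w /=; rewrite in_itv.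
move=> w /negP; rewrite -leNgt => H.
change (dn m (X w) ((0, 0), (x, 1))%R <= (- c)%:E)%E.
rewrite rescaled_lppE lp0 lpx ce; move: H.
case: (lattice_last_passage _ _ _) => [L||]//= H.
  rewrite lee_fin ler_pdivrMr// mulNr /c divfK ?gt_eqF//.
  by move: H; rewrite lee_fin; lra.
by rewrite gt0_mulNye ?leNye// lte_fin invr_gt0.
Qed.

End TailBound.

Lemma limn_esup_bounded {R : realType} (u : nat -> \bar R) :
  (limn_esup u < +oo)%E -> exists (C : R) N, 0 < C /\ forall n, (N <= n)%N -> (u n <= C%:E)%E.
Proof.
move=> /ereal_inf_lt[_ [V [N _ NV] <-]] Vy.
have [C [C0 HC]] : exists C : R, 0 < C /\ (ereal_sup (u @` V) <= C%:E)%E.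
  case: (ereal_sup _) Vy => [c _||_]//.
    by exists (Num.max 1 c); rewrite lt_max ltr01 lee_fin le_max lexx orbT.
  by exists 1; rewrite leNye.
exists C, N; split => // n Nn; apply: le_trans HC.
by apply: ereal_sup_ubound; exists n => //; exact: NV.
Qed.

(** * Chains of lattice edges *)

Section Grid.
Context {R : realType}.
Variables (rho alpha beta tau : R).
Implicit Types (X : int * int -> R) (p q : int * int) (l k : int) (j n : nat).
Local Notation drift := (drift rho alpha beta).

Lemma cube_root_le (a x : R) : 0 <= a -> a ^+ 3 <= x ->
  a <= x `^ (1 / 3) /\ a ^+ 2 <= x `^ (2 / 3).
Proof.
move=> a0 ax.
have x0 : 0 <= x by apply: le_trans ax; exact: exprn_ge0.
have h : a <= x `^ (1 / 3).
  have -> : a = (a ^+ 3) `^ (1 / 3).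
    by rewrite -powR_mulrn// -powRrM mulrCA divff ?pnatr_eq0// mulr1 powRr1.
  by apply: ge0_ler_powR => //; rewrite ?nnegrE ?exprn_ge0// divr_ge0.
split => //.
have -> : x `^ (2 / 3) = (x `^ (1 / 3)) ^+ 2.
  by rewrite -powR_mulrn ?powR_ge0// -powRrM; congr (_ `^ _); field.
by rewrite ler_pXn2r// nnegrE powR_ge0.
Qed.

Lemma cube_root_ge (a x : R) : 0 <= x -> 0 <= a -> x <= a ^+ 3 -> x `^ (1 / 3) <= a.
Proof.
move=> x0 a0 ax.
have -> : a = (a ^+ 3) `^ (1 / 3).
  by rewrite -powR_mulrn// -powRrM mulrCA divff ?pnatr_eq0// mulr1 powRr1.
by apply: ge0_ler_powR => //; rewrite ?nnegrE ?exprn_ge0// divr_ge0.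
Qed.

(** The flag tells whether the chain goes from [p] to the future or to the past. The displacement is
    oriented forwards in time in both cases, so that one estimate serves both. *)
Definition dvec (fw : bool) p q : int * int := if fw then q - p else p - q.

Definition directed_lpp (fw : bool) X p q : \bar R :=
  if fw then lattice_last_passage X p q else lattice_last_passage X q p.

Definition good_edge fw X p q (lam : R) : Prop :=
  ((drift (dvec fw p q) - lam)%:E < directed_lpp fw X p q)%E.

Lemma driftD (u v : int * int) : drift (u + v) = drift u + drift v.
Proof. by case: u v => u1 u2 [v1 v2]; rewrite /drift/= !rmorphD/=; ring. Qed.

Lemma dvecD fw p q r : dvec fw p r = dvec fw p q + dvec fw q r.
Proof. by case: fw; rewrite /dvec ?subrKA// [RHS]addrC subrKA. Qed.

Lemma good_edge_trans fw X p q r (l1 l2 : R) :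
  good_edge fw X p q l1 -> good_edge fw X q r l2 -> good_edge fw X p r (l1 + l2).
Proof.
rewrite /good_edge (dvecD fw p q r) driftD.
move=> h1 h2; have h12 := lteD h1 h2.
have h3 : (directed_lpp fw X p q + directed_lpp fw X q r <= directed_lpp fw X p r)%E.
  by case: fw {h1 h2 h12} => /=; [|rewrite addeC]; exact: lpp_superadd.
apply: lt_le_trans h3; apply: le_lt_trans h12.
by rewrite -EFinD lee_fin; lra.
Qed.

(** Level [j] has time step 8^j and space step tau 4^j, measured from the line of direction rho.
    Time is minus the second coordinate. *)
Definition grid j l k : int * int :=
  (Num.floor (rho * (8 ^+ j * k%:~R) + tau * 4 ^+ j * l%:~R), - ((8 ^ j)%N%:Z * k)).

(* A chain visits, at level [j], a grid point [offset] cells beyond the cell of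
its starting point; consecutive visited points are then separated in time by at
least [8^j], whichever cells they belong to. *)
Definition offset (fw : bool) : int := if fw then 2 else -1.

(** The edges to which the moment bound applies: rescaled slope within the [-3, 3] of [U], and
    duration at most 27 * 8^j, whose cube root is 3 * 2^j. *)
Definition admissible j fw p q : Prop := exists m : nat,
  [/\ (8 ^ j <= m <= 27 * 8 ^ j)%N, (dvec fw p q).2 = - m%:Z &
      `|(dvec fw p q).1%:~R - rho * m%:R| <= 3 * tau * m%:R `^ (2 / 3)].

Lemma floor_bounds (x : R) : (Num.floor x)%:~R <= x < (Num.floor x)%:~R + 1.
Proof. by have := floor_itv x; rewrite rmorphD. Qed.

(** The nearest slice that is at least one more time step of level [j] beyond the grid point; in
    lattice time the slices are [n * eta] apart. *)
Definition slice_index fw n (eta : R) j k : int :=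
  if fw then Num.ceil ((8 ^+ j * (k + offset fw)%:~R + 8 ^+ j) / (n%:R * eta))
  else Num.floor ((8 ^+ j * (k + offset fw)%:~R - 8 ^+ j) / (n%:R * eta)).

(** The ceiling of n i eta, written so as to be minus the second coordinate of [lattice_point] at
    time i eta. *)
Definition slice_time n (eta : R) (i : int) : int := - Num.floor (- (n%:R * (i%:~R * eta))).

(** The grid point is continued in direction rho, so that the slope of the last edge is only a
    rounding error. *)
Definition slice_end fw n (eta : R) j l k : int * int :=
  let g := grid j l (k + offset fw) in
  let tm := slice_time n eta (slice_index fw n eta j k) in
  (g.1 + (if fw then Num.floor (rho * `|(tm + g.2)%R|%N%:R)
          else - Num.floor (rho * `|(tm + g.2)%R|%N%:R)), - tm).

Lemma slice_time_bounds n (eta : R) i :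
  n%:R * (i%:~R * eta) <= (slice_time n eta i)%:~R < n%:R * (i%:~R * eta) + 1.
Proof.
rewrite /slice_time rmorphN/=; have /andP[] := floor_bounds (- (n%:R * (i%:~R * eta))).
by move=> h1 h2; apply/andP; split; lra.
Qed.

(** The gap is one step 8^j, plus less than n eta < 8 * 8^j from the rounding to a slice, plus less
    than 1 from the rounding of lattice time, hence at most 10 * 8^j. *)
Lemma slice_time_gap fw n (eta : R) j k : 0 < n%:R * eta -> n%:R * eta < 8 ^+ j.+1 ->
  exists m : nat, [/\ (8 ^ j <= m <= 10 * 8 ^ j)%N,
    slice_time n eta (slice_index fw n eta j k) - (8 ^ j)%N%:Z * (k + offset fw) =
      (if fw then m%:Z else - m%:Z) &
    (if fw then 0 <= n%:R * ((slice_index fw n eta j k)%:~R * eta) - 8 ^+ j * (k + offset fw)%:~R - 8 ^+ j < n%:R * eta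
     else 0 <= 8 ^+ j * (k + offset fw)%:~R - 8 ^+ j - n%:R * ((slice_index fw n eta j k)%:~R * eta) < n%:R * eta)].
Proof.
move=> ne0 ne8.
set i := slice_index _ _ _ _ _; set g : int := (8 ^ j)%N%:Z * (k + offset fw).
have gR : (g%:~R : R) = 8 ^+ j * (k + offset fw)%:~R.
  by rewrite /g rmorphM/= -[_%:~R]/((8 ^ j)%N%:R) natrX.
have /andP[s1 s2] := slice_time_bounds n eta i.
have ib : if fw then 0 <= n%:R * (i%:~R * eta) - g%:~R - 8 ^+ j < n%:R * eta
     else 0 <= g%:~R - 8 ^+ j - n%:R * (i%:~R * eta) < n%:R * eta.
  have ie : n%:R * (i%:~R * eta) = (n%:R * eta) * i%:~R by ring.
  rewrite ie gR /i /slice_index; case: (fw).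
    set y := (_ + _) / _; have /andP[c1 c2] := ceil_itv y.
    have yE : (n%:R * eta) * y = 8 ^+ j * (k + offset true)%:~R + 8 ^+ j.
      by rewrite mulrC divfK// gt_eqF.
    have e1 : (n%:R * eta) * y <= (n%:R * eta) * (Num.ceil y)%:~R by rewrite ler_pM2l.
    have e2 : (n%:R * eta) * ((Num.ceil y)%:~R - 1) < (n%:R * eta) * y.
      by rewrite ltr_pM2l//; move: c1; rewrite rmorphB.
    by move: e1 e2; rewrite yE mulrBr mulr1 => e1 e2; apply/andP; split; lra.
  set y := (_ - _) / _; have /andP[c1 c2] := floor_bounds y.
  have yE : (n%:R * eta) * y = 8 ^+ j * (k + offset false)%:~R - 8 ^+ j.
    by rewrite mulrC divfK// gt_eqF.
  have e1 : (n%:R * eta) * (Num.floor y)%:~R <= (n%:R * eta) * y by rewrite ler_pM2l.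
  have e2 : (n%:R * eta) * y < (n%:R * eta) * ((Num.floor y)%:~R + 1) by rewrite ltr_pM2l.
  by move: e1 e2; rewrite yE mulrDr mulr1 => e1 e2; apply/andP; split; lra.
set tm := slice_time _ _ _ in s1 s2 *.
clearbody g tm i.
have j1 : (1 : R) <= 8 ^+ j by rewrite exprn_ege1// ler1n.
have jN : ((8 ^ j)%N%:Z%:~R : R) = 8 ^+ j by rewrite -[_%:~R]/((8 ^ j)%N%:R) natrX.
have e8 : (8 : R) ^+ j.+1 = 8 * 8 ^+ j by rewrite exprS.
exists `|(tm - g)%R|%N; split; last by rewrite -gR.
  have : (if fw then (8 ^ j)%N%:Z <= tm - g <= 10 * (8 ^ j)%N%:Z
          else (8 ^ j)%N%:Z <= g - tm <= 10 * (8 ^ j)%N%:Z).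
    have e10 : ((10 * (8 ^ j)%N%:Z)%:~R : R) = 10 * 8 ^+ j by rewrite rmorphM/= jN.
    (* The rounding of lattice time loses less than 1, which integrality restores. *)
    have P0 (x y : int) : (x%:~R : R) < y%:~R + 1 -> x <= y.
      by rewrite -[1]/((1 : int)%:~R) -rmorphD ltr_int ltzD1.
    move: ib; case: (fw) => /andP[i1 i2]; apply/andP; split; apply: P0;
      rewrite ?e10 ?rmorphB/= ?jN; clear -i1 i2 s1 s2 j1 e8 ne8; lra.
  by clear; case: fw => h; clear -h; lia.
have : (if fw then 0 <= tm - g else 0 <= g - tm).
  have P0 (x : int) : (-1 : R) < x%:~R -> 0 <= x.
    by rewrite -[-1]/((-1 : int)%:~R) ltr_int; lia.
  by move: ib; case: (fw) => /andP[i1 i2]; apply: P0; rewrite rmorphB/=; lra.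
by clear; case: fw => h; clear -h; lia.
Qed.

(** This is 7^(2/3) >= 2, obtained from (3/2)^3 <= 7 and (3/2)^2 >= 2. *)
Lemma grid_time_pow23 j m : (7 <= m)%N ->
  2 * 4 ^+ j <= ((8 ^ j * m)%N%:R : R) `^ (2 / 3).
Proof.
move=> m7; have [||_] := @cube_root_le (3 / 2 * 2 ^+ j) (8 ^ j * m)%N%:R.
- by rewrite mulr_ge0// exprn_ge0.
- rewrite natrM natrX exprMn -exprM mulnC exprM (_ : 2 ^+ 3 = 8); last by ring.
  rewrite mulrC ler_pM2l ?exprn_gt0//.
  by apply: (@le_trans _ _ 7); [lra|rewrite ler_nat].
apply: le_trans; rewrite exprMn -exprM mulnC exprM (_ : 2 ^+ 2 = 4); last by ring.
by rewrite ler_pM2r ?exprn_gt0//; lra.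
Qed.

Hypothesis tau0 : 0 < tau.

(** The parent cell has indices [l] divided by 4 and [k] divided by 8. Measured in cells, the edge
    moves by the residue of [l], at most 3, beside direction rho, and lasts at least 7 steps thanks
    to the offsets. *)
Lemma grid_edge_admissible j fw l k : 1 <= 3 * tau * 4 ^+ j ->
  admissible j fw (grid j l (k + offset fw))
    (grid j.+1 (l %/ 4)%Z ((k %/ 8)%Z + offset fw)).
Proof.
move=> tj.
(* The duration in steps of level [j]: 8 (q + 2) - (8 q + r + 2) = 14 - r forwards and (8 q + r - 1)
   - 8 (q - 1) = 7 + r backwards, with q and r the quotient and remainder of [k] by 8. *)
pose mm : nat := if fw then (14 - `|(k %% 8)%Z|)%N else (7 + `|(k %% 8)%Z|)%N.
have k8 : k = (k %/ 8)%Z * 8 + (k %% 8)%Z by exact: divz_eq.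
have r8 : 0 <= (k %% 8)%Z < 8 by rewrite modz_ge0// ltz_pmod.
have l4 : l = (l %/ 4)%Z * 4 + (l %% 4)%Z by exact: divz_eq.
have r4 : 0 <= (l %% 4)%Z < 4 by rewrite modz_ge0// ltz_pmod.
move: k8 r8 l4 r4 @mm.
set kq := (k %/ 8)%Z; set kr := (k %% 8)%Z; set lq := (l %/ 4)%Z; set lr := (l %% 4)%Z.
move=> k8 r8 l4 r4 mm.
have mmb : (7 <= mm <= 14)%N by rewrite /mm; case: (fw); lia.
have j8 : (0 < 8 ^ j)%N by rewrite expn_gt0.
exists (8 ^ j * mm)%N.
have mR : ((8 ^ j * mm)%N%:R : R) = 8 ^+ j * mm%:R by rewrite natrM natrX.
have j4 : (0 : R) < 4 ^+ j by exact: exprn_gt0.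
have j8' : (0 : R) < 8 ^+ j by exact: exprn_gt0.
have mmE : (mm%:Z = if fw then 14 - kr else 7 + kr) by rewrite /mm; case: (fw); lia.
have intle (x y : int) : x <= y -> (x%:~R : R) <= y%:~R by rewrite ler_int.
have lr3 : 0 <= (lr%:~R : R) <= 3.
  by apply/andP; split; [apply: (intle 0 lr)|apply: (intle lr 3)]; lia.
have mmz : (mm%:R : R) = (mm%:Z)%:~R by [].
split.
- by rewrite leq_pmulr ?(leq_trans _ (andP mmb).1)//= mulnC leq_pmul2r// (leq_trans (andP mmb).2).
- rewrite /dvec PoszM mmE /grid expnS PoszM.
  by case: (fw) => /=; rewrite {1}k8; ring.
- set f1 := rho * (8 ^+ j * (k + offset fw)%:~R) + tau * 4 ^+ j * l%:~R.
  set f2 := rho * (8 ^+ j.+1 * (kq + offset fw)%:~R) + tau * 4 ^+ j.+1 * lq%:~R.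
  have /andP[a1 a2] := floor_bounds f1; have /andP[b1 b2] := floor_bounds f2.
  have df : f2 - f1 = (if fw then 1 else -1) * (rho * (8 ^+ j * mm%:R)) - tau * 4 ^+ j * lr%:~R.
    rewrite /f1 /f2 mmz mmE k8 l4 !exprS.
    by case: (fw); rewrite /offset !(rmorphD, rmorphM, rmorphB, rmorphN)/=; ring.
  have m23 := grid_time_pow23 j (andP mmb).1.
  have tl : 0 <= tau * 4 ^+ j * lr%:~R <= 3 * (tau * 4 ^+ j).
    rewrite mulr_ge0 ?mulr_ge0 ?(ltW tau0) ?(ltW j4)//=; last by case/andP: lr3.
    by rewrite mulrC ler_wpM2r ?mulr_ge0 ?(ltW tau0) ?(ltW j4)//; case/andP: lr3.
  (* The slope 3 is used here: three cells and a rounding error of at most 3 tau 4^j make 6 tau 4^j,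
     which is 3 times the lower bound 2 tau 4^j of [grid_time_pow23]. *)
  have bnd : 3 * (tau * 4 ^+ j) + 1 <= 3 * tau * ((8 ^ j * mm)%N%:R : R) `^ (2 / 3).
    apply: (@le_trans _ _ (3 * tau * (2 * 4 ^+ j))); first by lra.
    by rewrite ler_pM2l// mulr_gt0.
  apply: le_trans bnd; rewrite mR; set mr := rho * _ in df *.
  set g1 := grid _ _ _; set g2 := grid _ _ _.
  have {}b1 : g2.1%:~R <= f2 by [].
  have {}b2 : f2 < g2.1%:~R + 1 by [].
  have {}a1 : g1.1%:~R <= f1 by [].
  have {}a2 : f1 < g1.1%:~R + 1 by [].
  rewrite ler_norml /dvec; case: (fw) df => df; rewrite [(_ - _).1]/= rmorphB/=;
    move: df tl; set tt := tau * _ * _; set t4 := tau * _; rewrite ?mul1r ?mulN1r;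
    move=> df /andP[tl1 tl2]; clear -a1 a2 b1 b2 df tl1 tl2; apply/andP; split; lra.
Qed.

Lemma slice_edge_admissible fw n (eta : R) j l k : 0 < n%:R * eta ->
  n%:R * eta < 8 ^+ j.+1 -> 1 <= 3 * tau * 4 ^+ j ->
  admissible j fw (grid j l (k + offset fw)) (slice_end fw n eta j l k).
Proof.
move=> ne0 ne8 tj; have [m [mb mE _]] := slice_time_gap fw k ne0 ne8.
exists m; rewrite /slice_end.
set tm := slice_time _ _ _ in mE *.
have gE : tm + (grid j l (k + offset fw)).2 = if fw then m%:Z else - m%:Z by rewrite -mE.
have aE : `|(tm + (grid j l (k + offset fw)).2)%R|%N = m by rewrite gE; case: (fw); lia.
rewrite aE; set f := Num.floor _.
split; first by move: mb; lia.
  by move: gE; rewrite /dvec; case: (fw) => /=; lia.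
have dE : (dvec fw (grid j l (k + offset fw))
   ((grid j l (k + offset fw)).1 + (if fw then f else - f), - tm)).1 = f.
  by rewrite /dvec; case: (fw) => /=; lia.
rewrite dE.
have m1 : 1 <= 3 * tau * (m%:R : R) `^ (2 / 3).
  apply: le_trans tj _; rewrite ler_pM2l ?mulr_gt0//.
  have [|_] := @cube_root_le (2 ^+ j) m%:R (exprn_ge0 _ (ler0n _ 2)).
    rewrite -exprM mulnC exprM (_ : 2 ^+ 3 = 8); last by ring.
    by rewrite -natrX ler_nat; case/andP: mb.
  by apply: le_trans; rewrite -exprM mulnC exprM (_ : 2 ^+ 2 = 4)//; ring.
apply: le_trans m1; have /andP[h1 h2] := floor_bounds (rho * m%:R).
by rewrite ler_norml -/f; apply/andP; split; rewrite /f; lra.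
Qed.

End Grid.

Section Chain.
Context {R : realType}.
Variables (rho alpha beta tau : R).
Implicit Types (X : int * int -> R) (p q : int * int) (l k : int) (j n J : nat).
Local Notation drift := (drift rho alpha beta).
Local Notation good_edge := (good_edge rho alpha beta).
Local Notation grid := (grid rho tau).

Definition cell_t p j : int := ((- p.2) %/ (8 ^ j)%N%:Z)%Z.

(** The space coordinate of a lattice point: before rounding, it is tau n^(2/3) x at the image of
    (x, s). *)
Definition height p : R := p.1%:~R + rho * p.2%:~R.

Definition cell_x p j : int := Num.floor (height p / (tau * 4 ^+ j)).

Definition slice_x n (eta : R) q (i : int) : R :=
  (q.1%:~R - rho * n%:R * (i%:~R * eta)) / (tau * n%:R `^ (2 / 3)).

(** Cells of successive levels are nested, so the parent of the cell of [p] is again the cell of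
    [p]; with [cell_xS], the edges to parent cells therefore form a chain. *)
Lemma cell_tS p j : cell_t p j.+1 = (cell_t p j %/ 8)%Z.
Proof.
rewrite /cell_t; have j8 : 0 < (8 ^ j)%N%:Z by rewrite ltz_nat expn_gt0.
by rewrite expnS PoszM mulrC divzMA_ge0// ltW.
Qed.

Lemma cell_t_bounds p j : exists m : nat, (m < 8 ^ j)%N /\
  - p.2 = (8 ^ j)%N%:Z * cell_t p j + m%:Z.
Proof.
have j8 : 0 < (8 ^ j)%N%:Z by rewrite ltz_nat expn_gt0.
have mE := divz_eq (- p.2) (8 ^ j)%N%:Z.
have m0 : 0 <= (- p.2 %% (8 ^ j)%N%:Z)%Z by rewrite modz_ge0// gt_eqF.
have m8 : (- p.2 %% (8 ^ j)%N%:Z)%Z < (8 ^ j)%N%:Z by exact: ltz_pmod.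
exists `|(- p.2 %% (8 ^ j)%N%:Z)%Z|%N; rewrite gez0_abs//; split.
  by rewrite -ltz_nat gez0_abs.
by rewrite {1}mE mulrC.
Qed.

Lemma dvec_snd fw p q (m : nat) : (dvec fw p q).2 = - m%:Z ->
  q.2 - p.2 = if fw then - m%:Z else m%:Z.
Proof. by rewrite /dvec; case: fw => /=; lia. Qed.

Lemma directed_lpp_ge0 fw X p q (m : nat) : (forall z, 0 <= X z) ->
  0 <= (dvec fw p q).1 -> (dvec fw p q).2 = - m%:Z ->
  (0%:E <= directed_lpp fw X p q)%E.
Proof.
rewrite /dvec /directed_lpp => X0; case: fw; case: p q => p1 p2 [q1 q2] /= v1 v2;
  by apply: lpp_ge0 => //=; lia.
Qed.

Hypothesis tau0 : 0 < tau.

Lemma cell_xS p j : cell_x p j.+1 = (cell_x p j %/ 4)%Z.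
Proof.
rewrite /cell_x; pose y := height p / (tau * 4 ^+ j); rewrite -/y.
have -> : height p / (tau * 4 ^+ j.+1) = y / 4.
  by rewrite /y exprS; field; rewrite ?gt_eqF// ?exprn_gt0.
have /andP[f1 f2] := floor_bounds y.
have fE := divz_eq (Num.floor y) 4.
have r4 : 0 <= (Num.floor y %% 4)%Z < 4 by rewrite modz_ge0// ltz_pmod.
move: f1 f2 fE r4; set f := Num.floor y.
set q := (f %/ 4)%Z; set r := (f %% 4)%Z => f1 f2 fE r4.
apply: floor_def; rewrite rmorphD/=.
have fR : (f%:~R : R) = q%:~R * 4 + r%:~R by rewrite fE rmorphD rmorphM.
have intle (a b : int) : a <= b -> (a%:~R : R) <= b%:~R by rewrite ler_int.
have r0 : 0 <= (r%:~R : R) by apply: (intle 0 r); case/andP: r4.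
have r3 : (r%:~R : R) <= 3 by apply: (intle r 3); case/andP: r4; clear; lia.
clear -f1 f2 fR r0 r3; rewrite ler_pdivlMr// ltr_pdivrMr//.
by apply/andP; split; lra.
Qed.

Lemma cell_x_bounds p j :
  height p - tau * 4 ^+ j < tau * 4 ^+ j * (cell_x p j)%:~R <= height p.
Proof.
have t0 : 0 < tau * 4 ^+ j by rewrite mulr_gt0// exprn_gt0.
have /andP[f1 f2] := floor_bounds (height p / (tau * 4 ^+ j)).
rewrite -/(cell_x p j) in f1 f2.
move: f1 f2; rewrite ler_pdivlMr// ltr_pdivrMr// => f1 f2.
move: f2; rewrite mulrDl mul1r => f2; rewrite [tau * 4 ^+ j * _]mulrC f1 andbT.
by move: (height p) f2 => h f2; rewrite ltrBlDr.
Qed.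

(** [slice_x] inverts [lattice_point] at slice times, exactly because the coordinates of [q] are
    integers. *)
Lemma slice_xK n (eta : R) q i : (0 < n)%N -> q.2 = - slice_time n eta i ->
  lattice_point rho tau n (slice_x n eta q i, i%:~R * eta) = q.
Proof.
move=> n0 q2; have t0 : 0 < tau * n%:R `^ (2 / 3) by rewrite mulr_gt0// powR_gt0// ltr0n.
have xE : tau * n%:R `^ (2 / 3) * slice_x n eta q i =
    q.1%:~R - rho * n%:R * (i%:~R * eta).
  by rewrite /slice_x mulrC divfK// gt_eqF.
rewrite /lattice_point/= xE addrC subrK intrKfloor.
by move: q2; rewrite /slice_time opprK => <-; case: (q).
Qed.

Hypotheses (rho0 : 0 < rho) (alpha0 : 0 <= alpha) (beta0 : 0 <= beta).

Definition base_cost j : R := 2 * alpha * 8 ^+ j + beta * (tau * 4 ^+ j + 1) + 1.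

(** Below the first level only nonnegativity of the weights is used: a path exists and has
    nonnegative weight, so the cost is at most the drift. At a fixed level this is a constant,
    negligible against n^(1/3). The hypothesis on [j] makes the edge go to the right; the last 1 in
    [base_cost] makes the inequality strict. *)
Lemma base_edge fw X p j : (forall z, 0 <= X z) -> tau * 4 ^+ j + 1 <= rho * 8 ^+ j ->
  good_edge fw X p (grid j (cell_x p j) (cell_t p j + offset fw)) (base_cost j).
Proof.
move=> X0 rj.
have [m [m8 tE]] := cell_t_bounds p j.
have /andP[x1 x2] := cell_x_bounds p j.
set k := cell_t p j in tE *; set l := cell_x p j in x1 x2 *.
(* With -p.2 = 8^j k + m and m < 8^j, this is the distance in time to step k + 2 forwards, or to
   step k - 1 backwards. *)
pose mm : nat := if fw then (2 * 8 ^ j - m)%N else (8 ^ j + m)%N.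
have mm1 : (8 ^ j <= mm <= 2 * 8 ^ j)%N by rewrite /mm; case: (fw); lia.
have d2 : (dvec fw p (grid j l (k + offset fw))).2 = - mm%:Z.
  by rewrite /dvec /mm /grid; case: (fw) => /=; move: tE; rewrite mulrDr; lia.
have mmR : 8 ^+ j <= (mm%:R : R) <= 2 * 8 ^+ j.
  by rewrite -natrX -natrM !ler_nat.
have t0 : 0 < tau * 4 ^+ j by rewrite mulr_gt0// exprn_gt0.
set g := grid j l (k + offset fw) in d2 *.
have /andP[g1a g1b] := floor_bounds (rho * (8 ^+ j * (k + offset fw)%:~R) + tau * 4 ^+ j * l%:~R).
have g2R : (8 : R) ^+ j * (k + offset fw)%:~R = - g.2%:~R.
  by rewrite /g /grid/= rmorphN rmorphM/= opprK -[(8 ^ j)%N%:~R]/((8 ^ j)%N%:R) natrX.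
have gpE : (g.2%:~R : R) - p.2%:~R = if fw then - mm%:R else mm%:R.
  have e2 : g.2 - p.2 = if fw then - mm%:Z else mm%:Z.
    exact: dvec_snd.
  by rewrite -rmorphB e2; case: (fw); rewrite ?rmorphN.
have d1 : - (tau * 4 ^+ j) - 1 <= (dvec fw p g).1%:~R - rho * mm%:R <= tau * 4 ^+ j + 1.
  rewrite /dvec; move: g1a g1b; rewrite -[Num.floor _]/(g.1) g2R.
  rewrite /height in x1 x2.
  have gp : rho * g.2%:~R = rho * p.2%:~R + rho * (if fw then - mm%:R else mm%:R).
    by rewrite -mulrDr -gpE addrC subrK.
  move: gp; case: (fw) => /=; rewrite ?mulrN rmorphB/= => gp ga gb;
    clear -x1 x2 gp ga gb t0; apply/andP; split; lra.
have lpp0 : (0%:E <= directed_lpp fw X p g)%E.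
  have v1 : 0 <= (dvec fw p g).1.
    rewrite -(ler0z R); apply: (@le_trans _ _ (rho * mm%:R - tau * 4 ^+ j - 1)).
      have : rho * 8 ^+ j <= rho * mm%:R by rewrite ler_pM2l//; case/andP: mmR.
      by clear -rj; lra.
    by case/andP: d1 => + _; clear; lra.
  exact: directed_lpp_ge0 d2.
rewrite /good_edge; apply: lt_le_trans lpp0; rewrite lte_fin.
rewrite /drift d2 /base_cost rmorphN/= opprK mulrN.
have a1 : alpha * mm%:R <= alpha * (2 * 8 ^+ j) by rewrite ler_wpM2l//; case/andP: mmR.
have b1 : beta * ((dvec fw p g).1%:~R - rho * mm%:R) <= beta * (tau * 4 ^+ j + 1).
  by rewrite ler_wpM2l//; case/andP: d1.
by rewrite -[mm%:~R]/(mm%:R : R); clear -a1 b1; lra.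
Qed.

Lemma chain_good fw X p (lam : nat -> R) j J : (forall z, 0 <= X z) ->
  tau * 4 ^+ j + 1 <= rho * 8 ^+ j -> (j <= J)%N ->
  (forall i, (j <= i < J)%N ->
    good_edge fw X (grid i (cell_x p i) (cell_t p i + offset fw))
      (grid i.+1 (cell_x p i %/ 4)%Z ((cell_t p i %/ 8)%Z + offset fw)) (lam i)) ->
  good_edge fw X p (grid J (cell_x p J) (cell_t p J + offset fw))
    (base_cost j + \sum_(j <= i < J) lam i).
Proof.
move=> X0 rj jJ; elim: J jJ => [|J IH] jJ H.
  have j0 : j = 0%N by apply/eqP; rewrite -leqn0.
  by subst j; rewrite big_geq// addr0; exact: base_edge.
case: (ltnP J j) => Jj.
  have jE : j = J.+1 by apply/eqP; rewrite eqn_leq jJ.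
  by subst j; rewrite big_geq// addr0; exact: base_edge.
rewrite big_nat_recr//= addrA cell_xS cell_tS.
apply: good_edge_trans (H J _); last by rewrite Jj/=.
by apply: IH => // i /andP[ji iJ]; apply: H; rewrite ji/= ltnW.
Qed.

Lemma centering_drift n (u v : R * R) :
  `|centering alpha beta tau n u v -
    drift (lattice_point rho tau n v - lattice_point rho tau n u)| <=
  alpha + beta + beta * rho.
Proof.
case: u v => x s [y t]; rewrite /centering /lattice_point /drift/=.
set c := n%:R `^ (2 / 3); rewrite !rmorphB/=.
have /andP[] := floor_bounds (rho * n%:R * t + tau * c * y).
have /andP[] := floor_bounds (rho * n%:R * s + tau * c * x).
have /andP[] := floor_bounds (- (n%:R * s)).
have /andP[] := floor_bounds (- (n%:R * t)).
move: (Num.floor (rho * n%:R * t + tau * c * y))%:~R => A.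
move: (Num.floor (rho * n%:R * s + tau * c * x))%:~R => B.
move: (Num.floor (- (n%:R * s)))%:~R => S.
move: (Num.floor (- (n%:R * t)))%:~R => T => T1 T2 S1 S2 B1 B2 A1 A2.
(* [e1] and [e2] are the rounding errors in time and in space, each a difference of two fractional
   parts. *)
pose e1 := n%:R * (t - s) + (T - S).
have e1b : -1 <= e1 <= 1 by rewrite /e1; clear -T1 T2 S1 S2; apply/andP; split; lra.
pose e2 := (rho * n%:R * t + tau * c * y - A) - (rho * n%:R * s + tau * c * x - B).
have e2b : -1 <= e2 <= 1 by rewrite /e2; clear -A1 A2 B1 B2; apply/andP; split; lra.
have -> : alpha * n%:R * (t - s) + beta * tau * c * (y - x) -
    (alpha * - (T - S) + beta * (A - B + rho * (T - S))) =
    alpha * e1 + beta * e2 - beta * rho * e1.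
  by rewrite /e1 /e2; ring.
have br0 : 0 <= beta * rho by rewrite mulr_ge0// ltW.
apply: le_trans (ler_normB _ _) _; rewrite normrM (ger0_norm br0).
apply: lerD; last by rewrite ler_piMr// ler_norml.
apply: le_trans (ler_normD _ _) _; rewrite !normrM (ger0_norm alpha0) (ger0_norm beta0).
by apply: lerD; rewrite ler_piMr// ler_norml.
Qed.

Lemma good_edge_rescaled chi fw X n (u v : R * R) (lam : R) : 0 < chi -> (0 < n)%N ->
  good_edge fw X (lattice_point rho tau n u) (lattice_point rho tau n v) lam ->
  ((- ((lam + (alpha + beta + beta * rho)) / (chi * n%:R `^ (1 / 3))))%:E <=
   rescaled_lpp rho alpha beta chi tau n X (if fw then (u, v) else (v, u)))%E.
Proof.
move=> chi0 n0.
have k0 : 0 < chi * n%:R `^ (1 / 3) by rewrite mulr_gt0// powR_gt0// ltr0n.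
have key (a b : R * R) : ((drift (lattice_point rho tau n b - lattice_point rho tau n a) - lam)%:E <
    lattice_last_passage X (lattice_point rho tau n a) (lattice_point rho tau n b))%E ->
  ((- ((lam + (alpha + beta + beta * rho)) / (chi * n%:R `^ (1 / 3))))%:E <=
   rescaled_lpp rho alpha beta chi tau n X (a, b))%E.
  rewrite rescaled_lppE => H.
  have := centering_drift n a b; rewrite ler_norml => /andP[c1 c2].
  move: H; case: (lattice_last_passage _ _ _) => [L||]//=; last first.
    by rewrite gt0_mulye ?leey// lte_fin invr_gt0.
  rewrite lte_fin => H; rewrite lee_fin -mulNr ler_pM2r ?invr_gt0//.
  by clear -H c1 c2; lra.
by rewrite /good_edge /dvec /directed_lpp; case: fw; exact: key.
Qed.

End Chain.

Lemma measure_bigcup_fin_le {R : realType} d (T : measurableType d)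
    (P : probability T R) (I : finType) (E : I -> set T) (b : R) :
  (forall i, measurable (E i)) -> (forall i, (P (E i) <= b%:E)%E) ->
  (P (\bigcup_(i in setT) E i) <= (#|I|%:R * b)%:E)%E.
Proof.
move=> mE bE.
have key (s : seq I) : measurable (\bigcup_(i in [set` s]) E i) /\
    (P (\bigcup_(i in [set` s]) E i) <= ((size s)%:R * b)%:E)%E.
  elim: s => [|i s [IH1 IH2]].
    by rewrite set_nil bigcup_set0 measure0 mul0r.
  rewrite (_ : [set` i :: s] = [set i] `|` [set` s]); last first.
    apply/seteqP; split => x /=; rewrite in_cons; last first.
      by move=> [->|->]; rewrite ?eqxx ?orbT.
    by move=> /orP[/eqP ->|]; [left|right].
  rewrite bigcup_setU bigcup_set1; split; first exact: measurableU.
  apply: le_trans (measureU2 _ _ _) _ => //.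
  by rewrite /= -natr1 mulrDl mul1r [_ * b + b]addrC EFinD; apply: leeD.
have [_] := key (enum I); rewrite -cardE.
rewrite (_ : [set` enum I] = setT)//.
by apply/seteqP; split => i //= _; rewrite mem_enum.
Qed.

Section LevelDefs.
Context {R : realType}.
Variables (rho alpha beta tau : R).
Local Notation good_edge := (good_edge rho alpha beta).
Local Notation grid := (grid rho tau).
Implicit Types (l k : int) (j n J : nat).

Lemma measurable_good_edge d' (T' : measurableType d') (F : T' -> int * int -> R)
    fw p q lam : random_function F -> measurable [set w | good_edge fw (F w) p q lam].
Proof.
by move=> mF; case: fw; exact: measurable_lpp_gt.
Qed.

(* [ratio n j] is the length scale [(8^j / n)^(1/3)] of level [j] relative to [n]. *)
Definition ratio n j : R := 2 ^+ j / n%:R `^ (1 / 3).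

Definition edge_end fw n (eta : R) J j l k : int * int :=
  if (j < J)%N then grid j.+1 (l %/ 4)%Z ((k %/ 8)%Z + offset fw)
  else slice_end rho tau fw n eta j l k.

Definition cost n (g : R) j : R := n%:R `^ (1 / 3) * ratio n j `^ g.

Definition cell (N : nat) (i : 'I_(2 * N + 1)) : int := i%:Z - N%:Z.

Lemma cellP N (l : int) : (`|l| <= N)%N -> exists i : 'I_(2 * N + 1), cell i = l.
Proof.
move=> lN; have iN : (`|(l + N%:Z)%R| < 2 * N + 1)%N by lia.
by exists (Ordinal iN); rewrite /cell/=; lia.
Qed.

Definition level_ok n eta J (g : R) (Nl Nk : nat -> nat) j (w : int * int -> R) : Prop :=
  forall (fw : bool) l k, (`|l| <= Nl j)%N -> (`|k| <= Nk j)%N ->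
    good_edge fw w (grid j l (k + offset fw)) (edge_end fw n eta J j l k) (cost n g j).

(** The finite union gives both the measurability of [level_ok] and the union bound. *)
Lemma level_okE n eta J g Nl Nk j : level_ok n eta J g Nl Nk j =
  ~` \bigcup_(i in [set: bool * 'I_(2 * Nl j + 1) * 'I_(2 * Nk j + 1)])
    [set w | ~ good_edge i.1.1 w (grid j (cell i.1.2) (cell i.2 + offset i.1.1))
       (edge_end i.1.1 n eta J j (cell i.1.2) (cell i.2)) (cost n g j)].
Proof.
apply/seteqP; split => w.
  move=> H [[[fw a] b] _] /=; apply; apply: H; rewrite /cell.
    by have := ltn_ord a; lia.
  by have := ltn_ord b; lia.
move=> H fw l k /cellP[a <-] /cellP[b <-]; apply: contrapT => nG.
by apply: H; exists (fw, a, b).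
Qed.

Lemma measurable_level_ok d' (T' : measurableType d') (F : T' -> int * int -> R)
   n eta J g Nl Nk j : random_function F ->
  measurable [set w | level_ok n eta J g Nl Nk j (F w)].
Proof.
move=> mF; rewrite (_ : [set w | _] = ~` \bigcup_(i in [set: bool * 'I_(2 * Nl j + 1) * 'I_(2 * Nk j + 1)])
  [set w | ~ good_edge i.1.1 (F w) (grid j (cell i.1.2) (cell i.2 + offset i.1.1))
       (edge_end i.1.1 n eta J j (cell i.1.2) (cell i.2)) (cost n g j)]); last first.
  by apply/seteqP; split => w /=; rewrite level_okE.
apply: measurableC.
apply: fin_bigcup_measurable => // i _; apply: measurableC.
exact: measurable_good_edge.
Qed.

Lemma ratio_gt0 n j : (0 < n)%N -> 0 < ratio n j.
Proof. by move=> n0'; rewrite divr_gt0 ?exprn_gt0// powR_gt0// ltr0n. Qed.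

Lemma ratioS n j : ratio n j.+1 = 2 * ratio n j.
Proof. by rewrite /ratio exprS mulrA. Qed.

(** [ratio] doubles at each level, so the sum is geometric and controlled by the top level alone. It
    is used for probabilities, with exponent [e], and for costs, with exponent [g]. *)
Lemma ratio_geom n (e : R) j J : (0 < n)%N -> 0 < e -> (j <= J.+1)%N ->
  \sum_(j <= i < J.+1) ratio n i `^ e <= ratio n J `^ e / (1 - 2 `^ (- e)).
Proof.
move=> np e0.
have q1 : (2 : R) `^ (- e) < 1.
  rewrite powRN invf_lt1 ?powR_gt0//; have := @gt0_ltr_powR R e e0 1 2.
  by rewrite powR1; apply; rewrite ?nnegrE ?ltr1n.
have q0 : 0 < 1 - (2 : R) `^ (- e) by rewrite subr_gt0.
have step i : ratio n i `^ e = 2 `^ (- e) * ratio n i.+1 `^ e.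
  rewrite ratioS powRM ?(ltW (ratio_gt0 _ np))// mulrA -powRD ?addNr ?powRr0 ?mul1r//.
  by rewrite pnatr_eq0 implybT.
have ge0 i : 0 <= ratio n i `^ e / (1 - 2 `^ (- e)) by rewrite divr_ge0 ?powR_ge0// ltW.
elim: J => [|J IH] jJ.
  case: (j) jJ => [|[|//]] _; last by rewrite big_geq.
  rewrite big_nat1 ler_peMr ?powR_ge0// invf_ge1// lerBlDr lerDl powR_ge0//.
case: (ltnP J.+1 j) => Jj.
  by rewrite big_geq//; exact: ge0.
rewrite big_nat_recr//=; apply: le_trans (lerD (IH Jj) (lexx _)) _.
rewrite step le_eqVlt; apply/orP; left; apply/eqP.
by field; rewrite gt_eqF.
Qed.

End LevelDefs.

(** * Union bound over the edges of a level *)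

Section Levels.
Context {R : realType} d (T : measurableType d) (P : probability T R)
  (X : T -> int * int -> R).
Variables (rho alpha beta chi tau : R) (r C : R) (n0 : nat).
Hypotheses (iidX : iid P X) (rho0 : 0 < rho) (chi0 : 0 < chi) (tau0 : 0 < tau)
  (r0 : 0 < r) (C0 : 0 <= C).
Local Notation dn := (rescaled_lpp rho alpha beta chi tau).
Hypothesis momentX : forall n, (n0 <= n)%N -> forall x : R, -3 <= x <= 3 ->
  (negative_part_moment P r (fun w => dn n (X w) ((0, 0), (x, 1))%R) <= C%:E)%E.
Local Notation good_edge := (good_edge rho alpha beta).
Local Notation grid := (grid rho tau).
Local Notation edge_end := (edge_end rho tau).
Local Notation level_ok := (level_ok rho alpha beta tau).
Implicit Types (l k : int) (j n J : nat).

Lemma edge_prob j fw p q lam : admissible rho tau j fw p q -> (n0 <= 8 ^ j)%N -> 0 < lam ->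
  (P [set w | ~ good_edge fw (X w) p q lam] <= (C * (3 * chi * 2 ^+ j / lam) `^ r)%:E)%E.
Proof.
move=> [m [/andP[m1 m2] v2 v1]] nj lam0.
have m0 : (0 < m)%N by apply: leq_trans m1; rewrite expn_gt0.
have H a := lpp_tail_bound iidX chi0 tau0 r0 momentX a m0 (leq_trans nj m1) v2 lam0 v1.
(* The 27 of [admissible] is 3^3. *)
have c3 : m%:R `^ (1 / 3) <= 3 * 2 ^+ j :> R.
  apply: cube_root_ge; rewrite ?mulr_ge0 ?exprn_ge0//.
  rewrite exprMn -exprM mulnC exprM (_ : 2 ^+ 3 = 8); last by ring.
  rewrite (_ : 3 ^+ 3 = 27); last by ring.
  by rewrite -natrX -natrM ler_nat.
have e : C * (chi * m%:R `^ (1 / 3) / lam) `^ r <= C * (3 * chi * 2 ^+ j / lam) `^ r.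
  rewrite ler_wpM2l// ge0_ler_powR// ?nnegrE ?(ltW r0)//.
  - by rewrite divr_ge0 ?(ltW lam0)// mulr_ge0 ?powR_ge0// ltW.
  - by rewrite divr_ge0 ?(ltW lam0)// !mulr_ge0 ?exprn_ge0// ltW.
  - by rewrite ler_pM2r ?invr_gt0// [3 * chi]mulrC -mulrA ler_pM2l.
move: H; rewrite /good_edge /directed_lpp /dvec; case: (fw) => H.
- apply: le_trans (_ : _ <= (C * (chi * m%:R `^ (1 / 3) / lam) `^ r)%:E)%E _; last by rewrite lee_fin.
  by have := H p; rewrite (addrC p) subrK.
- apply: le_trans (_ : _ <= (C * (chi * m%:R `^ (1 / 3) / lam) `^ r)%:E)%E _; last by rewrite lee_fin.
  by have := H q; rewrite (addrC q) subrK.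
Qed.

Lemma level_prob n eta J (g e B : R) (Nl Nk : nat -> nat) j :
  (0 < n)%N -> (n0 <= 8 ^ j)%N -> (j <= J)%N -> 0 < n%:R * eta -> n%:R * eta < 8 ^+ J.+1 ->
  1 <= 3 * tau * 4 ^+ j -> r * (1 - g) = 5 + e -> 1 <= B -> (ratio n j : R) <= 1 ->
  (Nl j)%:R <= B / ratio n j ^+ 2 -> (Nk j)%:R <= B / ratio n j ^+ 3 ->
  (P [set w | ~ level_ok n eta J g Nl Nk j (X w)] <=
    (18 * B ^+ 2 * (C * (3 * chi) `^ r) * ratio n j `^ e)%:E)%E.
Proof.
move=> np nj jJ ne0 ne8 tj rg B1 x1 Nl1 Nk1.
have [mX _ _] := iidX.
have x0 := @ratio_gt0 R n j np; set x := ratio n j in x0 x1 Nl1 Nk1 *.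
have nu0 : (0 : R) < n%:R `^ (1 / 3) by rewrite powR_gt0// ltr0n.
have lam0 : 0 < cost n g j by rewrite mulr_gt0// powR_gt0.
pose b := C * (3 * chi * 2 ^+ j / cost n g j) `^ r.
pose E (i : bool * 'I_(2 * Nl j + 1) * 'I_(2 * Nk j + 1)) :=
  [set w | ~ good_edge i.1.1 (X w) (grid j (cell i.1.2) (cell i.2 + offset i.1.1))
       (edge_end i.1.1 n eta J j (cell i.1.2) (cell i.2)) (cost n g j)].
have -> : [set w | ~ level_ok n eta J g Nl Nk j (X w)] = \bigcup_(i in setT) E i.
  by apply/seteqP; split => w /=; rewrite level_okE; [move=> /contrapT|move=> ? /(_ _)].
apply: (@le_trans _ _ (#|{: bool * 'I_(2 * Nl j + 1) * 'I_(2 * Nk j + 1)}|%:R * b)%:E).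
  apply: measure_bigcup_fin_le => i.
    by apply: measurableC; exact: measurable_good_edge.
  apply: edge_prob => //; rewrite /edge_end; case: ltnP => Jj.
    exact: grid_edge_admissible.
  have jE : j = J by apply/eqP; rewrite eqn_leq jJ.
  by apply: slice_edge_admissible => //; rewrite jE.
rewrite lee_fin !card_prod card_bool !card_ord !natrM.
have xe0 : 0 < x `^ e by exact: powR_gt0.
(* The typical fluctuation over the cost is 3 chi x^(1 - g), and r (1 - g) = 5 + e. *)
have bE : b = C * (3 * chi) `^ r * (x `^ e * x ^+ 5).
  rewrite /b; have -> : 3 * chi * 2 ^+ j / cost n g j = 3 * chi * x `^ (1 - g).
    rewrite /cost powRB ?powRr1 ?(ltW x0)//; last by rewrite (gt_eqF x0) implybT.
    rewrite /x /ratio; field; rewrite !gt_eqF// powR_gt0//.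
  rewrite powRM ?powR_ge0//; last by rewrite mulr_ge0// ltW.
  rewrite -powRrM [(1 - g) * r]mulrC rg addrC powRD; last by rewrite (gt_eqF x0) implybT.
  by rewrite -powR_mulrn ?(ltW x0)// mulrA.
have b0 : 0 <= b by rewrite mulr_ge0// powR_ge0.
have l3 : (2 * Nl j + 1)%:R <= 3 * (B / x ^+ 2).
  rewrite natrD natrM; have : 1 <= B / x ^+ 2.
    by rewrite ler_pdivlMr ?exprn_gt0// mul1r (le_trans _ B1)// exprn_ile1// ltW.
  by move: Nl1; move: (B / x ^+ 2) (Nl j)%:R => u v; lra.
have k3 : (2 * Nk j + 1)%:R <= 3 * (B / x ^+ 3).
  rewrite natrD natrM; have : 1 <= B / x ^+ 3.
    by rewrite ler_pdivlMr ?exprn_gt0// mul1r (le_trans _ B1)// exprn_ile1// ltW.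
  by move: Nk1; move: (B / x ^+ 3) (Nk j)%:R => u v; lra.
(* Two directions, at most 3 B / x^2 positions and 3 B / x^3 times: the factor x^5 of the single
   edge cancels, and 2 * 3 * 3 gives 18. *)
apply: (@le_trans _ _ (2 * (3 * (B / x ^+ 2)) * (3 * (B / x ^+ 3)) * b)).
  have h : (2 * Nl j + 1)%:R * (2 * Nk j + 1)%:R <= 3 * (B / x ^+ 2) * (3 * (B / x ^+ 3)).
    exact: ler_pM.
  by rewrite ler_wpM2r// -mulrA -(mulrA 2 (3 * (B / x ^+ 2))) ler_pM2l.
have xN0 : x != 0 by rewrite gt_eqF.
by rewrite bE le_eqVlt; apply/orP; left; apply/eqP; field.
Qed.

End Levels.

Section Connect.
Context {R : realType}.
Variables (rho alpha beta chi tau : R).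
Implicit Types (X : int * int -> R) (p q : int * int) (l k : int) (j n J : nat).
Local Notation dn := (rescaled_lpp rho alpha beta chi tau).
Local Notation grid := (grid rho tau).

(** Two floors are involved, in the grid point and in the last edge, each with error less than 1. *)
Lemma slice_end_fst fw n (eta : R) J l k : 0 < n%:R * eta -> n%:R * eta < 8 ^+ J.+1 ->
  let q := slice_end rho tau fw n eta J l k in
  let tm := slice_time n eta (slice_index fw n eta J k) in
  `|q.1%:~R - rho * tm%:~R - tau * 4 ^+ J * l%:~R| <= 2.
Proof.
move=> ne0 ne8; rewrite /slice_end; set tm := slice_time _ _ _.
have [m [_ mE _]] := slice_time_gap fw k ne0 ne8; rewrite -/tm in mE.
set g := grid J l (k + offset fw).
have gE : tm + g.2 = if fw then m%:Z else - m%:Z by rewrite -mE.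
have aE : `|(tm + g.2)%R|%N = m by rewrite gE; case: (fw); lia.
have mR : (m%:R : R) = if fw then tm%:~R + g.2%:~R else - (tm%:~R + g.2%:~R).
  have -> : (m%:R : R) = (m%:Z)%:~R by [].
  have -> : m%:Z = if fw then tm + g.2 else - (tm + g.2).
    by rewrite gE; case: (fw); rewrite ?opprK.
  have gen (b : bool) (u v : int) : ((if b then u + v else - (u + v))%:~R : R) =
      if b then u%:~R + v%:~R else - (u%:~R + v%:~R).
    by case: b; rewrite ?rmorphN rmorphD.
  exact: gen.
have /andP[g1a g1b] := floor_bounds (rho * (8 ^+ J * (k + offset fw)%:~R) + tau * 4 ^+ J * l%:~R).
have g2R : 8 ^+ J * (k + offset fw)%:~R = - (g.2%:~R : R).
  by rewrite /g /grid/= rmorphN rmorphM/= opprK -[(8 ^ J)%N%:~R]/((8 ^ J)%N%:R) natrX.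
move: g1a g1b; rewrite -[Num.floor _]/(g.1) g2R => ga gb.
clearbody g tm; rewrite /= aE; have /andP[fa fb] := floor_bounds (rho * m%:R).
move: fa fb; move: (Num.floor _) => f.
rewrite mR; move: (tau * 4 ^+ J * l%:~R) ga gb => y ga gb.
by case: (fw) => fa fb; rewrite ler_norml rmorphD ?rmorphN/=; apply/andP; split; lra.
Qed.

(** The slice lies at most three steps 8^J and one slice spacing from the starting point, all
    bounded by n eta; the 1 is for rounding. *)
Lemma slice_index_time fw n (eta : R) J (x s : R) :
  let p := lattice_point rho tau n (x, s) in
  let i := slice_index fw n eta J (cell_t p J) in
  0 < n%:R * eta -> n%:R * eta < 8 ^+ J.+1 -> 8 ^+ J <= n%:R * eta ->
  if fw then 0 < n%:R * (i%:~R * eta - s) <= 4 * (n%:R * eta) + 1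
  else 0 < n%:R * (s - i%:~R * eta) <= 4 * (n%:R * eta) + 1.
Proof.
move=> p i ne0 ne8 ne1.
have [m [_ _]] := slice_time_gap fw (cell_t p J) ne0 ne8; rewrite -/i.
have [m' [m'8 tE]] := cell_t_bounds p J.
have /andP[] := floor_bounds (- (n%:R * s)); rewrite -[Num.floor _]/(p.2).
have tR : - (p.2%:~R : R) = 8 ^+ J * (cell_t p J)%:~R + m'%:R.
  by rewrite -rmorphN tE rmorphD rmorphM/= -[(8 ^ J)%N%:~R]/((8 ^ J)%N%:R) natrX.
have m'R : 0 <= (m'%:R : R) <= 8 ^+ J - 1.
  by rewrite ler0n/= lerBrDr natr1 -natrX ler_nat.
have j1 : 1 <= (8 : R) ^+ J by rewrite exprn_ege1// ler1n.
have off : ((cell_t p J + offset fw)%:~R : R) = (cell_t p J)%:~R + if fw then 2 else -1.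
  by rewrite rmorphD; case: (fw).
rewrite off mulrDr.
have nE : n%:R * (i%:~R * eta - s) = n%:R * (i%:~R * eta) - n%:R * s by ring.
have nE' : n%:R * (s - i%:~R * eta) = n%:R * s - n%:R * (i%:~R * eta) by ring.
rewrite nE nE'; move: tR; clearbody i p; case/andP: m'R.
move: (n%:R * (i%:~R * eta)) (n%:R * s) (n%:R * eta) (8 ^+ J * (cell_t p J)%:~R) m'%:R p.2%:~R {tE m'8 nE nE' off} ne0 ne8 ne1 => A S E K m2 p2 ne0 ne8 ne1.
by case: (fw) => m21 m22 tR p1 p3 /andP[h1 h2]; apply/andP; split; lra.
Qed.

Hypotheses (rho0 : 0 < rho) (tau0 : 0 < tau).

(** The constants added to [M] in [B] absorb the floors; this is possible because cells of level [j]
    are no larger than the whole picture, [ratio n j <= 1]. *)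
Lemma cell_ranges n j (M x s : R) : (0 < n)%N -> (ratio n j : R) <= 1 -> `|x| <= M -> `|s| <= M ->
  let p := lattice_point rho tau n (x, s) in
  let B := M + 3 + (1 + rho) / tau in
  (`|cell_x rho tau p j|%N%:R <= B / ratio n j ^+ 2) /\
  (`|cell_t p j|%N%:R <= B / ratio n j ^+ 3).
Proof.
move=> n0 r1 xM sM p B.
have M0 : 0 <= M by exact: le_trans xM.
have nu1 : 1 <= n%:R `^ (1 / 3) :> R.
  have := @ler_powR R n%:R _ 0 (1 / 3); rewrite powRr0; apply; last by rewrite divr_ge0.
  by rewrite ler1n.
set nu := n%:R `^ (1 / 3) in nu1 *.
have nu0 : 0 < nu by exact: lt_le_trans nu1.
have nu2 : n%:R `^ (2 / 3) = nu ^+ 2 :> R.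
  by rewrite /nu -powR_mulrn ?powR_ge0// -powRrM; congr (_ `^ _); field.
have nu3 : n%:R = nu ^+ 3 :> R.
  by rewrite /nu -powR_mulrn ?powR_ge0// -powRrM -[LHS]powRr1//; congr (_ `^ _); field.
have j2 : 0 < (2 : R) ^+ j by rewrite exprn_gt0.
have rE : ratio n j = 2 ^+ j / nu by [].
have j4 : (4 : R) ^+ j = (2 ^+ j) ^+ 2 by rewrite -exprM mulnC exprM (_ : 2 ^+ 2 = 4)//; ring.
have j8 : (8 : R) ^+ j = (2 ^+ j) ^+ 3 by rewrite -exprM mulnC exprM (_ : 2 ^+ 3 = 8)//; ring.
have jnu : 2 ^+ j <= nu by move: r1; rewrite rE ler_pdivrMr// mul1r.
have absint (z : int) : (`|z|%N%:R : R) = `|z%:~R| by rewrite -intr_norm -abszE.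
have /andP[p1a p1b] := floor_bounds (rho * n%:R * s + tau * (n%:R `^ (2 / 3)) * x).
have /andP[p2a p2b] := floor_bounds (- (n%:R * s)).
rewrite -[Num.floor _]/(p.1) in p1a p1b; rewrite -[Num.floor _]/(p.2) in p2a p2b.
have B1 : 0 < (1 + rho) / tau by rewrite divr_gt0// addr_gt0.
split; rewrite absint rE expr_div_n invf_div mulrA ler_pdivlMr ?exprn_gt0//.
- have /andP[h4 h5] := cell_x_bounds rho tau0 p j.
  rewrite -(@gtr0_norm _ ((2 ^+ j) ^+ 2)) ?exprn_gt0// -normrM -j4.
  rewrite -(@ler_pM2l _ tau)// -[X in X * `|_|](gtr0_norm tau0) -normrM.
  have hh : `|height rho p| <= tau * nu ^+ 2 * M + (1 + rho).
    rewrite /height.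
    have r4 : rho * p.2%:~R <= rho * (- (n%:R * s)) by rewrite ler_pM2l.
    have r5 : rho * (- (n%:R * s)) <= rho * (p.2%:~R + 1) by rewrite ler_pM2l// ltW.
    have t2 : `|tau * nu ^+ 2 * x| <= tau * nu ^+ 2 * M.
      by rewrite normrM gtr0_norm ?mulr_gt0 ?exprn_gt0// ler_pM2l// mulr_gt0// exprn_gt0.
    rewrite nu2 -mulrA in p1a p1b; rewrite !mulrN in r4 r5; rewrite mulrDr mulr1 in r5.
    move: t2; rewrite ler_norml => /andP[t2a t2b].
    move: p1a p1b r4 r5 t2a t2b; move: (rho * p.2%:~R) (rho * (n%:R * s)) (tau * nu ^+ 2 * x) (tau * nu ^+ 2 * M) p.1%:~R.
    by clear; move=> a b c e f *; rewrite ler_norml; apply/andP; split; lra.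
  have c1 : `|tau * ((cell_x rho tau p j)%:~R * 4 ^+ j)| <= tau * nu ^+ 2 * M + (1 + rho) + tau * 4 ^+ j.
    rewrite (_ : tau * (_ * _) = tau * 4 ^+ j * (cell_x rho tau p j)%:~R); last by ring.
    have t4 : 0 < tau * 4 ^+ j by rewrite mulr_gt0// exprn_gt0.
    move: hh; rewrite !ler_norml => /andP[a1 a2]; apply/andP; split; lra.
  apply: le_trans c1 _.
  have n1 : 1 <= nu ^+ 2 by rewrite exprn_ege1.
  have q1 : tau * 4 ^+ j <= tau * nu ^+ 2 by rewrite ler_pM2l// j4 ler_pXn2r// nnegrE ?(ltW j2)// ltW.
  have q2 : 1 + rho <= tau * ((1 + rho) / tau * nu ^+ 2).
    rewrite mulrA mulrC [tau * _]mulrC divfK ?gt_eqF// mulrC ler_peMr//.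
    by rewrite addr_ge0// ltW.
  have q3 : 0 <= tau * nu ^+ 2 by rewrite mulr_ge0 ?exprn_ge0// ltW.
  have -> : tau * (B * nu ^+ 2) = tau * nu ^+ 2 * M + 3 * (tau * nu ^+ 2) + tau * ((1 + rho) / tau * nu ^+ 2).
    by rewrite /B; ring.
  by move: q1 q2 q3; move: (tau * nu ^+ 2 * M) (tau * nu ^+ 2) (tau * ((1 + rho) / tau * nu ^+ 2)) (tau * 4 ^+ j); clear; move=> *; lra.
- have [m [m8 tE]] := cell_t_bounds p j.
  rewrite -(@gtr0_norm _ ((2 ^+ j) ^+ 3)) ?exprn_gt0// -normrM -j8.
  have tR : - (p.2%:~R : R) = 8 ^+ j * (cell_t p j)%:~R + m%:R.
    by rewrite -rmorphN tE rmorphD rmorphM/= -[(8 ^ j)%N%:~R]/((8 ^ j)%N%:R) natrX.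
  have mR : 0 <= (m%:R : R) <= 8 ^+ j by rewrite ler0n/= -natrX ler_nat ltnW.
  have n1 : 1 <= nu ^+ 3 by rewrite exprn_ege1.
  have q1 : 8 ^+ j <= nu ^+ 3 by rewrite j8 ler_pXn2r// nnegrE ?(ltW j2)// ltW.
  have q2 : `|nu ^+ 3 * s| <= nu ^+ 3 * M.
    by rewrite normrM gtr0_norm ?exprn_gt0// ler_pM2l// exprn_gt0.
  have q3 : 0 <= (1 + rho) / tau * nu ^+ 3 by rewrite mulr_ge0 ?exprn_ge0// ltW.
  have -> : B * nu ^+ 3 = nu ^+ 3 * M + 3 * nu ^+ 3 + (1 + rho) / tau * nu ^+ 3.
    by rewrite /B; ring.
  rewrite nu3 in p2a p2b; rewrite [_%:~R * _]mulrC.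
  move: q2 mR; rewrite ler_norml => /andP[q2a q2b] /andP[ma mb].
  by rewrite ler_norml; apply/andP; split; lra.
Qed.

Hypotheses (alpha0 : 0 <= alpha) (beta0 : 0 <= beta) (chi0 : 0 < chi).

(** Base edge, grid edges from [j0] to [J], slice edge: the costs add up by superadditivity. Since
    the chain stays with the cells of its starting point, the space displacement is one cell of
    level [J] and rounding errors. *)
Lemma connect_slice fw n (eta g : R) j0 J (Nl Nk : nat -> nat) X (x s : R) :
  let p := lattice_point rho tau n (x, s) in
  (0 < n)%N -> (forall z, 0 <= X z) -> tau * 4 ^+ j0 + 1 <= rho * 8 ^+ j0 ->
  (j0 <= J)%N -> n%:R * eta < 8 ^+ J.+1 -> 8 ^+ J <= n%:R * eta ->
  (forall j, (j0 <= j <= J)%N -> level_ok rho alpha beta tau n eta J g Nl Nk j X) ->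
  (forall j, (j0 <= j <= J)%N -> (`|cell_x rho tau p j| <= Nl j)%N /\ (`|cell_t p j| <= Nk j)%N) ->
  exists (i : int) (x' : R),
    [/\ if fw then 0 < n%:R * (i%:~R * eta - s) <= 4 * (n%:R * eta) + 1
        else 0 < n%:R * (s - i%:~R * eta) <= 4 * (n%:R * eta) + 1,
        `|x' - x| * (tau * n%:R `^ (2 / 3)) <= tau * 4 ^+ J + (3 + rho) &
        ((- ((base_cost alpha beta tau j0 + \sum_(j0 <= j < J.+1) cost n g j +
              (alpha + beta + beta * rho)) / (chi * n%:R `^ (1 / 3))))%:E <=
         dn n X (if fw then ((x, s), (x', i%:~R * eta))
                 else ((x', i%:~R * eta), (x, s)))%R)%E].
Proof.
move=> p n0 X0 rj jJ ne8 ne1 ok cells.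
have ne0 : 0 < n%:R * eta by apply: lt_le_trans ne1; rewrite exprn_gt0.
have [cx ct] := cells J (introT andP (conj jJ (leqnn J))).
set k := cell_t p J in ct *; set l := cell_x rho tau p J.
pose i := slice_index fw n eta J k.
pose q := slice_end rho tau fw n eta J l k.
pose x' := slice_x rho tau n eta q i.
have qK : lattice_point rho tau n (x', i%:~R * eta) = q by exact: slice_xK.
have t0 : 0 < tau * n%:R `^ (2 / 3) by rewrite mulr_gt0// powR_gt0// ltr0n.
exists i, x'; split.
- exact: slice_index_time.
- have h1 := slice_end_fst fw l k ne0 ne8.
  have /andP[h2 h3] := slice_time_bounds n eta i.
  have /andP[h4 h5] := cell_x_bounds rho tau0 p J.
  rewrite -[X in _ * X]gtr0_norm// -normrM mulrBl.
  have -> : x' * (tau * n%:R `^ (2 / 3)) = q.1%:~R - rho * n%:R * (i%:~R * eta).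
    by rewrite /x' /slice_x divfK// gt_eqF.
  cbv zeta in h1; rewrite -/q -/i in h1; rewrite -/l in h4 h5; rewrite /height in h4 h5.
  have /andP[p1a p1b] := floor_bounds (rho * n%:R * s + tau * (n%:R `^ (2 / 3)) * x).
  have /andP[p2a p2b] := floor_bounds (- (n%:R * s)).
  rewrite -[Num.floor _]/(p.1) in p1a p1b; rewrite -[Num.floor _]/(p.2) in p2a p2b.
  have r2 : rho * (n%:R * (i%:~R * eta)) <= rho * (slice_time n eta i)%:~R by rewrite ler_pM2l.
  have r3 : rho * (slice_time n eta i)%:~R <= rho * (n%:R * (i%:~R * eta) + 1).
    by rewrite ler_pM2l// ltW.
  have r4 : rho * p.2%:~R <= rho * (- (n%:R * s)) by rewrite ler_pM2l.
  have r5 : rho * (- (n%:R * s)) <= rho * (p.2%:~R + 1) by rewrite ler_pM2l// ltW.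
  have t4 : 0 < tau * 4 ^+ J by rewrite mulr_gt0// exprn_gt0.
  move: h1; rewrite ler_norml => /andP[h1a h1b].
  have e1 : rho * n%:R * (i%:~R * eta) = rho * (n%:R * (i%:~R * eta)) by ring.
  have e2 : rho * n%:R * s = rho * (n%:R * s) by ring.
  have e3 : x * (tau * n%:R `^ (2 / 3)) = tau * n%:R `^ (2 / 3) * x by ring.
  rewrite e1 e3; rewrite e2 in p1a p1b; rewrite !mulrN in r4 r5; rewrite mulrDr mulr1 in r3; rewrite mulrDr mulr1 in r5.
  move: h1a h1b h4 h5 p1a p1b r2 r3 r4 r5 t4.
  move: (rho * (n%:R * (i%:~R * eta))) (rho * (slice_time n eta i)%:~R) (rho * p.2%:~R) (rho * (n%:R * s)).
  move: (tau * 4 ^+ J * l%:~R) (tau * 4 ^+ J) (tau * n%:R `^ (2 / 3) * x) (q.1%:~R) (p.1%:~R).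
  by clear; move=> *; rewrite ler_norml; apply/andP; split; lra.
- apply: good_edge_rescaled => //; rewrite qK big_nat_recr//= addrA.
  apply: (@good_edge_trans _ _ _ _ _ _ _ (grid J l (k + offset fw))).
    apply: chain_good => // j /andP[j1 j2].
    have := ok j; rewrite j1 (ltnW j2) => /(_ erefl) okj.
    have [c1 c2] := cells j (introT andP (conj j1 (ltnW j2))).
    by have := okj fw _ _ c1 c2; rewrite /edge_end j2.
  have okJ : level_ok rho alpha beta tau n eta J g Nl Nk J X by apply: ok; rewrite jJ leqnn.
  by have := okJ fw l k cx ct; rewrite /edge_end ltnn.
Qed.

End Connect.

(** * Choice of the scales *)

Lemma powR_small {R : realType} (A a c : R) : 0 <= A -> 0 < a -> 0 < c ->
  exists2 x0, 0 < x0 & forall x, 0 <= x -> x <= x0 -> A * x `^ c <= a.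
Proof.
move=> A0 a0 c0; have A1 : 0 < A + 1 by rewrite ltr_wpDl.
have q0 : 0 < a / (A + 1) by rewrite divr_gt0.
exists ((a / (A + 1)) `^ (c^-1)); first exact: powR_gt0.
move=> x x0 xx.
have h : x `^ c <= a / (A + 1).
  have := @ge0_ler_powR R c (ltW c0) _ _ _ _ xx; rewrite -powRrM mulVf ?gt_eqF// powRr1 ?(ltW q0)//.
  by apply; rewrite nnegrE ?powR_ge0.
apply: le_trans (ler_wpM2l A0 h) _.
by rewrite mulrCA ger_pMr// ler_pdivrMr// mul1r lerDl.
Qed.

(** From level [j0] on all durations are covered by the moment bound and a cell absorbs the rounding
    errors; at level [j0] itself base edges go to the right. *)
Lemma start_level {R : realType} (rho tau : R) (n0 : nat) : 0 < rho -> 0 < tau ->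
  exists j0, [/\ (n0 <= 8 ^ j0)%N,
  forall j, (j0 <= j)%N -> 1 <= 3 * tau * 4 ^+ j &
  tau * 4 ^+ j0 + 1 <= rho * 8 ^+ j0].
Proof.
move=> rho0 tau0; pose K : R := n0%:R + (3 * tau)^-1 + (tau + 1) / rho.
have t3 : 0 < 3 * tau by rewrite mulr_gt0.
have i1 : 0 < (3 * tau)^-1 by rewrite invr_gt0.
have i2 : 0 < (tau + 1) / rho by rewrite divr_gt0// addr_gt0.
have [j0 Kj] : exists j0 : nat, K <= 2 ^+ j0.
  exists (Num.truncn K).+1; apply: ltW; apply: lt_trans (truncnS_gt _) _.
  by rewrite -natrX ltr_nat ltn_expl.
have j2 : 1 <= (2 : R) ^+ j0 by rewrite exprn_ege1// ler1n.
have j4 : (4 : R) ^+ j0 = (2 ^+ j0) ^+ 2 by rewrite -exprM mulnC exprM (_ : 2 ^+ 2 = 4)//; ring.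
have j8 : (8 : R) ^+ j0 = 2 ^+ j0 * 4 ^+ j0 by rewrite -exprMn; congr (_ ^+ _); ring.
have n0R : 0 <= (n0%:R : R) by [].
have j41 : 1 <= (4 : R) ^+ j0 by rewrite exprn_ege1// ler1n.
have j24 : (2 : R) ^+ j0 <= 4 ^+ j0 by rewrite j4 expr2 ler_peMr// (le_trans _ j2).
exists j0; split.
- rewrite -(ler_nat R) natrX j8; apply: (@le_trans _ _ (2 ^+ j0)).
    by move: Kj; rewrite /K; lra.
  by rewrite ler_peMr// (le_trans _ j2).
- move=> j jj; rewrite -ler_pdivrMl// mulr1.
  apply: (@le_trans _ _ (4 ^+ j0)); first by move: Kj j24; rewrite /K; lra.
  by rewrite ler_eXn2l// ltr1n.
- have : (tau + 1) / rho <= 2 ^+ j0 by move: Kj; rewrite /K; lra.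
  rewrite ler_pdivrMr// => h; rewrite j8 mulrA.
  apply: (@le_trans _ _ ((tau + 1) * 4 ^+ j0)); first by rewrite mulrDl mul1r lerD2l.
  by rewrite ler_wpM2r ?(le_trans ler01)// mulrC.
Qed.

(** Applied to y = n eta: chains stop at the level whose time step is comparable to the spacing of
    the slices. *)
Lemma top_level {R : realType} (y : R) : 1 <= y -> exists J, 8 ^+ J <= y < 8 ^+ J.+1.
Proof.
move=> y1; have t1 : (0 < Num.truncn y)%N by rewrite truncn_gt0.
have /andP[h1 h2] := @trunc_log_bounds 8 _ isT t1.
have y0 : 0 <= y by exact: le_trans y1.
exists (trunc_log 8 (Num.truncn y)); rewrite -!natrX; apply/andP; split.
  by rewrite -truncn_ge_nat.
by rewrite -truncn_lt_nat.
Qed.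

Section ScaleArithmetic.
Context {R : realFieldType}.
Implicit Types (a b c k m : R).

Lemma sum_bounds a b c m : 0 <= a -> 0 <= b -> 0 <= c -> 0 <= m ->
  let w := 1 + a + b + c + m in [/\ 1 <= w, a <= w, b <= w, c <= w & m <= w].
Proof. by move=> /=; split; lra. Qed.

Lemma half_le a b k m : 2 * a <= m * (b * k) -> a <= k / 2 * (b * m).
Proof. by lra. Qed.

Lemma add_halves a b k m : a <= k / 2 * m -> b <= k / 2 * m -> a + b <= k * m.
Proof. by lra. Qed.

Lemma eighth_bounds a b k c : 0 < k -> b <= k / 2 -> a <= c -> c <= k / 8 ->
  4 * a + b <= k /\ c <= k / 2.
Proof. by move=> *; split; lra. Qed.

End ScaleArithmetic.

Section Connectivity.
Context {R : realType} d (T : measurableType d) (P : probability T R)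
  (X : T -> int * int -> R).
Variables (rho alpha beta chi tau : R) (delta C : R) (n0 : nat).
Hypotheses (iidX : iid P X) (rho0 : 0 < rho) (alpha0 : 0 <= alpha)
  (beta0 : 0 <= beta) (chi0 : 0 < chi) (tau0 : 0 < tau)
  (delta0 : 0 < delta) (C0 : 0 <= C).
Local Notation dn := (rescaled_lpp rho alpha beta chi tau).
Hypothesis momentX : forall n, (n0 <= n)%N -> forall x : R, -3 <= x <= 3 ->
  (negative_part_moment P (5 + delta)%R (fun w => dn n (X w) ((0, 0), (x, 1))%R) <= C%:E)%E.
Local Notation level_ok := (level_ok rho alpha beta tau).

Lemma all_levels_prob n eta J (g e B : R) (Nl Nk : nat -> nat) j0 :
  (0 < n)%N -> (n0 <= 8 ^ j0)%N -> (j0 <= J)%N -> 0 < n%:R * eta -> n%:R * eta < 8 ^+ J.+1 ->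
  (forall j, (j0 <= j)%N -> 1 <= 3 * tau * 4 ^+ j) -> (5 + delta) * (1 - g) = 5 + e ->
  0 < e -> 1 <= B ->
  (forall j, (j <= J)%N -> (ratio n j : R) <= 1) ->
  (forall j, (Nl j)%:R <= B / ratio n j ^+ 2) -> (forall j, (Nk j)%:R <= B / ratio n j ^+ 3) ->
  (P [set w | ~ forall j, (j0 <= j <= J)%N -> level_ok n eta J g Nl Nk j (X w)] <=
   (18 * B ^+ 2 * (C * (3 * chi) `^ (5 + delta)) * (ratio n J `^ e / (1 - 2 `^ (- e))))%:E)%E.
Proof.
move=> np nj jJ ne0 ne8 tj rg e0 B1 x1 Nl1 Nk1.
have [mX _ _] := iidX.
have r0 : 0 < 5 + delta by rewrite addr_gt0.
pose A i := if (j0 <= i)%N then [set w | ~ level_ok n eta J g Nl Nk i (X w)] else set0.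
have mA i : measurable (A i).
  by rewrite /A; case: ifP => // _; apply: measurableC; exact: measurable_level_ok.
have -> : [set w | ~ forall j, (j0 <= j <= J)%N -> level_ok n eta J g Nl Nk j (X w)] =
    \big[setU/set0]_(i < J.+1) A i.
  rewrite -bigcup_mkord; apply/seteqP; split => w /=.
    move=> /existsNP[j /not_implyP[/andP[j1 j2] nj']].
    by exists j => //; rewrite /A j1.
  move=> [j /= jJ' Aj] H; move: Aj; rewrite /A; case: ifP => // j1; apply.
  by apply: H; rewrite j1.
apply: le_trans (Boole_inequality _ _) _ => //.
set K := 18 * B ^+ 2 * _.
have K0 : 0 <= K by rewrite /K !mulr_ge0 ?powR_ge0// ?exprn_ge0// (le_trans ler01).
apply: (@le_trans _ _ (\sum_(i < J.+1) (if (j0 <= i)%N then K * ratio n i `^ e else 0)%:E)%E).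
  apply: lee_sum => i _; rewrite /A; case: ifP => j1; last by rewrite measure0.
  have iJ : (i <= J)%N by rewrite -ltnS.
  apply: (level_prob iidX chi0 tau0 r0 C0 momentX) => //.
  - by apply: leq_trans nj _; rewrite leq_pexp2l.
  - exact: tj.
  - exact: x1.
rewrite sumEFin lee_fin.
have -> : \sum_(i < J.+1) (if (j0 <= i)%N then K * ratio n i `^ e else 0) =
   K * \sum_(j0 <= i < J.+1) ratio n i `^ e.
  rewrite (big_nat_widenl _ 0)// big_mkord mulr_sumr [RHS]big_mkcond/=.
  by apply: eq_bigr => i _.
rewrite ler_wpM2l//; apply: ratio_geom => //; exact: leqW.
Qed.

(** [eta] does not depend on [n], so that multi-time convergence applies to the slices. [S] is a set
    of fields and not an event on the space of [X], since it is later evaluated on coupled fields as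
    well. *)
Lemma lattice_connectivity (M kap eps : R) : 0 <= M -> 0 < kap -> 0 < eps ->
  exists eta : R, 0 < eta /\ eta <= kap /\ exists N : nat, forall n, (N <= n)%N ->
  exists S : set (int * int -> R),
  [/\ (0 < n)%N,
      forall d' (T' : measurableType d') (F : T' -> int * int -> R),
        random_function F -> measurable [set w | S (F w)],
      ((1 - eps)%:E <= P [set w | S (X w)])%E &
      forall Y, S Y -> (forall z, 0 <= Y z) -> forall (fw : bool) (x s : R),
        `|x| <= M -> `|s| <= M -> exists (i : int) (x' : R),
        [/\ if fw then s < i%:~R * eta <= s + kap else s - kap <= i%:~R * eta < s,
            `|x' - x| <= kap &
            ((- kap)%:E <= dn n Y (if fw then ((x, s), (x', i%:~R * eta))
                                  else ((x', i%:~R * eta), (x, s)))%R)%E]].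
Proof.
move=> M0 kap0 eps0.
have r0 : 0 < 5 + delta by rewrite addr_gt0.
have [j0 [nj tj rj]] := start_level n0 rho0 tau0.
(* The surplus [delta] is shared equally: (5 + delta) (1 - g) = 5 + delta / 2, half for the
   summability of probabilities and half for that of costs. *)
pose g := delta / (2 * (5 + delta)); pose e := delta / 2.
have g0 : 0 < g by rewrite divr_gt0// mulr_gt0.
have e0 : 0 < e by rewrite divr_gt0.
have rg : (5 + delta) * (1 - g) = 5 + e by rewrite /g /e; field; rewrite gt_eqF.
pose B := M + 3 + (1 + rho) / tau.
have Br : 0 < (1 + rho) / tau by rewrite divr_gt0// addr_gt0.
have B1 : 1 <= B by rewrite /B; lra.
have B0 : 0 <= B by exact: le_trans B1.
have geom0 (c : R) : 0 < c -> 0 < 1 - 2 `^ (- c).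
  move=> c0; rewrite subr_gt0 powRN invf_lt1 ?powR_gt0//.
  by have := @gt0_ltr_powR R c c0 1 2; rewrite powR1; apply; rewrite ?nnegrE ?ltr1n.
pose C1 := 18 * B ^+ 2 * (C * (3 * chi) `^ (5 + delta)) / (1 - 2 `^ (- e)).
have C10 : 0 <= C1.
  rewrite divr_ge0 ?(ltW (geom0 e e0))// !mulr_ge0 ?powR_ge0// ?exprn_ge0//.
have [x1 x10 Hx1] := powR_small C10 eps0 e0.
have k2 : 0 < kap / 2 by rewrite divr_gt0.
have Cg0 : 0 <= (chi * (1 - 2 `^ (- g)))^-1 by rewrite invr_ge0 mulr_ge0 ?(ltW (geom0 g g0))// ltW.
have [x2 x20 Hx2] := powR_small Cg0 k2 g0.
(* [xi] bounds the relative scale of the top level. [x1] makes the failure probability at most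
   [eps], [x2] the total edge cost at most kap / 2, and kap / 8 limits the displacements. *)
pose xi := Num.min (Num.min 1 (kap / 8)) (Num.min x1 x2).
have xi0 : 0 < xi by rewrite !lt_min ltr01 divr_gt0 ?x10 ?x20.
have xi1 : xi <= 1 by rewrite !ge_min lexx.
have xik : xi <= kap / 8 by rewrite !ge_min lexx orbT.
have xix1 : xi <= x1 by rewrite !ge_min lexx !orbT.
have xix2 : xi <= x2 by rewrite !ge_min lexx !orbT.
(* Then 8^J <= n eta means [ratio n J <= xi]. *)
pose eta := xi ^+ 3.
have eta0 : 0 < eta by rewrite exprn_gt0.
have etaxi : eta <= xi by rewrite /eta exprS ger_pMr// exprn_ile1// ltW.
have xi2 : xi ^+ 2 <= xi by rewrite expr2 ger_pMr.
exists eta; split => //; split; first by lra.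
pose D := base_cost alpha beta tau j0 + (alpha + beta + beta * rho).
have D0 : 0 <= D.
  rewrite /D /base_cost !addr_ge0 ?mulr_ge0 ?exprn_ge0 ?(ltW tau0) ?(ltW rho0)//.
  by rewrite addr_ge0// mulr_ge0 ?exprn_ge0// ltW.
(* A lower bound for n^(1/3). The terms after 1 dispose of the base cost and centering error, of the
   rounding in space, of the rounding in time, and of the requirement 8^j0 <= n eta. *)
pose W := 1 + 2 * D / (chi * kap) + 2 * (3 + rho) / (tau * kap) + 2 / kap + 8 ^+ j0 / eta.
have w1 : 0 <= 2 * D / (chi * kap) by rewrite divr_ge0 ?mulr_ge0// ltW.
have w2 : 0 < 2 * (3 + rho) / (tau * kap) by rewrite divr_gt0 ?mulr_gt0// addr_gt0.
have w3 : 0 < 2 / kap by rewrite divr_gt0.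
have w4 : 0 < 8 ^+ j0 / eta by rewrite divr_gt0// exprn_gt0.
have [W1 WD Wr Wk We] := sum_bounds w1 (ltW w2) (ltW w3) (ltW w4); rewrite -/W in W1 WD Wr Wk We.
exists (Num.truncn (W ^+ 3)).+1 => n nN.
have nW : W ^+ 3 <= n%:R.
  by apply: ltW; apply: lt_le_trans (truncnS_gt _) _; rewrite ler_nat.
have W0 : 0 <= W by exact: le_trans W1.
have [nuW _] := cube_root_le W0 nW.
set nu := n%:R `^ (1 / 3) in nuW.
have n1 : (0 < n)%N by exact: leq_trans nN.
have nu1 : 1 <= nu by exact: le_trans nuW.
have nu0 : 0 < nu by exact: lt_le_trans nu1.
have nu2 : n%:R `^ (2 / 3) = nu ^+ 2 :> R.
  by rewrite /nu -powR_mulrn ?powR_ge0// -powRrM; congr (_ `^ _); field.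
have nu3 : n%:R = nu ^+ 3 :> R.
  by rewrite /nu -powR_mulrn ?powR_ge0// -powRrM -[LHS]powRr1//; congr (_ `^ _); field.
have nuS : nu <= nu ^+ 2 by rewrite expr2 ler_peMr// ltW.
have nu23 : nu ^+ 2 <= n%:R by rewrite nu3 [leRHS]exprS ler_peMl// exprn_ge0// ltW.
have neta : 8 ^+ j0 <= n%:R * eta.
  by rewrite -ler_pdivrMr//; apply: le_trans nu23; apply: le_trans nuS; exact: le_trans We nuW.
have [J /andP[J1 J2]] := top_level (le_trans (exprn_ege1 j0 (ler1n R 8)) neta).
have jJ : (j0 <= J)%N.
  by rewrite -ltnS -(@ltr_eXn2l R 8) ?ltr1n//; exact: le_lt_trans J2.
have ne0 : 0 < n%:R * eta by rewrite mulr_gt0// ltr0n.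
have rJ : ratio n J <= xi.
  rewrite /ratio -/nu ler_pdivrMr// -(@ler_pXn2r _ 3) ?nnegrE ?exprn_ge0// ?mulr_ge0 ?(ltW xi0) ?(ltW nu0)//.
  rewrite -exprM mulnC exprM (_ : 2 ^+ 3 = 8); last by ring.
  by rewrite exprMn -nu3 mulrC.
have rj1 j : (j <= J)%N -> (ratio n j : R) <= 1.
  move=> jJ'; apply: le_trans xi1; apply: le_trans rJ.
  by rewrite /ratio ler_pM2r ?invr_gt0// ler_eXn2l// ltr1n.
have rp j : 0 < (ratio n j : R) by exact: ratio_gt0.
pose Nl j := Num.truncn (B / ratio n j ^+ 2); pose Nk j := Num.truncn (B / ratio n j ^+ 3).
have Nl1 j : (Nl j)%:R <= B / ratio n j ^+ 2 by rewrite truncn_le// divr_ge0// exprn_ge0// ltW.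
have Nk1 j : (Nk j)%:R <= B / ratio n j ^+ 3 by rewrite truncn_le// divr_ge0// exprn_ge0// ltW.
exists [set Y | forall j, (j0 <= j <= J)%N -> level_ok n eta J g Nl Nk j Y].
split => //.
- move=> d' T' F mF.
  rewrite (_ : [set w | _] = \bigcap_(j in [set j | (j0 <= j <= J)%N])
     [set w | level_ok n eta J g Nl Nk j (F w)]); last by apply/seteqP; split.
  by apply: bigcap_measurableType => j _; exact: measurable_level_ok.
- set E := [set w | _].
  have mE : measurable E.
    rewrite (_ : E = \bigcap_(j in [set j | (j0 <= j <= J)%N])
       [set w | level_ok n eta J g Nl Nk j (X w)]); last by apply/seteqP; split.
    by have [mX _ _] := iidX; apply: bigcap_measurableType => j _; exact: measurable_level_ok.
  have -> : E = ~` (~` E) by rewrite setCK.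
  rewrite probability_setC ?EFinB; last exact: measurableC.
  apply: leeB => //.
  have := all_levels_prob n1 nj jJ ne0 J2 tj rg e0 B1 rj1 Nl1 Nk1.
  move/le_trans; apply; rewrite lee_fin mulrA mulrAC -/C1.
  by apply: Hx1; [exact: ltW|exact: le_trans xix1].
- move=> Y SY Y0 fw x s xM sM.
  have cells j : (j0 <= j <= J)%N ->
     (`|cell_x rho tau (lattice_point rho tau n (x, s)) j| <= Nl j)%N /\
     (`|cell_t (lattice_point rho tau n (x, s)) j| <= Nk j)%N.
    move=> /andP[_ jJ']; have [c1 c2] := cell_ranges rho0 tau0 n1 (rj1 j jJ') xM sM.
    by split; rewrite truncn_ge_nat ?divr_ge0 ?exprn_ge0// ltW.
  have [i [x' [h1 h2 h3]]] := connect_slice rho0 tau0 alpha0 beta0 chi0 fw n1 Y0 rj jJ J2 J1 SY cells.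
  have nR : 0 < (n%:R : R) by rewrite ltr0n.
  have ninv : n%:R^-1 <= kap / 2.
    rewrite -[leRHS]invrK lef_pV2 ?posrE ?invr_gt0// invf_div.
    by apply: le_trans nu23; apply: le_trans nuS; exact: le_trans Wk nuW.
  have tb (a : R) : n%:R * a <= 4 * (n%:R * eta) + 1 -> a <= kap.
    rewrite -ler_pdivlMl// mulrDr mulr1 mulrCA mulKf ?gt_eqF// => /le_trans; apply.
    by have [] := eighth_bounds kap0 ninv etaxi xik.
  exists i, x'; split.
  + case: (fw) h1 => /andP[]; rewrite pmulr_rgt0// subr_gt0 => -> /tb; first by rewrite lerBlDl.
    by rewrite lerBlDr andbT lerBlDl.
  + have t0 : 0 < tau * nu ^+ 2 by rewrite mulr_gt0// exprn_gt0.
    rewrite -(ler_pM2r t0) -nu2; apply: le_trans h2 _; rewrite nu2.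
    have a1 : tau * 4 ^+ J <= kap / 2 * (tau * nu ^+ 2).
      have -> : 4 ^+ J = ratio n J ^+ 2 * nu ^+ 2.
        rewrite /ratio -/nu expr_div_n divfK ?gt_eqF ?exprn_gt0//.
        by rewrite -exprM mulnC exprM; congr (_ ^+ _); ring.
      rewrite mulrCA ler_pM2r//; apply: (@le_trans _ _ (xi ^+ 2)).
        by rewrite ler_pXn2r ?nnegrE ?(ltW (rp J)) ?(ltW xi0).
      by apply: le_trans xi2 _; have [] := eighth_bounds kap0 ninv etaxi xik.
    have a2 : 3 + rho <= kap / 2 * (tau * nu ^+ 2).
      have : 2 * (3 + rho) / (tau * kap) <= nu ^+ 2.
        by apply: le_trans nuS; exact: le_trans Wr nuW.
      by rewrite ler_pdivrMr ?mulr_gt0//; exact: half_le.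
    exact: add_halves.
  + apply: le_trans h3; rewrite lee_fin lerN2 -/nu ler_pdivrMr ?mulr_gt0//.
    have a1 : \sum_(j0 <= j < J.+1) cost n g j <= kap / 2 * (chi * nu).
      rewrite /cost -/nu -mulr_sumr.
      have := ratio_geom n1 g0 (leqW jJ); rewrite -(ler_pM2l nu0) => /le_trans; apply.
      have hx := Hx2 (ratio n J) (ltW (rp J)) (le_trans rJ xix2).
      have hg := ler_wpM2r (ltW (mulr_gt0 chi0 nu0)) hx; apply: le_trans hg.
      rewrite le_eqVlt; apply/orP; left; apply/eqP; field.
      by rewrite !gt_eqF// geom0.
    have a2 : D <= kap / 2 * (chi * nu).
      have : 2 * D / (chi * kap) <= nu by exact: le_trans WD nuW.
      by rewrite ler_pdivrMr ?mulr_gt0//; exact: half_le.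
    by rewrite addrAC addrC; exact: add_halves a1 a2.
Qed.

End Connectivity.

(** * Comparison with the landscape *)

Section Band.
Context {R : realType}.
Local Notation E := ((R * R) * (R * R))%type.

(** Bands are open and exhaust [R4up] as M grows, with compact closed versions; a compact subset of
    [R4up] lies in one of them. *)
Definition band (M : R) : set E := [set u | `|u| < M /\ M^-1 < u.2.2 - u.1.2].

Definition closed_band (M : R) : set E := [set u | `|u| <= M /\ M^-1 <= u.2.2 - u.1.2].

Lemma coordinate_dist (a b : E) : [/\ `|a.1.1 - b.1.1| <= `|a - b|, `|a.1.2 - b.1.2| <= `|a - b|,
  `|a.2.1 - b.2.1| <= `|a - b| & `|a.2.2 - b.2.2| <= `|a - b|].
Proof.
have [h1 h2] : `|a.1 - b.1| <= `|a - b| /\ `|a.2 - b.2| <= `|a - b|.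
  by split; rewrite [X in _ <= X]prod_normE/= le_max lexx ?orbT.
have [h3 h4] := ler_prod_norm a.1 b.1; have [h5 h6] := ler_prod_norm a.2 b.2.
by split; [exact: le_trans h1|exact: le_trans h1|exact: le_trans h2|exact: le_trans h2].
Qed.

Lemma norm4_le (a : E) e : `|a.1.1| <= e -> `|a.1.2| <= e -> `|a.2.1| <= e -> `|a.2.2| <= e ->
  `|a| <= e.
Proof. by move=> h1 h2 h3 h4; rewrite prod_normE/= ge_max !prod_normE !ge_max/= h1 h2 h3. Qed.

Lemma norm4_lt (a : E) e : `|a.1.1| < e -> `|a.1.2| < e -> `|a.2.1| < e -> `|a.2.2| < e ->
  `|a| < e.
Proof. by move=> h1 h2 h3 h4; rewrite prod_normE/= gt_max !prod_normE !gt_max/= h1 h2 h3. Qed.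

Lemma dist_lt_of_near (V : normedZmodType R) (a b p q : V) (x : R) :
  `|p - a| < (x - `|a - b|) / 2 -> `|q - b| < (x - `|a - b|) / 2 -> `|p - q| < x.
Proof.
have := ler_distD a p q; have := ler_distD b a q; rewrite [`|b - q|]distrC.
by lra.
Qed.

Lemma band_near M u : band M u -> exists2 r, 0 < r & forall v, `|v - u| < r -> band M v.
Proof.
move=> [h1 h2]; exists (Num.min (M - `|u|) ((u.2.2 - u.1.2 - M^-1) / 2)).
  by rewrite lt_min subr_gt0 h1 divr_gt0// subr_gt0.
move=> v; rewrite lt_min => /andP[v1 v2]; split.
  by have := ler_normD (v - u) u; rewrite subrK; lra.
have [_ a1 _ a2] := coordinate_dist v u.
have := le_lt_trans a1 v2; have := le_lt_trans a2 v2.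
by rewrite !ltr_norml => /andP[b1 b2] /andP[b3 b4]; lra.
Qed.

Lemma band_R4up M : 0 < M -> closed_band M `<=` R4up.
Proof. by move=> M0 u [_ h]; rewrite /R4up/= -subr_gt0; apply: lt_le_trans h; rewrite invr_gt0. Qed.

Lemma band_closed_band M : band M `<=` closed_band M.
Proof. by move=> u [h1 h2]; split; exact: ltW. Qed.

Lemma closed_band_band M M' : 0 < M -> M < M' -> closed_band M `<=` band M'.
Proof.
move=> M0 MM u [h1 h2]; split; first exact: le_lt_trans MM.
by apply: lt_le_trans h2; rewrite ltf_pV2// posrE (lt_trans M0).
Qed.

Lemma compact_closed_band M : compact (closed_band M).
Proof.
apply: (@subclosed_compact _ _ ((`[-M, M] `*` `[-M, M]) `*` (`[-M, M] `*` `[-M, M]))).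
- rewrite (_ : closed_band M = (fun u : E => `|u|) @^-1` [set x | x <= M] `&`
     (fun u : E => u.2.2 - u.1.2) @^-1` [set x | M^-1 <= x]); last by apply/seteqP; split.
  apply: closedI; apply: closed_comp => [u _|].
  + exact: norm_continuous.
  + exact: closed_le.
  + apply: (@cvgB _ R^o).
      by apply: (cvg_comp (snd : E -> R * R) snd); [exact: cvg_snd|exact: cvg_snd].
    by apply: (cvg_comp (fst : E -> R * R) snd); [exact: cvg_fst|exact: cvg_snd].
  + exact: closed_ge.
- by apply: compact_setX; apply: compact_setX; exact: segment_compact.
- move=> u [h _]; have h' : forall x : R, `|x| <= `|u| -> `[-M, M]%classic x.
    by move=> x hx; rewrite /= in_itv/= -ler_norml; exact: le_trans h.
  have [a1 a2 a3 a4] := coordinate_dist u 0; rewrite /= !subr0 in a1 a2 a3 a4.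
  by split; split; exact: h'.
Qed.

Lemma compact_band (K : set E) : compact K -> K `<=` R4up -> exists2 M : R, 0 < M & K `<=` band M.
Proof.
move=> /compact_near_coveringP cK KR.
have [N _ HN] : \forall n \near \oo, K `<=` band n.+1%:R.
  apply: (cK nat \oo (fun n u => band n.+1%:R u) _) => u Ku.
  have u0 : 0 < u.2.2 - u.1.2 by rewrite subr_gt0; exact: KR.
  pose m := Num.truncn (`|u| + (u.2.2 - u.1.2)^-1).
  have um : band m.+1%:R u.
    have hm : `|u| + (u.2.2 - u.1.2)^-1 < m.+1%:R by exact: truncnS_gt.
    split; first by apply: le_lt_trans hm; rewrite lerDl invr_ge0 ltW.
    rewrite -[ltRHS]invrK ltf_pV2 ?posrE ?invr_gt0//.
    by apply: le_lt_trans hm; rewrite lerDr.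
  have [r r0 hr] := band_near um.
  exists (ball u r, [set n | (m <= n)%N]); first by split; [exact: nbhsx_ballx|exists m].
  move=> [v n] /= [uv mn]; have [h1 h2] : band m.+1%:R v.
    by apply: hr; rewrite distrC; move: uv; rewrite -ball_normE.
  split; first by apply: lt_le_trans h1 _; rewrite ler_nat.
  by apply: le_lt_trans h2; rewrite lef_pV2 ?posrE// ler_nat.
by exists N.+1%:R => //; apply: (HN N) => /=.
Qed.

Lemma uniform_continuity_band (f : E -> R) M th : (forall u, R4up u -> {for u, continuous f}) ->
  0 < M -> 0 < th ->
  exists N : nat, forall n, (N <= n)%N -> forall a b, band M a -> band M b ->
    `|a - b| < n.+1%:R^-1 -> `|f a - f b| <= th.
Proof.
move=> cf M0 th0; have t2 : 0 < th / 2 by rewrite divr_gt0.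
have [N _ HN] : \forall n \near \oo, closed_band M `<=`
   [set a | forall b : E, `|a - b| < n.+1%:R^-1 -> `|f a - f b| <= th].
  have /compact_near_coveringP cK := @compact_closed_band M.
  apply: (cK nat \oo (fun n (a : E) => forall b : E, `|a - b| < n.+1%:R^-1 -> `|f a - f b| <= th) _) => u Ku.
  have /nbhs_ballP[r /= r0 hr] : nbhs u [set v | `|f u - f v| < th / 2].
    by have /cvgrPdist_lt := cf u (band_R4up M0 Ku); apply.
  have r2 : 0 < r / 2 by rewrite divr_gt0.
  pose m := Num.truncn (r / 2)^-1.
  have mr n : (m <= n)%N -> n.+1%:R^-1 < r / 2.
    move=> mn; rewrite -[ltRHS]invrK ltf_pV2 ?posrE ?invr_gt0//.
    by apply: lt_le_trans (truncnS_gt _) _; rewrite ler_nat.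
  exists (ball u (r / 2), [set n | (m <= n)%N]); first by split; [exact: nbhsx_ballx|exists m].
  move=> [v n] /= [uv mn] b vb.
  rewrite -ball_normE /= in uv.
  have h1 : `|f u - f v| < th / 2 by apply: hr; rewrite -ball_normE/=; lra.
  have h2 : `|f u - f b| < th / 2.
    apply: hr; rewrite -ball_normE/=; apply: le_lt_trans (ler_distD v u b) _.
    by rewrite [ltRHS]splitr; apply: ltrD => //; exact: lt_trans (mr _ mn).
  have := ler_normD (f v - f u) (f u - f b); rewrite subrKA [X in _ <= X + _]distrC; lra.
by exists N => n Nn a b /band_closed_band /(HN n Nn) h _ /h.
Qed.

Definition rat4 (p : (rat * rat) * (rat * rat)) : E :=
  ((ratr p.1.1, ratr p.1.2), (ratr p.2.1, ratr p.2.2)).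

Lemma rat4_near (u : E) (r : R) : 0 < r -> exists p, `|rat4 p - u| < r.
Proof.
move=> r0; have [p1 /andP[a1 b1]] := rat_right_near u.1.1 r0.
have [p2 /andP[a2 b2]] := rat_right_near u.1.2 r0.
have [p3 /andP[a3 b3]] := rat_right_near u.2.1 r0.
have [p4 /andP[a4 b4]] := rat_right_near u.2.2 r0.
exists ((p1, p2), (p3, p4)); apply: norm4_lt => /=;
  by rewrite ger0_norm ?subr_ge0// ltrBlDl.
Qed.

(** The modulus of continuity on a compact band is random; outside an event of small probability a
    deterministic one suffices, because the events [O n] increase to the whole space. *)
Lemma oscillation_event d (T : measurableType d) (P : probability T R) (f : T -> E -> R)
    (M th eps : R) :
  (forall u, measurable_fun setT (fun w => f w u)) ->
  (forall w u, R4up u -> {for u, continuous (f w)}) -> 0 < M -> 0 < th -> 0 < eps ->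
  exists (r : R) (O : set T), [/\ 0 < r, measurable O, ((1 - eps)%:E <= P O)%E &
    forall w, O w -> forall a b, band M a -> band M b -> `|a - b| < r -> `|f w a - f w b| <= th].
Proof.
move=> mf cf M0 th0 eps0.
pose pairs (n : nat) := [set p : ((rat * rat) * (rat * rat)) * ((rat * rat) * (rat * rat)) |
  [/\ band M (rat4 p.1), band M (rat4 p.2) & `|rat4 p.1 - rat4 p.2| < n.+1%:R^-1]].
(* Restricting to rational pairs makes the event measurable; continuity extends the bound to all
   pairs. *)
pose O n := \bigcap_(p in pairs n) [set w | `|f w (rat4 p.1) - f w (rat4 p.2)| <= th].
have mO n : measurable (O n).
  rewrite (_ : O n = ~` \bigcup_p [set w | pairs n p /\ ~ `|f w (rat4 p.1) - f w (rat4 p.2)| <= th]).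
    apply: measurableC; apply: countable_bigcupT_measurable; first exact: countableP.
    move=> p; have [np|np] := pselect (pairs n p); last first.
      by rewrite (_ : [set w | _] = set0)//; apply/seteqP; split => // w [].
    rewrite (_ : [set w | _] = ~` [set w | `|f w (rat4 p.1) - f w (rat4 p.2)| <= th]); last first.
      by apply/seteqP; split => w /= => [[]//|].
    apply: measurableC.
    have mg : measurable_fun setT (fun w => `|f w (rat4 p.1) - f w (rat4 p.2)|).
    by apply: measurableT_comp => //; exact: measurable_funB.
  have := mg measurableT `]-oo, th]%classic (measurable_itv _).
    by rewrite setTI; congr measurable; apply/seteqP; split => w /=; rewrite in_itv.
  apply/seteqP; split => w /= => [Ow [p _ [np]]|nO p np]; first by apply; exact: Ow.
  by apply: contrapT => h; apply: nO; exists p.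
have ndO : {homo O : n m / (n <= m)%N >-> (n <= m)%O}.
  move=> n m nm; rewrite subsetEset => w On p [h1 h2 h3]; apply: On; split => //.
  by apply: lt_le_trans h3 _; rewrite lef_pV2 ?posrE// ler_nat.
have OT : \bigcup_n O n = setT.
  apply/seteqP; split => // w _.
  have [N HN] := uniform_continuity_band (cf w) M0 th0.
  by exists N => // p [h1 h2 h3]; exact: (HN N).
have cO := @nondecreasing_cvg_mu _ _ _ P _ mO (bigcup_measurable (fun n _ => mO n)) ndO.
have PO : P (\bigcup_n O n) = 1%E by rewrite OT; exact: probability_setT.
have {cO} cO : P (O n) @[n --> \oo] --> 1%E by rewrite -PO; exact: cO.
have [N _ HN] : \forall n \near \oo, ((1 - eps)%:E < P (O n))%E.
  have V1 : nbhs (1%E : \bar R) [set x | ((1 - eps)%:E < x)%E].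
    change (nbhs (1 : R) [set x : R | ((1 - eps)%:E < x%:E)%E]).
    apply/nbhs_ballP; exists eps => //= x; rewrite -ball_normE/= lte_fin ltr_norml => /andP[].
    by lra.
  exact: (cO _ V1).
exists N.+1%:R^-1, (O N); split => //.
  by apply: ltW; apply: HN => /=.
move=> w Ow a b Va Vb ab.
have [ra ra0 ha] := band_near Va; have [rb rb0 hb] := band_near Vb.
have cont u : band M u -> {for u, continuous (f w)}.
  by move=> /band_closed_band/(band_R4up M0); exact: cf.
(* The strict inequality on |a - b| leaves room to replace [a] and [b] by rational points, at an
   arbitrarily small cost [e]. *)
apply/ler_addgt0Pr => e e0; have e2 : 0 < e / 2 by rewrite divr_gt0.
have /nbhs_ballP[sa /= sa0 hsa] : nbhs a [set v | `|f w a - f w v| < e / 2].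
  by have /cvgrPdist_lt := cont a Va; apply.
have /nbhs_ballP[sb /= sb0 hsb] : nbhs b [set v | `|f w b - f w v| < e / 2].
  by have /cvgrPdist_lt := cont b Vb; apply.
pose g := (N.+1%:R^-1 - `|a - b|) / 2.
have g0 : 0 < g by rewrite divr_gt0// subr_gt0.
have [p] : exists p, `|rat4 p - a| < Num.min ra (Num.min sa g).
  by apply: rat4_near; rewrite !lt_min ra0 sa0.
rewrite !lt_min => /and3P[pa1 pa2 pa3].
have [q] : exists q, `|rat4 q - b| < Num.min rb (Num.min sb g).
  by apply: rat4_near; rewrite !lt_min rb0 sb0.
rewrite !lt_min => /and3P[qb1 qb2 qb3].
have pq : `|f w (rat4 p) - f w (rat4 q)| <= th.
  apply: (Ow (p, q)); split => /=; [exact: ha|exact: hb|].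
  exact: dist_lt_of_near pa3 qb3.
have fa : `|f w a - f w (rat4 p)| < e / 2 by apply: hsa; rewrite -ball_normE/= distrC.
have fb : `|f w b - f w (rat4 q)| < e / 2 by apply: hsb; rewrite -ball_normE/= distrC.
have := ler_normD (f w a - f w (rat4 p)) (f w (rat4 p) - f w b); rewrite subrKA.
have := ler_normD (f w (rat4 p) - f w (rat4 q)) (f w (rat4 q) - f w b); rewrite subrKA.
by rewrite [`|f w (rat4 q) - f w b|]distrC; lra.
Qed.

End Band.

Lemma continuous_contract {R : realType} : continuous (@contract R).
Proof.
move=> x U /nbhs_ballP[e /= e0 eU].
by apply/nbhs_ballP; exists e => //= y; move=> xy; apply: eU.
Qed.

Lemma right_approximable_continuous {R : realType} (f : (R * R) * (R * R) -> \bar R) (s t : R) :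
  s < t -> (forall u, R4up u -> {for u, continuous (fun u => contract (f u))}) ->
  right_approximable (time_slice f s t).
Proof.
move=> st cf r e e0.
have : nbhs ((r.1, s), (r.2, t)) [set v | `|contract (f ((r.1, s), (r.2, t))) - contract (f v)| < e].
  by have /cvgrPdist_lt := cf ((r.1, s), (r.2, t)) st; apply.
move=> /nbhs_ballP[eta /= eta0 H]; exists eta => // r' /andP[a1 b1] /andP[a2 b2].
rewrite distrC; apply: (H ((r'.1, s), (r'.2, t))).
rewrite -ball_normE/=; apply: norm4_lt => /=; rewrite ?subrr ?normr0//.
  by rewrite distrC ger0_norm ?subr_ge0//; lra.
by rewrite distrC ger0_norm ?subr_ge0//; lra.
Qed.

(** * Finite nets and cells of values *)

Section Net.
Context {R : realType}.
Local Notation E := ((R * R) * (R * R))%type.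

Lemma band_enlarge (M M' : R) : 0 < M -> M < M' ->
  exists2 k, 0 < k & forall u v, closed_band M u -> `|v - u| <= k -> band M' v.
Proof.
move=> M0 MM; have iM : M'^-1 < M^-1 by rewrite ltf_pV2// posrE (lt_trans M0).
have k0 : 0 < Num.min ((M' - M) / 2) ((M^-1 - M'^-1) / 3).
  by rewrite lt_min !divr_gt0 ?subr_gt0.
exists (Num.min ((M' - M) / 2) ((M^-1 - M'^-1) / 3)) => // u v [h1 h2].
rewrite le_min => /andP[v1 v2]; split.
  by have := ler_normD (v - u) u; rewrite subrK; lra.
have [_ a1 _ a2] := coordinate_dist v u.
have := le_trans a1 v2; have := le_trans a2 v2.
by rewrite !ler_norml => /andP[b1 b2] /andP[b3 b4]; lra.
Qed.

Lemma finite_net (M k : R) : 0 < k -> exists (m : nat) (G : 'I_m -> E),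
  (forall i, closed_band M (G i)) /\ forall u, closed_band M u -> exists i, `|u - G i| < k.
Proof.
move=> k0; have /compact_near_coveringP cK := @compact_closed_band R M.
(* Finite lists directed by inclusion: the covering form of compactness along this filter yields one
   list that serves all points. *)
pose F : set_system (seq E) := [set A : set (seq E) | exists s0 : seq E, forall s : seq E, {subset s0 <= s} -> A s].
have FF : Filter F.
  split; first by exists [::].
    move=> A B [s hs] [t ht]; exists (s ++ t) => r rs.
    by split; [apply: hs|apply: ht] => x xs; apply: rs; rewrite mem_cat xs ?orbT.
  by move=> A B AB [s hs]; exists s => r /hs /AB.
have [s hs] : \forall s \near F, closed_band M `<=`
    [set u | exists g, [/\ g \in s, closed_band M g & `|u - g| < k]].
  apply: (cK (seq E) F (fun s u => exists g : E, [/\ g \in s, closed_band M g & `|u - g| < k]) FF).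
  move=> u Ku; exists (ball u k, [set s : seq E | u \in s]).
    by split; [exact: nbhsx_ballx|exists [:: u] => r; apply; rewrite inE].
  move=> [v r] /= [uv ur]; exists u; split => //.
  by rewrite distrC; move: uv; rewrite -ball_normE.
pose D := [seq g <- s | `[< closed_band M g >]].
have gE (i : 'I_(size D)) : closed_band M (nth (0 : E) D i).
  by have : nth (0 : E) D i \in D by [rewrite mem_nth]; rewrite mem_filter => /andP[/asboolP].
exists (size D), (fun i => nth (0 : E) D i); split => // u /(hs s (fun _ => id))[g [gs gK ug]].
have gD : g \in D by rewrite mem_filter gs andbT; exact/asboolP.
have iD : (index g D < size D)%N by rewrite index_mem.
by exists (Ordinal iD); rewrite /= nth_index.
Qed.

End Net.

(* The cells [cell_left j, cell_left j.+1 - del] for [L] lie well inside the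
disjoint cells ]cell_left j - del / 2, cell_left j.+1 - del / 2[ used for [d_n],
and they miss little of the law of [L] when [del] is small. *)
Section Cells.
Context {R : realType}.
Variables (h : R) (h0 : 0 < h).

Definition cell_left (j : nat) : R := 2 * h * j%:R - 1.

(** Cells are half-open of length 2 h; the successor covers the endpoint 1 of [-1, 1]. *)
Definition cell_count : nat := (Num.truncn h^-1).+1.

Lemma cell_leftS j : cell_left j.+1 = cell_left j + 2 * h.
Proof. by rewrite /cell_left -natr1; ring. Qed.

Lemma cell_unique j j' x y e : (cell_left j - e < x < cell_left j.+1 - e) ->
  (cell_left j' - e < y < cell_left j'.+1 - e) -> x = y -> j = j'.
Proof.
move=> /andP[a1 a2] /andP[b1 b2] xy; rewrite -xy in b1 b2.
have h2 : 0 < 2 * h by rewrite mulr_gt0.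
wlog jj : j j' a1 a2 b1 b2 / (j <= j')%N.
  by move=> W; case/orP: (leq_total j j') => jj; [apply: W|apply/esym/W].
apply/eqP; rewrite eqn_leq jj/= -ltnS -(ltr_nat R) -(ltr_pM2l h2).
by move: a2 b1; rewrite /cell_left; lra.
Qed.

Lemma cell_exists x : -1 <= x <= 1 -> exists j : 'I_cell_count, cell_left j <= x < cell_left j.+1.
Proof.
move=> /andP[x1 x2]; have h2 : 0 < 2 * h by rewrite mulr_gt0.
have q0 : 0 <= (x + 1) / (2 * h) by apply: divr_ge0; [lra|exact: ltW].
pose j := Num.truncn ((x + 1) / (2 * h)).
have jN : (j < cell_count)%N.
  rewrite ltnS truncn_ge_nat ?invr_ge0 ?(ltW h0)//.
  have : j%:R <= (x + 1) / (2 * h) by rewrite truncn_le.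
  rewrite ler_pdivlMr// => hj; rewrite -[_^-1]mul1r ler_pdivlMr//; lra.
exists (Ordinal jN) => /=; apply/andP; split.
  have : j%:R <= (x + 1) / (2 * h) by rewrite truncn_le.
  by rewrite ler_pdivlMr// /cell_left; lra.
have : (x + 1) / (2 * h) < j.+1%:R by exact: truncnS_gt.
by rewrite ltr_pdivrMr// /cell_left; lra.
Qed.

(** As [del] tends to 0 the events increase to [O]: each value lies strictly below the right end of
    its half-open cell, and there are finitely many values. *)
Lemma cell_event d (T : measurableType d) (P : probability T R) m (f : 'I_m -> T -> R)
    (O : set T) (eps : R) : measurable O ->
  (forall g, measurable_fun setT (f g)) -> (forall g w, -1 <= f g w <= 1) -> 0 < eps ->
  exists2 del : R, 0 < del & (P O - eps%:E <= P [set w | O w /\ forall g,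
    exists j : 'I_cell_count, (cell_left j <= f g w <= cell_left j.+1 - del)%R])%E.
Proof.
move=> mO mf f1 eps0.
pose F n := [set w | O w /\ forall g, exists j : 'I_cell_count,
  (cell_left j <= f g w <= cell_left j.+1 - n.+1%:R^-1)%R].
have mF n : measurable (F n).
  rewrite (_ : F n = O `&` \bigcap_(g in setT) \bigcup_(j in setT) [set w |
     (cell_left (j : 'I_cell_count) <= f g w <= cell_left j.+1 - n.+1%:R^-1)%R]); last first.
    apply/seteqP; split => [w [Ow H]|w [Ow H]]; split => // g.
      by move=> _; have [j hj] := H g; exists j.
    by have [j _ hj] := H g I; exists j.
  apply: measurableI => //; apply: fin_bigcap_measurable => // g _.
  apply: fin_bigcup_measurable => // j _.
  have := mf g measurableT `[cell_left j, cell_left j.+1 - n.+1%:R^-1]%classic (measurable_itv _).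
  by rewrite setTI; congr measurable; apply/seteqP; split => w /=; rewrite in_itv.
have ndF : {homo F : n k / (n <= k)%N >-> (n <= k)%O}.
  move=> n k nk; rewrite subsetEset => w [Ow H]; split => // g.
  have [j /andP[h1 h2]] := H g; exists j; rewrite h1/=; apply: le_trans h2 _.
  by rewrite lerD2l lerN2 lef_pV2 ?posrE// ler_nat.
have FT : \bigcup_n F n = O.
  apply/seteqP; split => [w [n _ []]//|w Ow].
  have js g : {j : 'I_cell_count | cell_left j <= f g w < cell_left j.+1}.
    exact/cid/cell_exists.
  have : exists n : nat, forall g, f g w <= cell_left (sval (js g)).+1 - n.+1%:R^-1.
    have : \forall n \near \oo, forall g : 'I_m, f g w <= cell_left (sval (js g)).+1 - n.+1%:R^-1.
      apply: filter_forall => g; set y := cell_left _.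
      have fy : 0 < y - f g w by rewrite subr_gt0 /y; case: (js g) => j /= /andP[].
      exists (Num.truncn (y - f g w)^-1) => // n /= yn.
      rewrite lerBrDr -lerBrDl -[leRHS]invrK lef_pV2 ?posrE ?invr_gt0//.
      by apply/ltW/(lt_le_trans (truncnS_gt _)); rewrite ler_nat.
    by move=> [n _ /(_ n (leqnn n)) hn]; exists n.
  move=> [n hn]; exists n => //; split => // g; exists (sval (js g)).
  by rewrite hn andbT; case: (js g) => j /= /andP[].
have cF := @nondecreasing_cvg_mu _ _ _ P _ mF (bigcup_measurable (fun n _ => mF n)) ndF.
have PF : P (\bigcup_n F n) = P O by rewrite FT.
have {cF} cF : P (F n) @[n --> \oo] --> P O by rewrite -PF; exact: cF.
have fO : P O \is a fin_num by exact: fin_num_measure.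
have V1 : nbhs (P O) [set x | (P O - eps%:E < x)%E].
  rewrite -(fineK fO).
  change (nbhs (fine (P O)) [set x : R | ((fine (P O))%:E - eps%:E < x%:E)%E]).
  apply/nbhs_ballP; exists eps => //= x; rewrite -ball_normE/= -EFinB lte_fin ltr_norml => /andP[].
  by lra.
have [n _ hn] := cF _ V1.
by exists n.+1%:R^-1; rewrite ?invr_gt0//; apply/ltW/(hn n)/leqnn.
Qed.

End Cells.

(** Turns additive errors into relative ones, uniformly over the finitely many cells of positive
    probability. *)
Lemma positive_lower_bound {R : realDomainType} (I : finType) (p : I -> R) :
  exists2 c, 0 < c & forall i, 0 < p i -> c <= p i.
Proof.
exists (\big[Num.min/1]_(i | 0 < p i) p i).
  by elim/big_ind: _ => // x y x0 y0; rewrite lt_min x0.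
by move=> i pi; rewrite (bigD1 i)//= ge_min lexx.
Qed.

Lemma contract_shift_le {R : realType} (x y a b : \bar R) (k : R) : 0 <= k ->
  ((- k)%:E <= a)%E -> ((- k)%:E <= b)%E -> (a + x + b <= y)%E ->
  contract x <= contract y + 2 * k.
Proof.
move=> k0 ka kb xy; apply: (@le_trans _ _ (contract (y + (2 * k)%:E)%E)); last first.
  by apply: contract_shift; rewrite mulr_ge0.
rewrite le_contract.
have h : ((- k)%:E + x + (- k)%:E <= y)%E.
  by apply: le_trans xy; apply: leeD => //; apply: leeD.
case: x y h {xy} => [x| |] [y| |] //=; rewrite ?leey ?leNye//.
by rewrite -!EFinD !lee_fin; lra.
Qed.

Lemma time_dist_le {R : realDomainType} (a b k : R) :
  a < b <= a + k \/ a - k <= b < a -> `|b - a| <= k.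
Proof. by case=> /andP[? ?]; rewrite ler_norml; apply/andP; split; lra. Qed.

Lemma sandwich_dist {R : realFieldType} (k h t x y z f m m' : R) :
  y <= x + 2 * k -> x <= z + 2 * k -> `|f - m| <= t + h -> `|f - m'| <= t + h ->
  `|z - m'| <= t + h -> `|y - m| <= t + h -> `|x - f| <= 2 * t + 2 * h + 2 * k.
Proof.
rewrite !ler_norml => ? ? /andP[? ?] /andP[? ?] /andP[? ?] /andP[? ?].
by apply/andP; split; lra.
Qed.

(** * Sandwich between slices *)

Section Sandwich.
Context {R : realType} d (T : measurableType d) (P : probability T R)
  (X : T -> int * int -> R).
Variables (rho alpha beta chi tau : R).
Hypotheses (chi0 : 0 < chi) (tau0 : 0 < tau).
Local Notation dn := (rescaled_lpp rho alpha beta chi tau).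
Local Notation E := ((R * R) * (R * R))%type.

Definition connected n (eta k M : R) (Y : int * int -> R) : Prop :=
  forall (fw : bool) (x s : R), `|x| <= M -> `|s| <= M -> exists (i : int) (x' : R),
    [/\ if fw then s < i%:~R * eta <= s + k else s - k <= i%:~R * eta < s,
        `|x' - x| <= k &
        ((- k)%:E <= dn n Y (if fw then ((x, s), (x', i%:~R * eta))
                             else ((x', i%:~R * eta), (x, s)))%R)%E].

(** Moving the start forwards and the end backwards gives a pair inside [u], whose value bounds that
    of [u] from below; moving them apart gives a pair around [u], bounding it from above. *)
Lemma connected_sandwich n eta k M Y (u : E) : (0 < n)%N -> 0 <= k ->
  connected n eta k M Y -> `|u| <= M ->
  (exists (i j : int) (x y : R), let v := ((x, i%:~R * eta), (y, j%:~R * eta)) in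
     `|v - u| <= k /\ contract (dn n Y v) <= contract (dn n Y u) + 2 * k) /\
  (exists (i j : int) (x y : R), let v := ((x, i%:~R * eta), (y, j%:~R * eta)) in
     `|v - u| <= k /\ contract (dn n Y u) <= contract (dn n Y v) + 2 * k).
Proof.
move=> n0 k0 cY uM; have [] := coordinate_dist u 0; rewrite /= !subr0.
case: u uM => [[x s] [y t]] uM /= a1 a2 a3 a4.
have {}a1 := le_trans a1 uM; have {}a2 := le_trans a2 uM.
have {}a3 := le_trans a3 uM; have {}a4 := le_trans a4 uM.
have [i1 [x1 [f1 f2 f3]]] := cY true x s a1 a2.
have [i2 [x2 [g1 g2 g3]]] := cY false x s a1 a2.
have [j1 [y1 [p1 p2 p3]]] := cY true y t a3 a4.
have [j2 [y2 [q1 q2 q3]]] := cY false y t a3 a4.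
split.
- exists i1, j2, x1, y2; split.
    by apply: norm4_le => //=; apply: time_dist_le; [left|right].
  apply: (contract_shift_le k0 f3 q3).
  apply: le_trans (rescaled_lpp_superadd rho alpha beta tau chi0 Y (x, s) (y2, j2%:~R * eta) (y, t) n0).
  apply: leeD => //.
  exact: (rescaled_lpp_superadd rho alpha beta tau chi0 Y (x, s) (x1, i1%:~R * eta) (y2, j2%:~R * eta) n0).
- exists i2, j1, x2, y1; split.
    by apply: norm4_le => //=; apply: time_dist_le; [right|left].
  apply: (contract_shift_le k0 g3 p3).
  apply: le_trans (rescaled_lpp_superadd rho alpha beta tau chi0 Y (x2, i2%:~R * eta) (y, t) (y1, j1%:~R * eta) n0).
  apply: leeD => //.
  exact: (rescaled_lpp_superadd rho alpha beta tau chi0 Y (x2, i2%:~R * eta) (x, s) (y, t) n0).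
Qed.

(** Three bands are needed: [u] lies in the first, the slice pairs around it and the net in the
    second, and the neighbourhoods of the net points in the third. *)
Lemma slice_control n eta k r t h M M1 M2 m (G : 'I_m -> E) (mid : 'I_m -> R)
    (Y : int * int -> R) (f : E -> R) : (0 < n)%N -> 0 <= k -> M <= M2 ->
  connected n eta k M2 Y ->
  (forall u v, closed_band M u -> `|v - u| <= k -> band M1 v) ->
  (forall u v, closed_band M1 u -> `|v - u| <= 3 * k -> band M2 v) ->
  (forall g, closed_band M1 (G g)) ->
  (forall u, closed_band M1 u -> exists g, `|u - G g| < k) -> 2 * k < r ->
  (forall a b, band M2 a -> band M2 b -> `|a - b| < r -> `|f a - f b| <= t) ->
  (forall g, `|f (G g) - mid g| <= h) ->
  (forall g (i j : int) x y, let v := ((x, i%:~R * eta), (y, j%:~R * eta)) in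
     `|v - G g| <= 2 * k -> `|contract (dn n Y v) - mid g| <= t + h) ->
  forall u, band M u -> `|contract (dn n Y u) - f u| <= 2 * t + 2 * h + 2 * k.
Proof.
move=> n0 k0 MM cY e1 e2 GK net kr osc fG hG u uM.
have uM2 : `|u| <= M2 by apply: le_trans MM; apply: ltW; case: uM.
have uK : closed_band M u by exact: band_closed_band.
have key v : `|v - u| <= k -> exists g, `|v - G g| <= 2 * k /\ `|f u - mid g| <= t + h.
  move=> vu; have v1 : band M1 v by exact: e1 vu.
  have [g vg] := net v (band_closed_band v1).
  exists g; split; first by apply: (le_trans (ltW vg)); rewrite ler_peMl// ler1n.
  have b2 x : band M1 x -> band M2 x.
    by move=> /band_closed_band/e2; apply; rewrite subrr normr0 mulr_ge0.
  have h1 : `|f u - f (G g)| <= t.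
    apply: osc; [apply: b2; apply: (e1 _ _ uK)|apply: (e2 _ _ (GK g))|].
    - by rewrite subrr normr0.
    - by rewrite subrr normr0 mulr_ge0.
    - apply: le_lt_trans (ler_distD v _ _) _; apply: lt_trans kr; rewrite mulr_natl mulr2n.
      by apply: ler_ltD => //; rewrite distrC.
  by have := ler_distD (f (G g)) (f u) (mid g); have := fG g; lra.
have [[i [j [x [y]]]] /= [vu lo] [i' [j' [x' [y']]]] /= [vu' up]] := connected_sandwich n0 k0 cY uM2.
have [g [vg fg]] := key _ vu; have [g' [vg' fg']] := key _ vu'.
exact: (sandwich_dist lo up fg fg' (hG _ _ _ _ _ vg') (hG _ _ _ _ _ vg)).
Qed.

End Sandwich.

(** Only finitely many slices meet a band, so finitely many deviations are involved. *)
Lemma bounded_int_index {R : realType} (eta M : R) : 0 < eta -> exists K : nat,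
  forall i : int, `|i%:~R * eta| <= M -> exists a : 'I_K, i = (a : nat)%:Z - (K./2)%:Z.
Proof.
move=> eta0; pose N := (Num.truncn (M / eta)).+1.
exists (N.*2.+1) => i iM.
have iN : (`|i| < N)%N.
  rewrite -(ltr_nat R); have := truncnS_gt (M / eta); apply: le_lt_trans.
  rewrite ler_pdivlMr// natr_absz intr_norm.
  by move: iM; rewrite normrM (gtr0_norm eta0).
have aN : (`|(i + N%:Z)%R|%N < N.*2.+1)%N by lia.
by exists (Ordinal aN) => /=; rewrite uphalf_double; lia.
Qed.

Section DeviationArithmetic.
Context {R : realFieldType}.
Implicit Types (a b c h t x : R).

Lemma deviation_near a b c h t x : a <= h - 2 * x -> c <= b + a -> 0 <= x -> b <= t ->
  c <= t + h - x.
Proof. by lra. Qed.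

Lemma deviation_at a b c h x : a <= h - 2 * x -> c <= b + a -> b <= x -> c <= h - x.
Proof. by lra. Qed.

End DeviationArithmetic.

Section SlicesEvent.
Context {R : realType} d (T : measurableType d) (P : probability T R)
  (X : T -> int * int -> R) d1 (T1 : measurableType d1) (P1 : probability T1 R)
  (L : T1 -> (R * R) * (R * R) -> \bar R).
Variables (rho alpha beta chi tau : R).
Local Notation dn := (rescaled_lpp rho alpha beta chi tau).
Local Notation E := ((R * R) * (R * R))%type.
Hypotheses (chi0 : 0 < chi) (tau0 : 0 < tau) (mX : random_function X)
  (mL : forall u, measurable_fun setT (fun w => L w u))
  (cL : forall w u, R4up u -> {for u, continuous (fun u => contract (L w u))})
  (cvgD : multi_time_cvg P (fun n w => dn n (X w)) P1 L).

(** Two kinds of deviations are used. At the times of a net point, the deviation at that point is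
    below [h], which locates the value in its cell. On nearby slices, the deviation over a ball of
    radius 2 k is below [t + h], which feeds the sandwich. The finer scale [r'], with oscillation
    [dl], protects the first kind from the width of the penalty zone. *)
Lemma slices_event (M1 M2 k eta r r' t h dl : R) m (G : 'I_m -> E) (mid : 'I_m -> R)
    (A : set T1) : 0 < M2 -> 0 < k -> 0 < eta -> 0 < r' -> 0 < dl -> 0 <= t -> 3 * k < r ->
  measurable A -> (forall g, closed_band M1 (G g)) ->
  (forall u v, closed_band M1 u -> `|v - u| <= 3 * k -> band M2 v) ->
  (forall w, A w -> forall g, `|contract (L w (G g)) - mid g| <= h - 2 * dl) ->
  (forall w, A w -> forall a b, band M2 a -> band M2 b -> `|a - b| < r ->
     `|contract (L w a) - contract (L w b)| <= t) ->
  (forall w, A w -> forall a b, band M2 a -> band M2 b -> `|a - b| < r' ->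
     `|contract (L w a) - contract (L w b)| <= dl) ->
  exists Q : nat -> set (int * int -> R), [/\
    forall n d' (T' : measurableType d') (F : T' -> int * int -> R),
      random_function F -> measurable [set w | Q n (F w)],
    forall eps : R, 0 < eps -> \forall n \near \oo, (P1 A - eps%:E <= P [set w | Q n (X w)])%E &
    forall n Y, Q n Y -> (forall g, `|contract (dn n Y (G g)) - mid g| < h) /\
      forall g (i j : int) x y, let v := ((x, i%:~R * eta), (y, j%:~R * eta)) in
        `|v - G g| <= 2 * k -> `|contract (dn n Y v) - mid g| <= t + h].
Proof.
move=> M20 k0 eta0 r'0 dl0 t0 kr mA GK e2 Amid Ar Ar'.
have [K idx] := bounded_int_index M2 eta0.
pose sl (a : 'I_K) : R := ((a : nat)%:Z - (K./2)%:Z)%:~R * eta.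
pose near (g : 'I_m) (a : 'I_K * 'I_K) : bool :=
  (`|sl a.1 - (G g).1.2| <= 2 * k) && (`|sl a.2 - (G g).2.2| <= 2 * k).
pose J : finType := ('I_m * option ('I_K * 'I_K))%type.
(* Pairs of slices far from the net point need not be ordered in time; they fall back on the times
   of the net point and repeat its constraint. *)
pose slc (j : J) : option (R * R) :=
  if j.2 is Some a then (if near j.1 a then Some (sl a.1, sl a.2) else None) else None.
pose s j := if slc j is Some p then p.1 else (G j.1).1.2.
pose e j := if slc j is Some p then p.2 else (G j.1).2.2.
pose q (j : J) := ((G j.1).1.1, (G j.1).2.1).
pose kk j := if slc j is Some _ then 2 * k else 0.
pose hh j := if slc j is Some _ then t + h else h.
(* The width of the penalty zone: 2 k + z <= 3 k stays in the largest band and below [r], and z < r'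
   leaves an oscillation of only [dl] at the net point. *)
pose z := Num.min k (r' / 2).
have z0 : 0 < z by rewrite lt_min k0 divr_gt0.
have zk : z <= k by rewrite ge_min lexx.
have k21 : 2 * k + k = 3 * k by ring.
have k30 : 0 <= 3 * k by rewrite mulr_ge0// ltW.
have k23 : 2 * k <= 3 * k by rewrite -k21 lerDl ltW.
have z3k : z <= 3 * k by rewrite (le_trans zk)// -k21 lerDr mulr_ge0// ltW.
have zr : z < r' by apply: (@le_lt_trans _ _ (r' / 2)); [rewrite ge_min lexx orbT|lra].
have Gb g : band M2 (G g) by apply: (e2 _ _ (GK g)); rewrite subrr normr0.
have slice_pt j (x : R * R) : `|x - q j| <= kk j + z ->
   let v := ((x.1, s j), (x.2, e j)) in
   [/\ band M2 v, `|v - G j.1| < r & slc j = None -> `|v - G j.1| < r'].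
  move=> xq v.
  have [x1 x2] := ler_prod_norm x (q j); rewrite /= in x1 x2.
  have xk : kk j + z <= 3 * k by rewrite /kk; case: (slc j) => [_|]; rewrite ?add0r// -k21 lerD2l.
  have vG : `|v - G j.1| <= 3 * k.
    have xk3 := le_trans xq xk.
    have [s3 e3] : `|s j - (G j.1).1.2| <= 3 * k /\ `|e j - (G j.1).2.2| <= 3 * k.
      rewrite /s /e /slc; case: (j) => g [a|] /=; last by rewrite !subrr normr0.
      case: ifP => /= [/andP[h1 h2]|_]; last by rewrite !subrr normr0.
      by split; [exact: le_trans h1 k23|exact: le_trans h2 k23].
    by apply: norm4_le => //=; [exact: le_trans x1 xk3|exact: le_trans x2 xk3].
  split; [exact: (e2 _ _ (GK j.1) vG)|exact: le_lt_trans vG kr|move=> sN].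
  have xz : `|x - q j| <= z by move: xq; rewrite /kk sN add0r.
  apply: le_lt_trans zr; apply: norm4_le => /=; [exact: le_trans x1 xz| |exact: le_trans x2 xz|];
    by rewrite /s /e sN subrr normr0 ltW.
have kk0 j : 0 <= kk j by rewrite /kk; case: (slc j) => [_|]//; rewrite mulr_ge0// ltW.
have se j : s j < e j.
  have [|h1 _ _] := slice_pt j (q j); first by rewrite subrr normr0 addr_ge0// ltW.
  exact: (band_R4up M20 (band_closed_band h1)).
have rL w j : right_approximable (time_slice (L w) (s j) (e j)).
  by apply: (@right_approximable_continuous R (L w) _ _ (se j)) => u uu; exact: cL.
have Adev w (j : J) (x : R * R) : A w -> `|x - q j| <= kk j + z ->
    `|contract (time_slice (L w) (s j) (e j) x) - mid j.1| <= hh j - dl.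
  move=> Aw /slice_pt[]; rewrite /time_slice; set v := (_, _) => b1 b2 b3.
  have h1 := Amid w Aw j.1.
  have h2 := ler_distD (contract (L w (G j.1))) (contract (L w v)) (mid j.1).
  rewrite /hh; case E1 : (slc j) b3 => [p|] b3.
    exact: (deviation_near h1 h2 (ltW dl0) (Ar w Aw _ _ b1 (Gb j.1) b2)).
  exact: (deviation_at h1 h2 (Ar' w Aw _ _ b1 (Gb j.1) (b3 erefl))).
have lg g : 0 < (1 + `|mid g|) / z by rewrite divr_gt0// ltr_pwDl.
exists (fun n => [set Y | forall j : J, deviation (q j) (kk j) (mid j.1) ((1 + `|mid j.1|) / z)
  (time_slice (dn n Y) (s j) (e j)) < hh j]).
split.
- move=> n d' T' F mF; apply: measurable_deviation_event => [j|j x|j w].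
  + exact: lg.
  + exact: measurable_rescaled_lpp.
  + exact: right_approximable_rescaled_lpp.
- apply: (multi_time_portmanteau (del := dl) cvgD) => //.
  + by move=> n u; exact: measurable_rescaled_lpp.
  + by move=> n w j; exact: right_approximable_rescaled_lpp.
- move=> n Y QY; split => [g|g i j x y v vG].
    apply: le_lt_trans (QY (g, None)).
    have := @deviation_ge R (q (g, None)) 0 (mid g) ((1 + `|mid g|) / z) (lg g)
      (time_slice (dn n Y) (G g).1.2 (G g).2.2) ((G g).1.1, (G g).2.1).
    rewrite subrr normr0 lexx => /(_ isT) hd.
    have -> : dn n Y (G g) = time_slice (dn n Y) (G g).1.2 (G g).2.2 ((G g).1.1, (G g).2.1).
      by rewrite /time_slice; case: (G g) => [[? ?] [? ?]].
    exact: hd.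
  have vb : band M2 v by apply: (e2 _ _ (GK g)); exact: le_trans vG k23.
  have [v1 v2 v3 v4] := coordinate_dist v 0; rewrite !subr0 in v1 v2 v3 v4.
  have vM : `|v| <= M2 by apply: ltW; case: vb.
  have [a ia] := idx i (le_trans v2 vM); have [b jb] := idx j (le_trans v4 vM).
  have [w1 w2 w3 w4] := coordinate_dist v (G g).
  have nab : near g (a, b).
    by rewrite /near /sl -ia -jb; apply/andP; split; [exact: le_trans w2 vG|exact: le_trans w4 vG].
  have sS : slc (g, Some (a, b)) = Some (sl a, sl b) by rewrite /slc /= nab.
  have [s1 s2 s3 s4] : [/\ s (g, Some (a, b)) = sl a, e (g, Some (a, b)) = sl b,
      kk (g, Some (a, b)) = 2 * k & hh (g, Some (a, b)) = t + h].
    by rewrite /s /e /kk /hh sS.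
  have := QY (g, Some (a, b)); rewrite s1 s2 s3 s4 => /ltW; apply: le_trans.
  have := @deviation_ge R (q (g, Some (a, b))) (2 * k) (mid g) ((1 + `|mid g|) / z) (lg g)
      (time_slice (dn n Y) (sl a) (sl b)) (x, y).
  rewrite /time_slice /sl -ia -jb; apply.
  rewrite prod_normE/= ge_max; apply/andP; split; [exact: le_trans w1 vG|exact: le_trans w3 vG].
Qed.

End SlicesEvent.

Lemma measurable_forall_fin d (T : measurableType d) (I : finType) (A : I -> set T) :
  (forall i, measurable (A i)) -> measurable [set w | forall i, A i w].
Proof.
move=> mA; rewrite (_ : [set w | _] = \bigcap_(i in setT) A i).
  by apply: fin_bigcap_measurable => //; exact: finite_finset.
by apply/seteqP; split => [w H i _|w H i]; [exact: H|exact: (H i)].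
Qed.

Lemma probability_setI_ge {R : realType} d (T : measurableType d) (P : probability T R)
    (B C : set T) (e : R) : measurable B -> measurable C -> ((1 - e)%:E <= P C)%E ->
  (P B - e%:E <= P (B `&` C))%E.
Proof.
move=> mB mC PC; rewrite leeBlDr//.
have h : P (~` C) = (1 - P C)%E by exact: probability_setC.
have h2 : (P (~` C) <= e%:E)%E.
  rewrite h; move: PC; rewrite -(fineK (fin_num_measure P C mC)) -EFinB !lee_fin; lra.
have -> : P B = (P (B `&` C) + P (B `&` ~` C))%E.
  rewrite -measureU//; [|exact: measurableI|by apply: measurableI => //; exact: measurableC|].
    by rewrite -setIUr setUv setIT.
  by rewrite setIACA setICr setI0.
by rewrite leeD2l//; apply: le_trans h2; apply: le_measure => //; rewrite inE//;
  [apply: measurableI => //|]; exact: measurableC.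
Qed.

Section CellArithmetic.
Context {R : realFieldType}.
Implicit Types (a b x t del p q eps pm k r s : R).

Lemma cell_mid_le a x t del : a <= x <= a + 2 * t - del ->
  `|x - (a + t - del / 2)| <= t - 2 * (del / 4).
Proof. by move=> /andP[? ?]; rewrite ler_norml; apply/andP; split; lra. Qed.

Lemma cell_mid_lt a x t del : `|x - (a + t - del / 2)| < t ->
  a - del / 2 < x < a + 2 * t - del / 2.
Proof. by rewrite ltr_norml => /andP[? ?]; apply/andP; split; lra. Qed.

Lemma cell_inside a b x del : 0 < del -> a <= x <= b - del -> a - del / 2 < x < b - del / 2.
Proof. by move=> ? /andP[? ?]; apply/andP; split; lra. Qed.

Lemma cell_loss eps pm p q : 0 < eps -> pm <= p -> p - eps * pm / 2 <= q ->
  (1 - eps) * p <= q - eps * pm / 2.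
Proof. by move=> e0 pmp; have := ler_wpM2l (ltW e0) pmp; lra. Qed.

Lemma quarter_lt k r : 0 < r -> k <= r / 4 -> 2 * k < r /\ 3 * k < r.
Proof. by move=> *; split; lra. Qed.

Lemma eighth_sum k t : k <= t / 8 -> 2 * (t / 8) + 2 * (t / 8) + 2 * k <= 6 * (t / 8).
Proof. by lra. Qed.

Lemma three_quarters eps p q s :
  p - eps / 4 <= q -> 1 - eps / 4 <= p -> q - eps / 4 <= s -> 0 < eps -> 1 - eps <= s.
Proof. by lra. Qed.

End CellArithmetic.

Section Closeness.
Context {R : realType} d (T : measurableType d) (P : probability T R)
  (X : T -> int * int -> R) d1 (T1 : measurableType d1) (P1 : probability T1 R)
  (L : T1 -> (R * R) * (R * R) -> \bar R).
Variables (rho alpha beta chi tau : R) (delta C : R) (n0 : nat).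
Local Notation dn := (rescaled_lpp rho alpha beta chi tau).
Hypotheses (iidX : iid P X) (rho0 : 0 < rho) (alpha0 : 0 <= alpha)
  (beta0 : 0 <= beta) (chi0 : 0 < chi) (tau0 : 0 < tau)
  (delta0 : 0 < delta) (C0 : 0 <= C)
  (momentX : forall n, (n0 <= n)%N -> forall x : R, -3 <= x <= 3 ->
    (negative_part_moment P (5 + delta)%R (fun w => dn n (X w) ((0, 0), (x, 1))%R) <= C%:E)%E)
  (mL : forall u, measurable_fun setT (fun w => L w u))
  (cL : forall w u, R4up u -> {for u, continuous (fun u => contract (L w u))})
  (cvgD : multi_time_cvg P (fun n w => dn n (X w)) P1 L).

(** An index is a choice of a cell for the value at each net point. [A] and its index set do not
    depend on [n], while [S] does; this allows one landscape to be coupled with all the [d_n]. *)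
Lemma closeness (M th eps : R) : 0 < M -> 0 < th -> 0 < eps ->
  exists (I : finType) (A : I -> set T1),
  [/\ forall i, measurable (A i), trivIset setT A, ((1 - eps)%:E <= P1 (\bigcup_i A i))%E &
  exists N : nat, forall n, (N <= n)%N -> exists S : I -> set (int * int -> R),
  [/\ trivIset setT S,
      forall i d' (T' : measurableType d') (F : T' -> int * int -> R),
        random_function F -> measurable [set w | S i (F w)],
      forall i, ((1 - eps)%:E * P1 (A i) <= P [set w | S i (X w)])%E &
      forall i w Y, A i w -> S i Y -> (forall z, 0 <= Y z) -> forall u, band M u ->
        `|contract (dn n Y u) - contract (L w u)| <= th]].
Proof.
move=> M0 th0 eps0; pose t := th / 8; have t0 : 0 < t by rewrite divr_gt0.
have e40 : 0 < eps / 4 by rewrite divr_gt0.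
pose M1 := M + 1; pose M2 := M + 2.
have [M10 M20] : 0 < M1 /\ 0 < M2 by rewrite /M1 /M2; lra.
have [MM1 MM2] : M < M1 /\ M1 < M2 by rewrite /M1 /M2; lra.
pose f w u := contract (L w u).
have mf u : measurable_fun setT (fun w => f w u) by exact: measurable_contract.
have [r [W [r0 mW PW osc]]] := oscillation_event P1 mf cL M20 t0 e40.
have [ka ka0 Ha] := band_enlarge M0 MM1; have [kb kb0 Hb] := band_enlarge M10 MM2.
pose k := Num.min (Num.min t ka) (Num.min (kb / 3) (r / 4)).
have k0 : 0 < k by rewrite !lt_min t0 ka0 !divr_gt0.
have : k <= k by []. rewrite {2}/k !le_min => /andP[/andP[kt kka] /andP[kkb kr]].
have [m [G [GK net]]] := @finite_net R M1 k k0.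
have f1 (g : 'I_m) w : -1 <= f w (G g) <= 1 by rewrite -ler_norml contract_le1.
have [del del0 Pcell] := cell_event (f := fun g => f ^~ (G g)) t0 P1 mW (fun g => mf (G g)) f1 e40.
have d40 : 0 < del / 4 by rewrite divr_gt0.
(* A second oscillation event is needed because its accuracy depends on the gap [del], which is only
   known after the first one has been fixed. *)
have [r' [W' [r'0 mW' PW' osc']]] := oscillation_event P1 mf cL M20 d40 e40.
pose I : finType := {ffun 'I_m -> 'I_(cell_count t)}.
pose B := [set w | W w /\ forall g, exists j : 'I_(cell_count t),
  cell_left t j <= f w (G g) <= cell_left t j.+1 - del].
pose A (i : I) := [set w | W w /\ forall g, cell_left t (i g) <= f w (G g) <= cell_left t (i g).+1 - del] `&` W'.
(* The centre of the shifted open cell of length 2 t: being within [t] of it puts [d_n] in that open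
   cell, and on [A i] the value of [L] is within t - del / 2 of it. *)
pose mid (i : I) g := cell_left t (i g) + t - del / 2.
have mcell i : measurable [set w | W w /\ forall g, cell_left t ((i : I) g) <= f w (G g) <= cell_left t (i g).+1 - del].
  apply: measurableI => //; apply: measurable_forall_fin => g.
  have := mf (G g) measurableT `[cell_left t (i g), cell_left t (i g).+1 - del]%classic (measurable_itv _).
  by rewrite setTI; congr measurable; apply/seteqP; split => w /=; rewrite in_itv.
have mA i : measurable (A i) by apply: measurableI.
have BA : B `&` W' = \bigcup_i A i.
  apply/seteqP; split => [w [[Ww H] W'w]|w [i _ [[Ww H] W'w]]]; last first.
    by split => //; split => // g; exists (i g).
  have {}H g := cid (H g).
  exists [ffun g => sval (H g)] => //; split => //; split => // g.
  by rewrite ffunE; exact: (svalP (H g)).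
have mB : measurable B.
  rewrite (_ : B = \bigcup_i [set w | W w /\ forall g, cell_left t ((i : I) g) <= f w (G g) <= cell_left t (i g).+1 - del]).
    by apply: fin_bigcup_measurable => //; exact: finite_finset.
  apply/seteqP; split => [w [Ww H]|w [i _ [Ww H]]]; last by split => // g; exists (i g).
  have {}H g := cid (H g).
  exists [ffun g => sval (H g)] => //; split => // g.
  by rewrite ffunE; exact: (svalP (H g)).
have PA : ((1 - eps)%:E <= P1 (\bigcup_i A i))%E.
  rewrite -BA; apply: le_trans (probability_setI_ge mB mW' PW').
  move: Pcell PW; rewrite -/B.
  rewrite -(fineK (fin_num_measure P1 W mW)) -(fineK (fin_num_measure P1 B mB)) -!EFinB !lee_fin; lra.
have [pm pm0 Hpm] := positive_lower_bound (fun i => fine (P1 (A i))).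
(* Lost twice, in the weak convergence and in the connectivity event; the total eps * pm is at most
   [eps] times the probability of any cell of positive probability. *)
pose e1 := eps * pm / 2; have e10 : 0 < e1 by rewrite divr_gt0// mulr_gt0.
have [eta [eta0 [_ [N HN]]]] := lattice_connectivity iidX rho0 alpha0 beta0 chi0 tau0 delta0 C0 momentX (ltW M20) k0 e10.
have [mX _ _] := iidX.
have [k2r kr3] := quarter_lt r0 kr.
have Hb3 u v : closed_band M1 u -> `|v - u| <= 3 * k -> band M2 v.
  by move=> Ku vu; apply: (Hb u) => //; apply: (le_trans vu); rewrite -ler_pdivlMl// mulrC.
have AQ i : {Q : nat -> set (int * int -> R) | [/\
    forall n d' (T' : measurableType d') (F : T' -> int * int -> R),
      random_function F -> measurable [set w | Q n (F w)],
    forall eps : R, 0 < eps -> \forall n \near \oo, (P1 (A i) - eps%:E <= P [set w | Q n (X w)])%E &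
    forall n Y, Q n Y -> (forall g, `|contract (dn n Y (G g)) - mid i g| < t) /\
      forall g (a b : int) x y, let v := ((x, a%:~R * eta), (y, b%:~R * eta)) in
        `|v - G g| <= 2 * k -> `|contract (dn n Y v) - mid i g| <= t + t]}.
  apply/cid; apply: (slices_event (r := r) (r' := r') (dl := del / 4) chi0 tau0 mX mL cL cvgD M20 k0 eta0 r'0 d40 (ltW t0) kr3 (mA i) GK Hb3).
  - by move=> w [[_ Aw] _] g; move: (Aw g); rewrite cell_leftS; exact: cell_mid_le.
  - by move=> w [[Ww _] _]; exact: osc.
  - by move=> w [_ W'w] a b Va Vb ab; exact: osc'.
pose Q i := sval (AQ i).
have near_n : \forall n \near \oo, forall i, (P1 (A i) - e1%:E <= P [set w | Q i n (X w)])%E.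
  by apply: filter_forall => i; have [_ + _] := svalP (AQ i); apply.
have [N' _ HN'] := near_n.
have tA : trivIset setT A.
  move=> i j _ _ [w [[[_ Hi] _] [[_ Hj] _]]]; apply/ffunP => g; apply/val_inj => /=.
  exact: (cell_unique t0 (cell_inside del0 (Hi g)) (cell_inside del0 (Hj g)) erefl).
exists I, A; split => //; exists (maxn N N') => n; rewrite geq_max => /andP[Nn N'n].
have [S [n_gt0 mS PS HS]] := HN n Nn.
exists (fun i => [set Y | Q i n Y /\ S Y]); split => //.
- apply/trivIsetP => i j _ _ ij; apply/seteqP; split => // Y [[Qi _] [Qj _]].
  have /eqP := ij; apply; apply/ffunP => g; apply/val_inj => /=.
  have [_ _ /(_ n Y Qi)[/(_ g) hi _]] := svalP (AQ i).
  have [_ _ /(_ n Y Qj)[/(_ g) hj _]] := svalP (AQ j).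
  have {}hi := cell_mid_lt hi; have {}hj := cell_mid_lt hj; rewrite -!cell_leftS in hi hj.
  exact: (cell_unique t0 hi hj erefl).
- move=> i d' T' F mF; apply: measurableI; last exact: mS.
  by have [+ _ _] := svalP (AQ i); apply.
- move=> i.
  have mQ : measurable [set w | Q i n (X w)] by have [+ _ _] := svalP (AQ i); apply.
  have mQS := probability_setI_ge mQ (mS _ _ _ mX) PS.
  have := HN' n N'n i; have := Hpm i; move: mQS.
  set D := _ `&` _; have -> : [set w | Q i n (X w) /\ S (X w)] = D by [].
  have mD : measurable D by apply: measurableI => //; exact: mS.
  rewrite -(fineK (fin_num_measure P1 _ (mA i))) -(fineK (fin_num_measure P _ mQ)) /=.
  rewrite -(fineK (fin_num_measure P _ mD)) -!EFinB -EFinM !lee_fin.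
  have : 0 <= fine (P1 (A i)) by exact: fine_ge0.
  have : 0 <= fine (P D) by exact: fine_ge0.
  move=> D0 A0 QD Hp Hq.
  (* [pm] bounds only the positive probabilities from below; for a null [A i] the inequality is
     trivial. *)
  have [A0'|A0'] := ltP 0 (fine (P1 (A i))).
    by apply: le_trans QD; exact: cell_loss (Hp A0') Hq.
  by rewrite (le_anti (introT andP (conj A0' A0))) mulr0.
- move=> i w Y [[Ww Aw] W'w] [QY SY] Y0 u uM.
  have cY : connected rho alpha beta chi tau n eta k M2 Y.
    by move=> fw x s xM sM; exact: HS.
  have [_ _ /(_ n Y QY)[_ Hv]] := svalP (AQ i).
  have Ha' a v : closed_band M a -> `|v - a| <= k -> band M1 v.
    by move=> Ka va; apply: (Ha a) => //; exact: le_trans va kka.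
  have MM : M <= M2 by apply: ltW; exact: lt_trans MM2.
  have fG g : `|f w (G g) - mid i g| <= t.
    move: (Aw g); rewrite cell_leftS => /cell_mid_le /le_trans; apply.
    by rewrite gerBl mulr_ge0// ltW.
  have := slice_control chi0 n_gt0 (ltW k0) MM cY Ha' Hb3 GK net k2r (osc w Ww) fG Hv uM.
  move=> /le_trans; apply; apply: (le_trans (eighth_sum kt)).
  by rewrite mulrCA ger_pMr// ler_pdivrMr// mul1r ler_nat.
Qed.

End Closeness.

(** * Coupling *)

Lemma probability_setI_full {R : realType} d (T : measurableType d) (P : probability T R)
    (B C : set T) : measurable B -> measurable C -> P C = 1%E -> P (B `&` C) = P B.
Proof.
move=> mB mC PC; apply/le_anti/andP; split.
  by apply: le_measure; rewrite ?inE//; exact: measurableI.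
have := @probability_setI_ge R d T P B C 0 mB mC; rewrite PC subr0 sube0; exact.
Qed.

Section Quantile.
Context {R : realType}.
Local Notation U := (uniform_prob (@ltr01 R)).

Lemma uniform_probE (A : set R) : measurable A ->
  U A = lebesgue_measure (A `&` `[0, 1]%classic).
Proof.
move=> mA; rewrite /uniform_prob integral_uniform_pdf.
rewrite (eq_integral (fun=> 1%E)); last first.
  move=> x; rewrite inE/= in_itv/= => -[_ x01].
  by rewrite /uniform_pdf x01 subr0 invr1.
by rewrite integral_cst ?mul1e//; exact: measurableI.
Qed.

Lemma uniform_prob_itvoo : U `]0, 1[%classic = 1%E.
Proof.
rewrite uniform_probE// (_ : _ `&` _ = `]0, 1[%classic).
  by rewrite lebesgue_measure_itv/= lte_fin ltr01 sube0.
by apply/setIidPl/subset_itv; rewrite bnd_simp.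
Qed.

Lemma uniform_prob_Nyc (c : R) : 0 <= c <= 1 -> U `]-oo, c]%classic = c%:E.
Proof.
move=> /andP[c0 c1]; rewrite uniform_probE// (_ : _ `&` _ = `[0, c]%classic).
  rewrite lebesgue_measure_itv/= lte_fin sube0.
  by case: ltgtP c0 => // <-.
apply/seteqP; split => x /=; rewrite !in_itv/=; first by move=> [-> /andP[->]].
by move=> /andP[-> xc]; rewrite xc (le_trans xc c1).
Qed.

Lemma uniform_prob_cy (c : R) : 0 <= c <= 1 -> U `]c, +oo[%classic = (1 - c)%:E.
Proof.
move=> c01; rewrite -setCitvl probability_setC//.
by rewrite [X in (1 - X)%E]uniform_prob_Nyc.
Qed.

Lemma uniform_prob_setI (B : set R) : measurable B ->
  U (B `&` `]0, 1[%classic) = U B.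
Proof.
by move=> mB; apply: probability_setI_full => //; exact: uniform_prob_itvoo.
Qed.

(** The generalized inverse of the distribution function, applied to a uniform variable. Laws are
    compared on the half-lines above x, a generating pi-system. *)
Lemma quantile d (S : measurableType d) (P : probability S R) (V : S -> R) :
  measurable_fun setT V -> exists2 Q : R -> R, measurable_fun setT Q &
  forall B, measurable B -> U (Q @^-1` B) = P (V @^-1` B).
Proof.
move=> mV; pose V' : {mfun S >-> R} := mfun_Sub (mem_set mV).
pose F x := fine (cdf (V' : {RV P >-> R}) x).
have FE x : cdf (V' : {RV P >-> R}) x = (F x)%:E by rewrite fineK// fin_num_measure.
have F01 x : 0 <= F x <= 1 by rewrite -!lee_fin -FE cdf_ge0 cdf_le1.
have Fnd x y : x <= y -> F x <= F y.
  by move=> xy; rewrite -lee_fin -!FE; exact: cdf_nondecreasing.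
pose A u := [set x | u <= F x].
have A0 u : u < 1 -> A u !=set0.
  move=> u1; have V1 : nbhs (1%E : \bar R) [set y | (u%:E < y)%E].
    change (nbhs (1 : R) [set y : R | (u%:E < y%:E)%E]).
    apply/nbhs_ballP; exists (1 - u) => [|y]; first by rewrite /= subr_gt0.
    by rewrite -ball_normE/= lte_fin ltr_norml => /andP[_]; lra.
  have [M [_ HM]] := @cvg_cdfy1 _ S R P V' _ V1.
  exists (M + 1) => /=; have := HM (M + 1); rewrite /= FE lte_fin => /(_ _)/ltW; apply.
  by rewrite ltrDl.
have Alb u : 0 < u -> has_lbound (A u).
  move=> u0; have V1 : nbhs (0%E : \bar R) [set y | (y < u%:E)%E].
    change (nbhs (0 : R) [set y : R | (y%:E < u%:E)%E]).
    apply/nbhs_ballP; exists u => [|y]//.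
    by rewrite -ball_normE/= lte_fin ltr_norml => /andP[]; lra.
  have [M [_ HM]] := @cvg_cdfNy0 _ S R P V' _ V1.
  exists (M - 1) => x /= ux; rewrite leNgt; apply/negP => xM.
  have := HM (M - 1); rewrite /= FE lte_fin => /(_ _) h.
  have h' := h (ltac:(by rewrite gtrBl)).
  by have := le_lt_trans (le_trans ux (Fnd _ _ (ltW xM))) h'; rewrite ltxx.
(* Outside ]0, 1[, a null set, the infimum may be over an empty or unbounded set; 0 is an arbitrary
   value. *)
pose Q u := if 0 < u < 1 then inf (A u) else 0.
(* Right continuity of the distribution function turns the infimum into an exact equivalence. *)
have QE u x : 0 < u < 1 -> (x < Q u) = (F x < u).
  move=> u01; have /andP[u0 u1] := u01; rewrite /Q u01; apply/idP/idP.
    move=> xQ; rewrite ltNge; apply/negP => uF.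
    by move: xQ; apply/negP; rewrite -leNgt; apply: ge_inf => //; exact: Alb.
  move=> Fx; have V1 : nbhs (cdf (V' : {RV P >-> R}) x) [set y | (y < u%:E)%E].
    rewrite FE; change (nbhs (F x) [set y : R | (y%:E < u%:E)%E]).
    apply/nbhs_ballP; exists (u - F x) => [|y]; first by rewrite /= subr_gt0.
    by rewrite -ball_normE/= lte_fin ltr_norml => /andP[]; lra.
  have /nbhs_ballP[e /= e0 He] := @cdf_right_continuous _ S R P V' x _ V1.
  have xe : x < x + e / 2 by rewrite ltrDl divr_gt0.
  apply: (lt_le_trans xe); apply: lb_le_inf; first exact: A0.
  move=> z /= uz; rewrite leNgt; apply/negP => zx.
  have := He (x + e / 2); rewrite -ball_normE/= FE lte_fin.
  rewrite opprD addrA subrr add0r normrN gtr0_norm ?divr_gt0// => /(_ _ xe) h.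
  have h' := h (ltac:(by rewrite ltr_pdivrMr// ltr_pMr// ltr1n)).
  by have := le_lt_trans (le_trans uz (Fnd _ _ (ltW zx))) h'; rewrite ltxx.
have QI x : Q @^-1` `]x, +oo[%classic `&` `]0, 1[%classic = `](F x), +oo[%classic `&` `]0, 1[%classic.
  apply/seteqP; split => u /= [+ u01]; rewrite !in_itv/= !andbT in u01 *; rewrite QE//.
have QI' x : Q @^-1` `]x, +oo[%classic `&` ~` `]0, 1[%classic =
    (if x < 0 then ~` `]0, 1[%classic else set0).
  apply/seteqP; split => u /=.
    by rewrite in_itv/= andbT /Q in_itv/= => -[+ /negP/negbTE u01]; rewrite u01 => ->/=; rewrite in_itv/= u01.
  by case: ifP => // x0 /=; rewrite !in_itv/= andbT /Q => /negP/negbTE ->.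
have mQ : measurable_fun setT Q.
  apply: (measurability _ (RGenOInfty.measurableE R)) => //.
  move=> _ [_ [x ->] <-]; rewrite setTI -[X in measurable X]setIT -(setUv `]0, 1[%classic) setIUr QI QI'.
  apply: measurableU; first exact: measurableI.
  by case: ifP => // _; exact: measurableC.
exists Q => //.
have mQ' : @measurable_fun _ _ (measurableTypeR R) R setT Q by exact: mQ.
pose Q' : {mfun measurableTypeR R >-> R} := @mfun_Sub _ _ (measurableTypeR R) R Q (mem_set mQ').
have G x : U (Q @^-1` `]x, +oo[%classic) = P (V @^-1` `]x, +oo[%classic).
  have mB : measurable (Q @^-1` `]x, +oo[%classic).
    by rewrite -[X in measurable X]setTI; exact: (mQ measurableT _ (measurable_itv _)).
  rewrite -uniform_prob_setI// QI uniform_prob_setI// uniform_prob_cy// -setCitvl preimage_setC probability_setC.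
    by rewrite -[P _]/(cdf (V' : {RV P >-> R}) x) FE EFinB.
  by rewrite -[X in measurable X]setTI; exact: (mV measurableT _ (measurable_itv _)).
move=> B mB.
pose m1 : {measure set R -> \bar R} := distribution U Q'.
pose m2 : {measure set R -> \bar R} := distribution P V'.
change (m1 B = m2 B); apply: (@measure_unique _ R R (@RGenOInfty.G R) (fun n : nat => `](- n%:R), +oo[%classic)) => //.
- exact: RGenOInfty.measurableE.
- move=> _ _ [x ->] [y ->]; exists (Num.max x y); apply/seteqP; split => z /=;
    by rewrite !in_itv/= !andbT gt_max => /andP.
- by move=> n; exists (- n%:R).
- apply/seteqP; split => // z _; exists (Num.truncn `|z|).+1 => //=.
  rewrite in_itv/= andbT ltrNl; apply: le_lt_trans (truncnS_gt _).
  by rewrite -normrN ler_norm.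
- by move=> _ [x ->]; exact: G.
- by move=> n; apply: (le_lt_trans (probability_le1 (distribution U Q') (measurable_itv _))); rewrite ltry.
Qed.

End Quantile.

Section Coupling.
Context {R : realType}.
Local Notation U := (uniform_prob (@ltr01 R)).

(** Samples the conditional law of [V] given [D]. In product form the statement holds for a null [D]
    too, where any function will do. *)
Lemma conditional_quantile d (S : measurableType d) (m : probability S R) (V : S -> R)
    (D : set S) : measurable_fun setT V -> measurable D ->
  exists2 Q : R -> R, measurable_fun setT Q &
  forall C, measurable C -> (m D * U (Q @^-1` C))%E = m (D `&` V @^-1` C).
Proof.
move=> mV mD; have mVC C : measurable C -> measurable (V @^-1` C).
  by move=> mC; rewrite -[X in measurable X]setTI; exact: mV.
have [D0|D0] := eqVneq (m D) 0%E.
  exists (cst 0) => [|C mC]; first exact: measurable_cst.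
  rewrite D0 mul0e; apply/esym/eqP; rewrite eq_le measure_ge0 andbT -D0.
  by apply: le_measure; rewrite ?inE//; apply: measurableI => //; exact: mVC.
have [Q mQ QE] := quantile (mnormalize (mrestr m mD) m) mV.
exists Q => // C mC.
have fD : m D \is a fin_num by exact: fin_num_measure.
have ME : mnormalize (mrestr m mD) m (V @^-1` C) = (m (V @^-1` C `&` D) * ((fine (m D))^-1)%:E)%E.
  rewrite /mnormalize/= /mrestr setTI (negbTE D0)/=; case: eqP => // DE.
  by move: fD; rewrite DE.
rewrite (etrans (QE C mC) ME) setIC -[X in (X * _)%E](fineK fD) muleCA -EFinM divff ?mule1//.
by rewrite fine_eq0.
Qed.

(** On [A i], sample from the conditional law of [V] given [D i]; as the two partitions have equal
    masses, the mixture has the law of [V]. Only the cell of the first variable is looked at. *)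
Lemma partition_coupling (J : finType) d (W : measurableType d) (P : probability W R)
    d' (S : measurableType d') (m : probability S R) (V : S -> R)
    (A : J -> set W) (D : J -> set S) (B : J -> set R) :
  measurable_fun setT V -> (forall i, measurable (A i)) -> (forall i, measurable (D i)) ->
  (forall i, measurable (B i)) -> trivIset setT A -> trivIset setT D ->
  (forall i, P (A i) = m (D i)) -> (forall i, D i `<=` V @^-1` B i) ->
  exists Z : W * measurableTypeR R -> R, [/\ measurable_fun setT Z,
    forall C, measurable C -> (P \x U)%E (Z @^-1` C) = m (V @^-1` C) &
    {ae (P \x U)%E, forall z, forall i, A i z.1 -> B i (Z z)}].
Proof.
move=> mV mA mD mB tA tD AD DB.
(* [None] stands for the complement, which also has the same mass on both sides. *)
pose A' (o : option J) := if o is Some i then A i else ~` \bigcup_i A i.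
pose D' (o : option J) := if o is Some i then D i else ~` \bigcup_i D i.
have mUA : measurable (\bigcup_i A i) by apply: fin_bigcup_measurable => //; exact: finite_finset.
have mUD : measurable (\bigcup_i D i) by apply: fin_bigcup_measurable => //; exact: finite_finset.
have mA' o : measurable (A' o) by case: o => [i|] //=; exact: measurableC.
have mD' o : measurable (D' o) by case: o => [i|] //=; exact: measurableC.
have tA' : trivIset setT A'.
  move=> -[i|] [j|] _ _ //= [w [h1 h2]].
  - by congr Some; apply: tA => //; exists w.
  - by case: h2; exists i.
  - by case: h1; exists j.
have tD' : trivIset setT D'.
  move=> -[i|] [j|] _ _ //= [w [h1 h2]].
  - by congr Some; apply: tD => //; exists w.
  - by case: h2; exists i.
  - by case: h1; exists j.
have covA w : exists o, A' o w.
  by have [[i _ Ai]|nA] := pselect ((\bigcup_i A i) w); [exists (Some i)|exists None].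
have covD w : exists o, D' o w.
  by have [[i _ Di]|nD] := pselect ((\bigcup_i D i) w); [exists (Some i)|exists None].
have AD' o : P (A' o) = m (D' o).
  case: o => [i|]; first exact: AD.
  rewrite /A' /D' !probability_setC//; congr (1 - _)%E.
  rewrite !measure_fin_bigcup//; [|exact: finite_finset|exact: finite_finset].
  by apply: eq_fsbigr => i _; exact: AD.
have Qex o := cid2 (conditional_quantile m mV (mD' o)).
pose Q o := s2val (Qex o).
have mQ o : measurable_fun setT (Q o) by exact: (s2valP (Qex o)).
have QE o C : measurable C -> (P (A' o) * U (Q o @^-1` C))%E = m (D' o `&` V @^-1` C).
  by move=> mC; rewrite AD'; exact: (s2valP' (Qex o)).
have mQC o C : measurable C -> measurable (Q o @^-1` C : set (measurableTypeR R)).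
  by move=> mC; rewrite -[X in measurable X]setTI; exact: mQ.
pose idx w := sval (cid (covA w)).
have idxA w : A' (idx w) w by exact: (svalP (cid (covA w))).
have idxE w o : A' o w -> idx w = o.
  by move=> Ao; apply: tA' => //; exists w.
exists (fun z => Q (idx z.1) z.2).
have preE C : (fun z : W * measurableTypeR R => Q (idx z.1) z.2) @^-1` C =
    \bigcup_o (A' o `*` (Q o @^-1` C)).
  apply/seteqP; split => [z Cz|z [k _ [Ao Co]]]; first by exists (idx z.1).
  by rewrite /= (idxE _ _ Ao).
have mrect o C : measurable C -> measurable (A' o `*` (Q o @^-1` C : set (measurableTypeR R))).
  by move=> mC; apply: measurableX => //; exact: mQC.
split.
- move=> _ C mC; rewrite setTI preE.
  by apply: fin_bigcup_measurable => [|o _]; [exact: finite_finset|exact: mrect].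
- move=> C mC; rewrite preE measure_fin_bigcup//; last by move=> o _; exact: mrect.
  + rewrite (_ : V @^-1` C = \bigcup_o (D' o `&` V @^-1` C)); last first.
      apply/seteqP; split => [w Cw|w [k _ []]//].
      by have [k Do] := covD w; exists k.
    rewrite measure_fin_bigcup//.
    * apply: eq_fsbigr => k _; transitivity (P (A' k) * U (Q k @^-1` C))%E; last exact: QE.
      exact: (product_measure1E P U (mA' k) (mQC k C mC)).
    * exact: finite_finset.
    * exact: trivIset_setIr.
    * move=> o _; apply: measurableI => //; rewrite -[X in measurable X]setTI; exact: mV.
  + exact: finite_finset.
  + by move=> o o' _ _ [z [[h1 _] [h2 _]]]; apply: tA' => //; exists z.1.
(* The exceptional set has the mass of the part of [D i] where [V] leaves [B i], and there is
   none. *)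
- exists (\bigcup_i (A i `*` (Q (Some i) @^-1` ~` (B i)))); split.
  + apply: fin_bigcup_measurable => [|i _]; first exact: finite_finset.
    by apply: (mrect (Some i)); exact: measurableC.
  + rewrite measure_fin_bigcup.
    * rewrite fsbig1// => i _; have mBC := measurableC (mB i).
      transitivity (P (A' (Some i)) * U (Q (Some i) @^-1` ~` B i))%E.
        exact: (product_measure1E P U (mA' (Some i)) (mQC (Some i) _ mBC)).
      rewrite QE// (_ : _ `&` _ = set0) ?measure0//.
      by apply/seteqP; split => // s [/DB].
    * exact: finite_finset.
    * by move=> i j _ _ [z [[h1 _] [h2 _]]]; apply: tA => //; exists z.1.
    * by move=> i _; apply: (mrect (Some i)); exact: measurableC.
  + move=> z /= /existsNP[i /not_implyP[Ai nB]]; exists i => //; split => //=.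
    by have := nB; rewrite (idxE _ (Some i) Ai).
Qed.

End Coupling.

(** * Encoding of fields as real numbers *)

Section TernaryCode.
Context {R : realType}.
Implicit Types (b : nat -> bool).

(** Digits 0 and 2 only: the first bit is read off by comparison with 2/3, since a sum starting with
    0 is at most 1/3. There are no ambiguous expansions. *)
Fixpoint ternary_sum (n : nat) b : R :=
  if n is n'.+1 then (2 * (b 0%N)%:R + ternary_sum n' (fun k => b k.+1)) / 3 else 0.

Lemma ternary_sum_itv n b : 0 <= ternary_sum n b <= 1.
Proof.
elim: n b => [|n IH] b /=; first by rewrite lexx ler01.
have /andP[h1 h2] := IH (fun k => b k.+1).
by case: (b 0%N) => /=; apply/andP; split; rewrite ?ler_pdivlMr ?ler_pdivrMr//; lra.
Qed.

Lemma ternary_sum_nondecreasing b : {homo ternary_sum^~ b : n m / (n <= m)%N >-> n <= m}.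
Proof.
apply/nondecreasing_seqP => n; elim: n b => [|n IH] b.
  by have /andP[] := ternary_sum_itv 1 b.
by rewrite [leLHS]/= [leRHS]/= ler_pM2r ?invr_gt0// lerD2l; exact: IH.
Qed.

Definition ternary b : R := limn (ternary_sum^~ b).

Lemma cvg_ternary b : ternary_sum n b @[n --> \oo] --> ternary b.
Proof.
apply: nondecreasing_is_cvgn; first exact: ternary_sum_nondecreasing.
by exists 1 => _ [n _ <-]; have /andP[] := ternary_sum_itv n b.
Qed.

Lemma ternary_itv b : 0 <= ternary b <= 1.
Proof.
apply/andP; split.
  apply: limr_ge; first exact: (cvgP _ (@cvg_ternary b)).
  by near=> n; have /andP[] := ternary_sum_itv n b.
apply: limr_le; first exact: (cvgP _ (@cvg_ternary b)).
by near=> n; have /andP[] := ternary_sum_itv n b.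
Unshelve. all: by end_near. Qed.

Lemma ternaryE b : ternary b = (2 * (b 0%N)%:R + ternary (fun k => b k.+1)) / 3.
Proof.
have h1 : ternary_sum n.+1 b @[n --> \oo] --> ternary b.
  by have := @cvg_ternary b; rewrite -(cvg_shiftS (ternary_sum^~ b)).
apply: (cvg_unique _ h1) => //=.
apply: cvgMl; apply: cvgD; [exact: cvg_cst|exact: cvg_ternary].
Qed.

Fixpoint digit (n : nat) (r : R) : bool :=
  if n is n'.+1 then digit n' (if 2 / 3 <= r then 3 * r - 2 else 3 * r) else 2 / 3 <= r.

Lemma digit_ternary n b : digit n (ternary b) = b n.
Proof.
elim: n b => [|n IH] b; have h : (2 / 3 <= ternary b) = b 0%N.
- have /andP[h1 h2] := ternary_itv (fun k => b k.+1).
  rewrite ternaryE ler_pM2r ?invr_gt0//.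
  by case: (b 0%N) => /=; [apply/idP|apply/negP/negP; rewrite -ltNge]; lra.
- exact: h.
- have /andP[h1 h2] := ternary_itv (fun k => b k.+1).
  rewrite ternaryE ler_pM2r ?invr_gt0//.
  by case: (b 0%N) => /=; [apply/idP|apply/negP/negP; rewrite -ltNge]; lra.
- rewrite /= h -[RHS](IH (fun k => b k.+1)); congr (digit n _).
  by rewrite [in LHS]ternaryE; case: (b 0%N) => /=; field.
Qed.

Lemma measurable_ternary d (T : measurableType d) (F : T -> nat -> bool) :
  (forall n, measurable_fun setT (fun w => F w n)) ->
  measurable_fun setT (fun w => ternary (F w)).
Proof.
move=> mF; apply: (@measurable_fun_cvg _ _ _ _ (fun n w => ternary_sum n (F w))).
  move=> n; elim: n F mF => [|n IH] F mF /=; first exact: measurable_cst.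
  apply: measurable_funM => //; apply: measurable_funD; last by apply: IH => k; exact: mF.
  apply: measurable_funM => //.
  rewrite (_ : (fun w => _) = (fun w => if F w 0%N then 1 else 0)); last first.
    by apply/funext => w; case: (F w 0%N).
  exact: measurable_fun_if.
by move=> w _; exact: cvg_ternary.
Qed.

Lemma measurable_digit n : measurable_fun setT (digit n).
Proof.
have m0 : measurable_fun setT (fun r : R => 2 / 3 <= r) by exact: measurable_fun_ler.
elim: n => [//|n IH].
apply: (@measurableT_comp _ _ _ _ _ _ (digit n)) => //.
have m3 : measurable_fun setT (fun r : R => 3 * r) by exact: measurable_funM.
have m2 : measurable_fun setT (fun r : R => 3 * r - 2) by exact: measurable_funB.
exact: measurable_fun_ifT.
Qed.

End TernaryCode.

(* A field is encoded by the ternary expansion, without the digit 1, of the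
indicators of the rationals below its values. *)
Section Code.
Context {R : realType} (I : countType).

Definition threshold_bit (x : I -> R) (n : nat) : bool :=
  if @unpickle (I * rat)%type n is Some p then ratr p.2 < x p.1 else false.

Definition encode (x : I -> R) : R := ternary (threshold_bit x).

(** A measurable left inverse of [encode] on all of R; the default value of [fine] occurs only off
    the range of [encode]. *)
Definition decode (r : R) (i : I) : R :=
  fine (ereal_sup [set (ratr q)%:E | q in [set q : rat | digit (pickle (i, q)) r]]).

Lemma measurable_encode d (T : measurableType d) (F : T -> I -> R) :
  random_function F -> measurable_fun setT (fun w => encode (F w)).
Proof.
move=> mF; apply: measurable_ternary => n; rewrite /threshold_bit.
case: unpickle => [p|]; last exact: measurable_cst.
exact: measurable_fun_ltr.
Qed.

Lemma random_function_decode : random_function decode.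
Proof.
move=> i; apply: (@measurableT_comp _ _ _ _ _ _ fine); first exact: fine_measurable.
apply: (measurability _ (ErealGenOInfty.measurableE R)) => //.
move=> _ [_ [a ->] <-]; rewrite setTI.
rewrite (_ : _ @^-1` _ = \bigcup_q [set r | digit (pickle (i, q)) r /\ (a < ratr q)%R]).
  apply: countable_bigcupT_measurable; first exact: countableP.
  move=> q; have [aq|aq] := ltP a (ratr q : R); last first.
    by rewrite (_ : [set r | _] = set0)//; apply/seteqP; split => // r [].
  have mt : measurable [set true] by [].
  have := @measurable_digit R (pickle (i, q)) measurableT [set true] mt.
  by rewrite setTI; congr measurable; apply/seteqP; split => r //= [].
apply/seteqP; split => r /=; rewrite in_itv/= andbT.
  by move=> /ereal_sup_gt[_ [q dq <-]]; rewrite lte_fin => aq; exists q.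
move=> [q _ [dq aq]]; apply: lt_le_trans (_ : ((ratr q)%:E <= _)%E); first by rewrite lte_fin.
by apply: ereal_sup_ubound; exists q.
Qed.

Lemma encodeK x : decode (encode x) = x.
Proof.
apply/funext => i; rewrite /decode (_ : ereal_sup _ = (x i)%:E)//.
have dE q : digit (pickle (i, q)) (encode x) = (ratr q < x i).
  by rewrite digit_ternary /threshold_bit pickleK.
apply/le_anti/andP; split.
  by apply: ge_ereal_sup => _ [q /= + <-]; rewrite dE lee_fin => /ltW.
rewrite leNgt; apply/negP => h.
set s := ereal_sup _ in h.
have [q hq1 hq2] : exists2 q : rat, (s < (ratr q)%:E)%E & ratr q < x i.
  case: s h => [s| |]; rewrite ?lte_fin//.
    move=> sx; have [q] := rat_in_itvoo sx; rewrite in_itv/= => /andP[sq qx].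
    by exists q; rewrite ?lte_fin.
  move=> _; have : x i - 1 < x i by rewrite gtrBl.
  by move=> /rat_in_itvoo[q]; rewrite in_itv/= => /andP[sq qx]; exists q; rewrite ?ltNyr.
move: hq1; apply/negP; rewrite -leNgt; apply: ereal_sup_ubound.
by exists q => //=; rewrite dE.
Qed.

End Code.

(** * Transport along a measure preserving map *)

Section Pullback.
Context {R : realType} d (T : measurableType d) (P : probability T R)
  d' (T' : measurableType d') (P' : probability T' R) (phi : T' -> T).
Hypotheses (mphi : measurable_fun setT phi)
  (Pphi : forall A, measurable A -> P' (phi @^-1` A) = P A).

Lemma random_function_comp dV (V : measurableType dV) (I : Type) (F : T -> I -> V) :
  random_function F -> random_function (F \o phi).
Proof. by move=> mF i; exact: (measurableT_comp (mF i) mphi). Qed.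

Lemma ae_comp (Q : T -> Prop) : {ae P, forall w, Q w} -> {ae P', forall w, Q (phi w)}.
Proof.
move=> [N [mN PN QN]]; exists (phi @^-1` N); split.
- by rewrite -[X in measurable X]setTI; exact: mphi.
- by rewrite Pphi.
- by move=> w /= nQ; apply: QN.
Qed.

Lemma measurable_cylinder dV (V : measurableType dV) (I : Type) (F : T -> I -> V)
    m (p : 'I_m -> I) (B : 'I_m -> set V) : random_function F ->
  (forall j, measurable (B j)) -> measurable [set w | forall j, B j (F w (p j))].
Proof.
move=> mF mB; apply: measurable_forall_fin => j.
by rewrite -[X in measurable X]setTI; exact: mF.
Qed.

Lemma same_law_comp dV (V : measurableType dV) (I : Type) (F : T -> I -> V) :
  random_function F -> same_law P' (F \o phi) P F.
Proof.
move=> mF m p B mB; rewrite -Pphi; first by [].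
exact: (measurable_cylinder p mF mB).
Qed.

Lemma same_law_trans (R0 : realType) dV (V : measurableType dV) (I : Type)
    d1 (T1 : measurableType d1) (P1 : probability T1 R0) (F1 : T1 -> I -> V)
    d2 (T2 : measurableType d2) (P2 : probability T2 R0) (F2 : T2 -> I -> V)
    d3 (T3 : measurableType d3) (P3 : probability T3 R0) (F3 : T3 -> I -> V) :
  same_law P1 F1 P2 F2 -> same_law P2 F2 P3 F3 -> same_law P1 F1 P3 F3.
Proof. by move=> h12 h23 m p B mB; rewrite h12//; exact: h23. Qed.

Lemma same_law_sym (R0 : realType) dV (V : measurableType dV) (I : Type)
    d1 (T1 : measurableType d1) (P1 : probability T1 R0) (F1 : T1 -> I -> V)
    d2 (T2 : measurableType d2) (P2 : probability T2 R0) (F2 : T2 -> I -> V) :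
  same_law P1 F1 P2 F2 -> same_law P2 F2 P1 F1.
Proof. by move=> h m p B mB; rewrite h. Qed.

(** Preimages of the sets of a sigma-algebra form one; independence can thus be read on the original
    space. *)
Lemma sigma_of_comp dV (V : measurableType dV) (I : Type) (F : T -> I -> V) (E : set T') :
  sigma_of (F \o phi) E -> exists2 A, sigma_of F A & E = phi @^-1` A.
Proof.
apply: (@smallest_sub _ _ _ [set E | exists2 A, sigma_of F A & E = phi @^-1` A]).
  have [s0 sC sU] := @smallest_sigma_algebra T setT [set E | exists i, exists2 B, measurable B & E = (fun w => F w i) @^-1` B].
  split.
  - by exists set0 => //; rewrite preimage_set0.
  - move=> _ [A sA ->]; exists (setT `\` A); first exact: sC.
    by rewrite !setTD preimage_setC.
  - move=> A sA; have {}sA n := cid2 (sA n).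
    exists (\bigcup_n s2val (sA n)); first by apply: sU => n; exact: (s2valP (sA n)).
    rewrite preimage_bigcup; apply: eq_bigcupr => n _; exact: (s2valP' (sA n)).
move=> _ [i [B mB ->]]; exists ((fun w => F w i) @^-1` B) => //.
by apply: sub_sigma_algebra; exists i, B.
Qed.

Lemma sigma_of_measurable dV (V : measurableType dV) (I : Type) (F : T -> I -> V) (A : set T) :
  random_function F -> sigma_of F A -> measurable A.
Proof.
move=> mF; apply: (@smallest_sub _ _ _ measurable).
  split; [exact: measurable0|by move=> B mB; rewrite setTD; exact: measurableC|].
  by move=> B mB; exact: bigcupT_measurable.
move=> _ [i [B mB ->]]; rewrite -[X in measurable X]setTI; exact: mF.
Qed.

Lemma independent_comp dV (V : measurableType dV) (I : choiceType) (J : Type)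
    (F : I -> T -> J -> V) : (forall i, random_function (F i)) ->
  independent P (fun i => sigma_of (F i)) ->
  independent P' (fun i => sigma_of (F i \o phi)).
Proof.
move=> mF ind s E us GE; have {}GE i := cid2 (sigma_of_comp (GE i)).
have mA i := sigma_of_measurable (mF i) (s2valP (GE i)).
have EA i : E i = phi @^-1` s2val (GE i) by exact: (s2valP' (GE i)).
have := ind s (fun i => s2val (GE i)) us (fun i => s2valP (GE i)).
rewrite -Pphi; last by apply: fin_bigcap_measurable.
rewrite preimage_bigcap => h.
rewrite (_ : \bigcap_(i in _) E i = \bigcap_(i in [set` s]) phi @^-1` s2val (GE i)); last first.
  by apply: eq_bigcapr => i _; exact: EA.
rewrite h; apply: eq_bigr => i _; rewrite -Pphi; last exact: mA.
by congr (P' _); exact/esym/EA.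
Qed.

(** The line ensemble lives on a space of its own, tied to the sheet only through the law of [S'],
    so the same witnesses serve. *)
Lemma airy_sheet_comp (S : T -> R * R -> R) : airy_sheet P S -> airy_sheet P' (S \o phi).
Proof.
move=> [mS cS sS [d1 [T1 [P1 [S' [A [mS' cS' sS' hA hSA]]]]]]]; split.
- exact: random_function_comp.
- by move=> w; exact: cS.
- move=> t; have mt : random_function (fun w q => S w (q.1 + t, q.2 + t)) by move=> q; exact: mS.
  apply: (same_law_trans (same_law_comp mt)).
  exact: (same_law_trans (sS t) (same_law_sym (same_law_comp mS))).
- exists d1, T1, P1, S', A; split => //.
  exact: (same_law_trans sS' (same_law_sym (same_law_comp mS))).
Qed.

Lemma directed_landscape_comp (L : T -> (R * R) * (R * R) -> \bar R) :
  directed_landscape P L -> directed_landscape P' (L \o phi).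
Proof.
move=> [mL [L1 L2 L3] L4 L5]; split.
- exact: random_function_comp.
- by split => [w|w|w]; [exact: L1|exact: L2|exact: L3].
- move=> k s t st disj; have [h1 h2] := L4 k s t st disj; split.
    move=> i; have [S aS hS] := h1 i.
    by exists (S \o phi) => [|w q]; [exact: airy_sheet_comp|exact: hS].
  apply: (@independent_comp _ _ _ _ (fun i w => time_slice (L w) (s i) (t i))) => //.
  by move=> i q; exact: mL.
- exact: (ae_comp L5).
Qed.

End Pullback.

Section FieldCoupling.
Context {R : realType} d (T : measurableType d) (P : probability T R) (K : countType)
  (X : T -> K -> R) d1 (T1 : measurableType d1) (P1 : probability T1 R).
Local Notation U := (uniform_prob (@ltr01 R)).
Local Notation mR := (measurableTypeR R).
Local Notation PU := ((P1 \x U) \x U)%E.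
Hypotheses (mX : random_function X) (X0 : forall w z, 0 <= X w z).

Lemma measurable_nonneg d2 (T2 : measurableType d2) (F : T2 -> K -> R) :
  random_function F -> measurable [set w | forall z, 0 <= F w z].
Proof.
move=> mF; rewrite (_ : [set w | _] = ~` \bigcup_z ~` [set w | 0 <= F w z]); last first.
  apply/seteqP; split => [w H [z _]|w H z]; first by apply; exact: H.
  by apply: contrapT => h; apply: H; exists z.
apply: measurableC; apply: countable_bigcupT_measurable; first exact: countableP.
move=> z; apply: measurableC.
have := mF z measurableT `[0, +oo[%classic (measurable_itv _).
by rewrite setTI; congr measurable; apply/seteqP; split => w /=; rewrite in_itv/= andbT.
Qed.

Lemma product_setT d2 (T2 : measurableType d2) (P2 : probability T2 R) (A : set T2) :
  measurable A -> (P2 \x U)%E (fst @^-1` A) = P2 A.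
Proof.
move=> mA; rewrite (_ : fst @^-1` A = A `*` [set: mR]); last first.
  by apply/seteqP; split => [z|z []].
transitivity (P2 A * U [set: mR])%E.
  exact: (product_measure1E P2 U mA measurableT).
by rewrite [X in (_ * X)%E](probability_setT U) mule1.
Qed.

(** [P (S i)] may exceed (1 - eps) P1 (A i), so both sides are thinned by independent uniform
    variables to equal masses before the partition coupling. The thinning on the landscape side,
    z.1.2 <= 1 - eps, is the same for all [i] and for all fields coupled at this level. *)
Lemma field_coupling (eps : R) (I : finType) (A : I -> set T1) (S : I -> set (K -> R)) :
  0 <= eps <= 1 -> (forall i, measurable (A i)) -> trivIset setT A -> trivIset setT S ->
  (forall i d2 (T2 : measurableType d2) (F : T2 -> K -> R),
    random_function F -> measurable [set w | S i (F w)]) ->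
  (forall i, ((1 - eps)%:E * P1 (A i) <= P [set w | S i (X w)])%E) ->
  exists X' : (T1 * mR) * mR -> K -> R, [/\ random_function X', same_law PU X' P X &
    {ae PU, forall z, forall i, A i z.1.1 -> z.1.2 <= 1 - eps ->
      S i (X' z) /\ forall x, 0 <= X' z x}].
Proof.
move=> /andP[eps0 eps1] mA tA tS mS PS.
pose D i := [set w | S i (X w)]; have mD i : measurable (D i) by exact: mS.
pose a i := fine (P1 (A i)); pose p i := fine (P (D i)).
have aE i : P1 (A i) = (a i)%:E by rewrite fineK// fin_num_measure.
have pE i : P (D i) = (p i)%:E by rewrite fineK// fin_num_measure.
have a0 i : 0 <= a i by rewrite fine_ge0.
have p0 i : 0 <= p i by rewrite fine_ge0.
have ap i : (1 - eps) * a i <= p i by have := PS i; rewrite -/(D i) aE pE -EFinM lee_fin.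
have e1 : 0 <= 1 - eps <= 1 by apply/andP; split; lra.
have ea0 i : 0 <= (1 - eps) * a i by rewrite mulr_ge0// subr_ge0.
(* The fraction of [D i] to keep. If [p i] vanishes, so does (1 - eps) [a i], and the value 0 of the
   quotient is right. *)
pose c i := (1 - eps) * a i / p i.
have cp i : p i * c i = (1 - eps) * a i.
  have [pi0|pi0] := eqVneq (p i) 0; last by rewrite /c mulrC divfK.
  by rewrite pi0 mul0r; apply/le_anti; rewrite ea0/= -[leRHS]pi0 ap.
have c01 i : 0 <= c i <= 1.
  rewrite divr_ge0//=; have [pi0|pi0] := eqVneq (p i) 0; first by rewrite /c pi0 invr0 mulr0.
  by rewrite ler_pdivrMr ?mul1r// lt0r pi0 p0.
pose A' i : set (T1 * mR) := A i `*` `]-oo, 1 - eps]%classic.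
pose D' i : set (T * mR) := D i `*` `]-oo, c i]%classic.
(* Nonnegativity is carried along in the code: equality of laws alone would give it only almost
   surely and by a further argument. *)
pose B i := [set r | S i (decode r) /\ forall x : K, 0 <= decode r x].
have mB i : measurable (B i).
  apply: measurableI; first by apply: mS; exact: random_function_decode.
  exact: measurable_nonneg (@random_function_decode R K).
pose V (w : T * mR) := encode (X w.1).
have mV : measurable_fun setT V.
  by apply: (measurableT_comp (measurable_encode mX)); exact: measurable_fst.
have mA' i : measurable (A' i) by apply: measurableX.
have mD' i : measurable (D' i) by apply: measurableX.
have tA' : trivIset setT A'.
  by move=> i j _ _ [z [[h1 _] [h2 _]]]; apply: tA => //; exists z.1.
have tD' : trivIset setT D'.
  by move=> i j _ _ [z [[h1 _] [h2 _]]]; apply: tS => //; exists (X z.1).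
have AD i : (P1 \x U)%E (A' i) = (P \x U)%E (D' i).
  transitivity (P1 (A i) * U `]-oo, (1 - eps)%R]%classic)%E.
    exact: (product_measure1E P1 U (mA i) (measurable_itv _)).
  transitivity (P (D i) * U `]-oo, c i]%classic)%E; last first.
    by apply/esym; exact: (product_measure1E P U (mD i) (measurable_itv _)).
  rewrite [X in (_ * X)%E = _]uniform_prob_Nyc// [X in _ = (_ * X)%E]uniform_prob_Nyc//.
  by rewrite aE pE -!EFinM cp mulrC.
have DB i : D' i `<=` V @^-1` B i.
  by move=> z [Dz _]; rewrite /B /V /= encodeK; split => // x; exact: X0.
have [Z [mZ lawZ aeZ]] := partition_coupling mV mA' mD' mB tA' tD' AD DB.
exists (fun z => decode (Z z)); split.
- by move=> x; exact: (measurableT_comp (@random_function_decode R K x) mZ).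
- move=> m q C mC.
  have := lawZ [set r | forall j, C j (decode r (q j))].
  rewrite (_ : V @^-1` _ = fst @^-1` [set w | forall j, C j (X w (q j))]); last first.
    by apply/seteqP; split => w /= H j; have := H j; rewrite /V encodeK.
  move=> h; apply: (etrans (h _)).
    exact: (measurable_cylinder q (@random_function_decode R K) mC).
  exact: (product_setT P (measurable_cylinder q mX mC)).
- move: aeZ; apply: filterS => z H i Az ze.
  by apply: H; split => //=; rewrite in_itv.
Qed.

End FieldCoupling.

Lemma ae_imp {R : realType} d (T : measurableType d) (mu : {measure set T -> \bar R})
    (Q Q' : T -> Prop) : (forall w, Q w -> Q' w) ->
  {ae mu, forall w, Q w} -> {ae mu, forall w, Q' w}.
Proof.
by move=> QQ [N [mN N0 QN]]; exists N; split => // w /= nQ'; apply: QN => /= /QQ.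
Qed.

Lemma ae_imp2 {R : realType} d (T : measurableType d) (mu : {measure set T -> \bar R})
    (Q1 Q2 Q' : T -> Prop) : (forall w, Q1 w -> Q2 w -> Q' w) ->
  {ae mu, forall w, Q1 w} -> {ae mu, forall w, Q2 w} -> {ae mu, forall w, Q' w}.
Proof.
move=> QQ [N1 [m1 N10 Q1N]] [N2 [m2 N20 Q2N]]; exists (N1 `|` N2); split.
- exact: measurableU.
- apply/eqP; rewrite eq_le measure_ge0 andbT.
  by apply: le_trans (measureU2 mu m1 m2) _; rewrite [X in (X + _)%E]N10 [X in (_ + X)%E]N20 adde0.
- move=> w /= nQ'; apply: contrapT => /not_orP[n1 n2]; apply: nQ'; apply: QQ.
    by apply: contrapT => h; apply: n1; exact: Q1N.
  by apply: contrapT => h; apply: n2; exact: Q2N.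
Qed.

Lemma compact_fin_bounded {R : realType} (L : (R * R) * (R * R) -> \bar R)
    (K : set ((R * R) * (R * R))) : compact K ->
  (forall u, K u -> L u \is a fin_num /\ {for u, continuous L}) ->
  exists B : R, forall u, K u -> exists2 a : R, L u = a%:E & `|a| <= B.
Proof.
move=> /compact_near_coveringP cK finK.
have [N _ HN] : \forall n \near \oo, K `<=` [set u | exists2 a : R, L u = a%:E & `|a| <= n%:R].
  apply: (cK nat \oo (fun n u => exists2 a : R, L u = a%:E & `|a| <= n%:R) _) => u Ku.
  have [fu cu] := finK u Ku; pose l := fine (L u).
  have V : nbhs (L u) [set y | exists2 a : R, y = a%:E & `|a| <= `|l| + 1].
    rewrite -(fineK fu) -/l.
    change (nbhs l [set a' : R | exists2 a : R, a'%:E = a%:E & `|a| <= `|l| + 1]).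
    apply/nbhs_ballP; exists 1 => //= y; rewrite -ball_normE/= => ly; exists y => //.
    by have := ler_normD l (y - l); rewrite addrC subrK [`|y - l|]distrC; lra.
  exists ([set v | exists2 a : R, L v = a%:E & `|a| <= `|l| + 1],
          [set n | (Num.truncn (`|l| + 1) <= n.-1)%N /\ (0 < n)%N]).
    split; first exact: cu V.
    by exists (Num.truncn (`|l| + 1)).+1 => // n /= ln; split; [rewrite -ltnS prednK|];
      exact: leq_trans ln.
  move=> [v n] /= [[a va al] [ln n0]]; exists a => //.
  apply: (le_trans al); apply/ltW/(lt_le_trans (truncnS_gt _)); rewrite ler_nat.
  by rewrite -(prednK n0) ltnS.
by exists N%:R; apply: HN => /=.
Qed.

(** On a compact set [L] is bounded by some [B], so [contract_close_fin] applies with one threshold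
    for all points. *)
Lemma cvg_uniformly_of_contract {R : realType} (D : nat -> (R * R) * (R * R) -> \bar R)
    (L : (R * R) * (R * R) -> \bar R) :
  (forall u, R4up u -> L u \is a fin_num /\ {for u, continuous L}) ->
  (forall M th : R, 0 < M -> 0 < th -> \forall n \near \oo, forall u, band M u ->
     `|contract (D n u) - contract (L u)| <= th) ->
  cvg_uniformly_on_compacts D L.
Proof.
move=> finL DL K cK KR e e0; have [M M0 KM] := compact_band cK KR.
have [B HB] := compact_fin_bounded cK (fun u Ku => finL u (KR u Ku)).
have [K0|K0] := pselect (K !=set0); last first.
  by near=> n => u Ku; case: K0; exists u.
have B0 : 0 <= B by have [u /HB[a _]] := K0; exact: le_trans.
pose th := e / (1 + B + e) ^+ 2.
have th0 : 0 < th by rewrite divr_gt0// exprn_gt0//; lra.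
have [N _ HN] := DL M (th / 2) M0 (divr_gt0 th0 (ltr0Sn _ 1)).
exists N => // n /HN Hn u Ku; have [a La aB] := HB u Ku.
rewrite La; apply: (contract_close_fin aB e0).
by rewrite -La; apply: le_lt_trans (Hn u (KM u Ku)) _; rewrite ltr_pdivrMr// ltr_pMr// ltr1n.
Unshelve. all: by end_near. Qed.

(** * Levels of accuracy and the Borel-Cantelli lemma *)

Section LevelCoupling.
Context {R : realType} d (T : measurableType d) (P : probability T R)
  (X : T -> int * int -> R) d1 (T1 : measurableType d1) (P1 : probability T1 R)
  (L : T1 -> (R * R) * (R * R) -> \bar R).
Variables (rho alpha beta chi tau : R) (delta C : R) (n0 : nat).
Local Notation dn := (rescaled_lpp rho alpha beta chi tau).
Local Notation U := (uniform_prob (@ltr01 R)).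
Local Notation mR := (measurableTypeR R).
Local Notation PU := ((P1 \x U) \x U)%E.
Hypotheses (iidX : iid P X) (X0 : forall w z, 0 <= X w z) (rho0 : 0 < rho) (alpha0 : 0 <= alpha)
  (beta0 : 0 <= beta) (chi0 : 0 < chi) (tau0 : 0 < tau)
  (delta0 : 0 < delta) (C0 : 0 <= C)
  (momentX : forall n, (n0 <= n)%N -> forall x : R, -3 <= x <= 3 ->
    (negative_part_moment P (5 + delta)%R (fun w => dn n (X w) ((0, 0), (x, 1))%R) <= C%:E)%E)
  (mL : forall u, measurable_fun setT (fun w => L w u))
  (cL : forall w u, R4up u -> {for u, continuous (fun u => contract (L w u))})
  (cvgD : multi_time_cvg P (fun n w => dn n (X w)) P1 L).

Lemma level_coupling (k : nat) : exists G : set (T1 * mR),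
  [/\ measurable G, ((P1 \x U)%E (~` G) <= (2 / (2 ^ k.+1)%:R)%:E)%E &
  exists N : nat, forall n, (N <= n)%N -> exists X' : (T1 * mR) * mR -> int * int -> R,
  [/\ random_function X', same_law PU X' P X &
    {ae PU, forall z, G z.1 -> forall u, band k.+1%:R u ->
      `|contract (dn n (X' z) u) - contract (L z.1.1 u)| <= k.+1%:R^-1}]].
Proof.
(* [G] requires a cell of the landscape and the thinning, each failing with probability at most
   [eps]; hence the 2 in the bound. *)
pose eps : R := 1 / (2 ^ k.+1)%:R.
have q0 : 0 < (2 ^ k.+1)%:R :> R by rewrite ltr0n expn_gt0.
have eps0 : 0 < eps by rewrite divr_gt0.
have eps1 : eps <= 1 by rewrite ler_pdivrMr// mul1r ler1n expn_gt0.
have k0 : 0 < (k.+1%:R : R) by rewrite ltr0n.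
have ki : 0 < (k.+1%:R : R)^-1 by rewrite invr_gt0.
have [mX _ _] := iidX.
have [I [A [mA tA PA [N HN]]]] := closeness iidX rho0 alpha0 beta0 chi0 tau0 delta0 C0 momentX mL cL cvgD k0 ki eps0.
have mUA : measurable (\bigcup_i A i) by apply: fin_bigcup_measurable => //; exact: finite_finset.
have mG : measurable ((\bigcup_i A i) `*` `]-oo, 1 - eps]%classic : set (T1 * mR)).
  exact: measurableX.
exists ((\bigcup_i A i) `*` `]-oo, 1 - eps]%classic); split => //.
  rewrite probability_setC//.
  have GE : (P1 \x U)%E ((\bigcup_i A i) `*` `]-oo, (1 - eps)%R]%classic) =
      (P1 (\bigcup_i A i) * (1 - eps)%:E)%E.
    transitivity (P1 (\bigcup_i A i) * U `]-oo, (1 - eps)%R]%classic)%E.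
      exact: (product_measure1E P1 U mUA (measurable_itv _)).
    by congr (_ * _)%E; apply: uniform_prob_Nyc; apply/andP; split; lra.
  rewrite [X in (1 - X)%E]GE.
  move: PA; rewrite -(fineK (fin_num_measure P1 _ mUA)) -EFinM -EFinB !lee_fin.
  set p := fine _ => hp.
  have h2 : (1 - eps) * (1 - eps) <= p * (1 - eps) by rewrite ler_wpM2r// subr_ge0.
  have -> : 2 / (2 ^ k.+1)%:R = 2 * eps by rewrite /eps; field; rewrite gt_eqF.
  by nra.
exists N => n /HN[S [tS mS PS close]].
have e01 : 0 <= eps <= 1 by rewrite (ltW eps0).
have [X' [mX' lX' aeX']] := field_coupling mX X0 e01 mA tA tS mS PS.
exists X'; split => //; apply: ae_imp aeX' => z H [[i _ Ai] ze].
rewrite /= in_itv/= in ze.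
by have [Si Xz0] := H i Ai ze; exact: (close i z.1.1 (X' z) Ai Si Xz0).
Qed.

Lemma almost_sure_coupling : exists X' : nat -> (T1 * mR) * mR -> int * int -> R,
  (forall n, random_function (X' n) /\ same_law PU (X' n) P X) /\
  {ae PU, forall z, forall M th : R, 0 < M -> 0 < th -> \forall n \near \oo,
    forall u, band M u -> `|contract (dn n (X' n z) u) - contract (L z.1.1 u)| <= th}.
Proof.
have [mX _ _] := iidX.
have /choice[G HG] := level_coupling.
have mG k : measurable (G k) by have [] := HG k.
have PG k : ((P1 \x U)%E (~` G k) <= (2 / (2 ^ k.+1)%:R)%:E)%E by have [] := HG k.
have /choice[N HN] : forall k, exists N : nat, forall n, (N <= n)%N ->
    exists X' : (T1 * mR) * mR -> int * int -> R,
    [/\ random_function X', same_law PU X' P X &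
    {ae PU, forall z, G k z.1 -> forall u, band k.+1%:R u ->
      `|contract (dn n (X' z) u) - contract (L z.1.1 u)| <= k.+1%:R^-1}].
  by move=> k; have [] := HG k.
(* The highest level already available at index [n]. It tends to infinity, since [k <= lev n] as
   soon as n is at least [k] and [N k]. *)
pose lev (n : nat) := (\max_(k < n.+1 | (N k <= n)%N) k)%N.
have lev_ge k n : (maxn k (N k) <= n)%N -> (k <= lev n)%N /\ (N (lev n) <= n)%N.
  rewrite geq_max => /andP[kn Nn].
  have k1 : (k < n.+1)%N by [].
  have Pk : (N (Ordinal k1) <= n)%N by [].
  split; first exact: (@leq_bigmax_cond _ (fun i : 'I_n.+1 => (N i <= n)%N) (fun i => val i) (Ordinal k1)).
  have c0 : (0 < #|[pred i : 'I_n.+1 | (N i <= n)%N]|)%N.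
    by apply/card_gt0P; exists (Ordinal k1).
  have [i iP levE] := eq_bigmax_cond (fun i : 'I_n.+1 => val i) c0.
  have -> : lev n = val i by rewrite -levE.
  exact: iP.
have Xex n : exists X' : (T1 * mR) * mR -> int * int -> R,
    [/\ random_function X', same_law PU X' P X &
    (N (lev n) <= n)%N -> {ae PU, forall z, G (lev n) z.1 -> forall u, band (lev n).+1%:R u ->
      `|contract (dn n (X' z) u) - contract (L z.1.1 u)| <= (lev n).+1%:R^-1}].
  have [Nn|nN] := boolP (N (lev n) <= n)%N.
    by have [X' [h1 h2 h3]] := HN _ _ Nn; exists X'.
  (* For small [n] no level may be available and the maximum is the default 0; any field with the
     law of [X] will do, and the coupling over an empty index set provides one. *)
  have z01 : (0 : R) <= (0 : R) <= 1 by rewrite lexx ler01.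
  have [X' [h1 h2 _]] := @field_coupling R _ T P _ X _ T1 P1 mX X0 0 'I_0 (fun=> set0) (fun=> set0) z01
    (fun=> measurable0) (fun i => match i with Ordinal _ h => ltac:(by []) end)
    (fun i => match i with Ordinal _ h => ltac:(by []) end)
    (fun i => match i with Ordinal _ h => ltac:(by []) end)
    (fun i => match i with Ordinal _ h => ltac:(by []) end).
  by exists X'.
have {Xex}/choice[X' HX'] := Xex.
exists X'; split; first by move=> n; have [] := HX' n.
(* One bad event per level, shared by all [n] of that level: this is what makes the probabilities
   summable. *)
pose F k : set ((T1 * mR) * mR) := fst @^-1` (~` G k).
have mF k : measurable (F k).
  have := @measurable_fst _ _ (T1 * mR)%type mR measurableT (~` G k) (measurableC (mG k)).
  by rewrite setTI.
have PF : (PU (lim_sup_set F) = 0)%E.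
  apply: lim_sup_set_cvg0 => //.
  apply: (@le_lt_trans _ _ 2%:E); last exact: ltry.
  apply: (le_trans _ (@epsilon_trick0 R 2 xpredT (ler0n _ _))).
  apply: lee_nneseries => // k _; apply: le_trans (PG k).
  by rewrite [X in (X <= _)%E](product_setT _ (measurableC (mG k))).
have aeF : {ae PU, forall z, exists K, forall k, (K <= k)%N -> G k z.1}.
  exists (lim_sup_set F); split => //.
    apply: bigcap_measurableType => n _; exact: bigcup_measurable.
  move=> z /= nK n _; apply: contrapT => nF; apply: nK; exists n => k nk.
  by apply: contrapT => nG; apply: nF; exists k.
have aeX : {ae PU, forall z, forall n, (N (lev n) <= n)%N -> G (lev n) z.1 ->
    forall u, band (lev n).+1%:R u ->
      `|contract (dn n (X' n z) u) - contract (L z.1.1 u)| <= (lev n).+1%:R^-1}.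
  apply: ae_foralln => n; have [_ _ h] := HX' n.
  have [Nn|nN] := boolP (N (lev n) <= n)%N; last by apply: aeW.
  by apply: ae_imp (h Nn) => z hz _.
(* Given [M] and [th], wait until the level exceeds M, 1 / th and the last bad level. *)
apply: ae_imp2 aeX aeF => z Hz [K HK] M th M0 th0.
pose k := maxn K (maxn (Num.truncn M) (Num.truncn th^-1)).
exists (maxn k (N k)) => // n /lev_ge[kl Nl] u Mu.
have k1 : (K <= lev n)%N by apply: leq_trans kl; rewrite leq_maxl.
have Ml : M < (lev n).+1%:R.
  apply: lt_le_trans (truncnS_gt _) _; rewrite ler_nat ltnS; apply: leq_trans kl.
  by rewrite /k leq_max leq_maxl orbT.
have tl : (lev n).+1%:R^-1 <= th.
  rewrite -[leRHS]invrK lef_pV2 ?posrE ?invr_gt0//.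
  apply/ltW/(lt_le_trans (truncnS_gt _)); rewrite ler_nat ltnS; apply: leq_trans kl.
  by rewrite /k leq_max leq_maxr orbT.
apply: le_trans tl; apply: Hz => //; first exact: HK.
exact: (closed_band_band M0 Ml (band_closed_band Mu)).
Qed.

End LevelCoupling.

Theorem theorem1p17 (R : realType)
    (d : measure_display) (T : measurableType d) (P : probability T R)
    (X : T -> int * int -> R)
    (d1 : measure_display) (T1 : measurableType d1) (P1 : probability T1 R)
    (L : T1 -> (R * R) * (R * R) -> \bar R)
    (rho alpha beta chi tau : R) :
  iid P X ->
  (forall w z, 0 <= X w z) ->
  0 < rho -> 0 < alpha -> 0 < beta -> 0 < chi -> 0 < tau ->
  directed_landscape P1 L ->
  multi_time_cvg P (fun n w => rescaled_lpp rho alpha beta chi tau n (X w)) P1 L ->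
  (exists delta : R, 0 < delta /\
    (limn_esup (fun n : nat =>
       ereal_sup [set negative_part_moment P (5 + delta)%R
                        (fun w => rescaled_lpp rho alpha beta chi tau n (X w) u)
                 | u in segment_U]) < +oo)%E) ->
  exists (d' : measure_display) (T' : measurableType d') (P' : probability T' R)
         (X' : nat -> T' -> int * int -> R)
         (L' : T' -> (R * R) * (R * R) -> \bar R),
    [/\ (forall n, random_function (X' n) /\ same_law P' (X' n) P X),
        directed_landscape P' L',
        same_law P' L' P1 L &
        {ae P', forall w,
          cvg_uniformly_on_compacts
            (fun n => rescaled_lpp rho alpha beta chi tau n (X' n w)) (L' w)}].
Proof.
move=> iidX X0 rho0 alpha0 beta0 chi0 tau0 landL cvgD [delta [delta0 momU]].
have [C [n0 [C0 momC]]] := limn_esup_bounded momU.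
have momX n : (n0 <= n)%N -> forall x : R, -3 <= x <= 3 ->
    (negative_part_moment P (5 + delta)%R (fun w => rescaled_lpp rho alpha beta chi tau n (X w)
      ((0, 0), (x, 1))%R) <= C%:E)%E.
  move=> nn x x3; apply: le_trans (momC n nn); apply: ereal_sup_ubound.
  by exists ((0, 0), (x, 1)) => //; exists x => //=; rewrite in_itv.
have [mL [finL L2 L3] L4 L5] := landL.
have cL w u : R4up u -> {for u, continuous (fun u => contract (L w u))}.
  move=> /(finL w)[_ cu]; exact: continuous_comp cu (@continuous_contract R _).
have [X' [hX' close]] := almost_sure_coupling iidX X0 rho0 (ltW alpha0) (ltW beta0) chi0 tau0
  delta0 (ltW C0) momX mL cL cvgD.
pose U := uniform_prob (@ltr01 R); pose mR := measurableTypeR R.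
pose PU : probability ((T1 * mR) * mR)%type R := ((P1 \x U) \x U)%E.
(* The coupled landscape is the given one, read on the product with two uniform variables. *)
pose phi (z : (T1 * mR) * mR) := z.1.1.
have mphi : measurable_fun setT phi.
  by apply: (measurableT_comp _ measurable_fst); exact: measurable_fst.
have Pphi A : measurable A -> PU (phi @^-1` A) = P1 A.
  move=> mA; have mA' : measurable (fst @^-1` A : set (T1 * mR)).
    by have := @measurable_fst _ _ T1 mR measurableT A mA; rewrite setTI.
  by transitivity ((P1 \x U)%E (fst @^-1` A)); [exact: (product_setT _ mA')|exact: product_setT].
exists _, ((T1 * mR) * mR)%type, PU, X', (L \o phi); split => //.
- exact: (directed_landscape_comp mphi Pphi landL).
- exact: (same_law_comp Pphi mL).
- apply: ae_imp close => z Hz; apply: cvg_uniformly_of_contract => //.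
  by move=> u; exact: finL.
Qed.
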